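(* Let $M$ be a $\sigma$-module over $\Gamma^{\mathrm{alg}}[p^{-1}]$ (resp. over $\Gamma^{\mathrm{alg}}_{\mathrm{con}}[p^{-1}]$). Assume $q^s\in\mathbb{Q}$ for every Frobenius slope (resp. every generic Frobenius slope) $s$ of $M$. Then $M$ has a generic cyclic vector.
   Context: $K$ is a complete discrete valuation field of characteristic $0$, residue field $k_K$ of characteristic $p$, uniformizer $\pi_K$, $|p|=p^{-1}$; $q$ a power of $p$, $\sigma$ a $q$-Frobenius lift on $\mathcal{O}_K$ extended with $\sigma(x)\equiv x^q\bmod\pi_K$. $\mathcal{E}$ is the field of series $\sum_{n\in\mathbb{Z}}a_nx^n$ over $K$ (bounded coefficients, $|a_n|\to0$ as $n\to-\infty$). $\Gamma^{\mathrm{alg}}$ is the ring of integers of the completion of the maximal unramified extension of $\varinjlim(\mathcal{E}\xrightarrow\sigma\mathcal{E}\to\cdots)$; $\Gamma^{\mathrm{alg}}[p^{-1}]$ is a complete discretely valued field with norm $|\cdot|_1$ and residue field $k_K(\!(x)\!)^{\mathrm{alg}}$ (valuation $v$, $v(x)=1$), and $\sigma$ extends to it. Writing $f=\sum_{i\gg-\infty}\pi_K^i[\bar x_i]$ (Teichmüller lifts), $v_n(f)=\min_{i\le n}v(\bar x_i)$; $\Gamma^{\mathrm{alg}}_r=\{f\in\Gamma^{\mathrm{alg}}: rv_n(f)+n\to\infty\}$, and $\Gamma^{\mathrm{alg}}_{\mathrm{con}}=\bigcup_{r>0}\Gamma^{\mathrm{alg}}_r$ (a $\sigma$-stable subring).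 A $\sigma$-module over a ring $R$ is a finite free $R$-module $M$ with an $R$-linear isomorphism $\varphi:\sigma^*M\to M$ (equivalently a $\sigma$-semilinear bijective-on-basis endomorphism). Slopes over a complete discretely valued field $F$: $N$ is étale if it has an $\mathcal{O}_F$-lattice stable under $\varphi$ and generated by its image; pure of slope $\lambda$ if $(N,\alpha^{-1}\varphi^m)$ is étale for some $m>0$, $\alpha\in F$ with $\log_{q^m}|\alpha|=-\lambda$; the Frobenius slopes are the breaks of the unique filtration with pure graded pieces. A generic Frobenius slope of a $\sigma$-module $M$ over $\Gamma^{\mathrm{alg}}_{\mathrm{con}}[p^{-1}]$ is a Frobenius slope of $\Gamma^{\mathrm{alg}}[p^{-1}]\otimes M$. Notation $q^s\in\mathbb{Q}$: writing $s=a/b$ in lowest terms, $b$ divides $\log_pq$ (then $q^s:=p^{a\log_pq/b}$). For $R=\Gamma^{\mathrm{alg}}[p^{-1}]$ or $\Gamma^{\mathrm{alg}}_{\mathrm{con}}[p^{-1}]$ and $M$ of rank $n$, $e\in M$ is a cyclic vector if $e,\varphi(e),\dots,\varphi^{n-1}(e)$ is an $R$-basis; then $\varphi^n(e)=-(a_{n-1}\varphi^{n-1}(e)+\cdots+a_0e)$ uniquely, and $f_e(\sigma)=a_0+a_1\sigma+\cdots+a_{n-1}\sigma^{n-1}+\sigma^n$ (with $a_n=1$). The Newton polygon of $\sum a_i\sigma^i$ is the lower convex hull boundary of $\{(i,-\log_q|a_i|_1)\}$; $e$ is generic if every point $(i,-\log_q|a_i|_1)$, $0\le i\le n$, lies on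 this Newton polygon. *)

(* Defs.v *)
From HB Require Import structures.
From mathcomp Require Import all_boot all_order all_algebra all_field.
From mathcomp Require Import all_classical all_reals all_analysis.

Set Implicit Arguments.
Unset Strict Implicit.
Unset Printing Implicit Defensive.

Import Order.TTheory GRing.Theory Num.Theory.
Import numFieldNormedType.Exports.

Local Open Scope classical_set_scope.
Local Open Scope ring_scope.

(* Absolute values take values in a model R of the real numbers; O_F is the
   set [absF a <= 1] and its maximal ideal the set [absF a < 1]. *)

Record ultrametric_abs (R : realType) (F : fieldType) (absF : F -> R) : Prop :=
  UltrametricAbs {
    abs_ge0 : forall a, 0 <= absF a;
    abs_eq0 : forall a, absF a = 0 <-> a = 0;
    absM : forall a b, absF (a * b) = absF a * absF b;
    absD : forall a b, absF (a + b) <= Num.max (absF a) (absF b) }.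

Definition abs_complete (R : realType) (F : fieldType) (absF : F -> R) : Prop :=
  forall u : nat -> F,
    (forall e : R, 0 < e -> exists N, forall m n,
       (N <= m)%N -> (N <= n)%N -> absF (u m - u n) < e) ->
    exists l : F, absF (u n - l) @[n --> \oo] --> (0 : R).

Definition is_uniformizer (R : realType) (F : fieldType) (absF : F -> R)
    (pi : F) : Prop :=
  0 < absF pi < 1 /\
  forall a, a != 0 -> exists z : int, absF a = absF pi ^ z.

Definition is_complete_dvf (R : realType) (F : fieldType) (absF : F -> R)
    (pi : F) : Prop :=
  [/\ ultrametric_abs absF, abs_complete absF & is_uniformizer absF pi].

Definition frobenius_lift (R : realType) (F : fieldType) (absF : F -> R)
    (q : nat) (s : F -> F) : Prop :=
  forall a, absF a <= 1 -> absF (s a) <= 1 /\ absF (s a - a ^+ q) < 1.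

(* A residue field is given through its reduction map [res], which is only
   meaningful on O_F; these axioms determine (k, res) up to isomorphism. *)
Record residue_map (R : realType) (F : fieldType) (absF : F -> R)
    (k : fieldType) (res : F -> k) : Prop := ResidueMap {
  res1 : res 1 = 1;
  resD : forall a b, absF a <= 1 -> absF b <= 1 -> res (a + b) = res a + res b;
  resM : forall a b, absF a <= 1 -> absF b <= 1 -> res (a * b) = res a * res b;
  res_eq0 : forall a, absF a <= 1 -> (res a = 0 <-> absF a < 1);
  res_surj : forall c, exists2 a, absF a <= 1 & res a = c }.

(* The field of series sum_(n : int) a_n x^n over K. *)

Definition series_coefs (R : realType) (K : fieldType) (absK : K -> R)
    (a : int -> K) : Prop :=
  (exists B : R, forall n, absK (a n) <= B) /\
  (forall e : R, 0 < e -> exists N : int, forall n, n <= N -> absK (a n) < e).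

(* sum_(-N <= i <= N) u i *)
Definition sym_sum (V : nmodType) (u : int -> V) (N : nat) : V :=
  \sum_(i < N.*2.+1) u (i%:Z - N%:Z).

(* [coef] identifies E with the set of admissible coefficient families, with
   termwise addition, convolution product and constants cst c = c x^0; this
   determines the field E up to a unique isomorphism. *)
Record series_field (R : realType) (K : fieldType) (absK : K -> R)
    (E : fieldType) (coef : E -> int -> K) (cst : K -> E) (x : E) : Prop :=
  SeriesField {
    coef_inj : injective coef;
    coef_range : forall a : int -> K,
      series_coefs absK a <-> exists f, coef f = a;
    coefD : forall f g n, coef (f + g) n = coef f n + coef g n;
    coefM : forall f g n,
      absK (sym_sum (fun i => coef f i * coef g (n - i)) N - coef (f * g) n)
        @[N --> \oo] --> (0 : R);
    coef_cst : forall c n, coef (cst c) n = if n == 0 then c else 0;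
    coef_x : forall n, coef x n = if n == 1 then 1 else 0 }.

Definition gauss_norm (R : realType) (K : fieldType) (absK : K -> R)
    (E : Type) (coef : E -> int -> K) (f : E) : R :=
  sup (range (fun n => absK (coef f n))).

(* sigma(x) = x^q mod pi_K and sigma(sum a_n x^n) = sum sigma(a_n) sigma(x)^n.
   The latter series need not converge for the Gauss norm, only for the weak
   topology; its sum is computed coefficientwise. *)
Definition series_frobenius (R : realType) (K : fieldType) (absK : K -> R)
    (E : fieldType) (coef : E -> int -> K) (x : E) (q : nat)
    (sK : K -> K) (sE : E -> E) : Prop :=
  (forall n, absK (coef (sE x - x ^+ q) n) < 1) /\
  (forall f m,
     absK (sym_sum (fun i => sK (coef f i) * coef (sE x ^ i) m) N
           - coef (sE f) m) @[N --> \oo] --> (0 : R)).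

(* Subfields are sets, and residue fields of subfields of F are taken inside
   the residue field k of F. *)

Definition is_subfield (F : fieldType) (U : set F) : Prop :=
  [/\ U 1, (forall a b, U a -> U b -> U (a - b)),
      (forall a b, U a -> U b -> U (a * b)) & (forall a, U a -> U a^-1)].

Definition coefs_in (F : fieldType) (S : set F) (f : {poly F}) : Prop :=
  forall i, S f`_i.

Definition sub_residue (R : realType) (F : fieldType) (absF : F -> R)
    (k : fieldType) (res : F -> k) (U : set F) : set k :=
  [set res a | a in [set a | U a /\ absF a <= 1]].

Definition unramified (R : realType) (F : fieldType) (absF : F -> R)
    (k : fieldType) (res : F -> k) (L U : set F) : Prop :=
  (forall u, U u -> u != 0 -> exists2 l, L l & absF u = absF l) /\
  (forall c, sub_residue absF res U c ->
     exists f : {poly k}, [/\ coefs_in (sub_residue absF res L) f,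
       separable_poly f & root f c]).

(* The maximal unramified extension: algebraic, unramified, and with residue
   field a separable closure of that of L. *)
Definition max_unramified (R : realType) (F : fieldType) (absF : F -> R)
    (k : fieldType) (res : F -> k) (L U : set F) : Prop :=
  [/\ is_subfield U, L `<=` U,
      (forall u, U u -> exists f : {poly F},
         [/\ f != 0, coefs_in L f & root f u]),
      unramified absF res L U
    & (forall f : {poly k}, coefs_in (sub_residue absF res U) f ->
         separable_poly f -> (1 < size f)%N ->
         exists2 c, sub_residue absF res U c & root f c)].

Definition abs_dense (R : realType) (F : fieldType) (absF : F -> R)
    (U : set F) : Prop :=
  forall a (e : R), 0 < e -> exists2 u, U u & absF (a - u) < e.

(* G is Gamma^alg[1/p], the completion of the maximal unramified extension of
   the direct limit of E -sE-> E -sE-> ...; [iota m] is the map from the m-th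
   copy of E, so that the direct limit is the union of their images. *)
Record gamma_alg_field (R : realType) (K : fieldType) (absK : K -> R)
    (E : fieldType) (coef : E -> int -> K) (q : nat) (sE : E -> E)
    (G : fieldType) (absG : G -> R) (iota : nat -> {rmorphism E -> G})
    (sG : G -> G) (kG : fieldType) (res : G -> kG) : Prop := GammaAlgField {
  galg_abs : ultrametric_abs absG;
  galg_complete : abs_complete absG;
  galg_res : residue_map absG res;
  galg_colim : forall m f, iota m.+1 (sE f) = iota m f;
  galg_isometry : forall m f, absG (iota m f) = gauss_norm absK coef f;
  galg_unramified : exists2 U : set G,
    max_unramified absG res [set g | exists m f, g = iota m f] U
    & abs_dense absG U;
  galg_sigma : forall m f, sG (iota m f) = iota m (sE f);
  galg_frobenius : frobenius_lift absG q sG }.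

(* The extension to kG = k_K((x))^alg of the x-adic valuation of k_K((x)). *)
Record residue_valuation (R : realType) (K : fieldType) (absK : K -> R)
    (E : fieldType) (coef : E -> int -> K) (G : fieldType) (iota0 : E -> G)
    (kG : fieldType) (res : G -> kG) (v : kG -> \bar R) : Prop :=
  ResidueValuation {
    val0 : v 0 = +oo%E;
    val_fin : forall a, a != 0 -> v a \is a fin_num;
    valM : forall a b, v (a * b) = (v a + v b)%E;
    valD : forall a b, (Order.min (v a) (v b) <= v (a + b)%R)%E;
    val_xadic : forall f n, (forall i, absK (coef f i) <= 1) ->
      absK (coef f n) = 1 -> (forall i, i < n -> absK (coef f i) < 1) ->
      v (res (iota0 f)) = (n%:~R)%:E }.

(* The Teichmueller map is the unique multiplicative section of [res]. *)
Definition teichmuller (R : realType) (G : fieldType) (absG : G -> R)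
    (kG : fieldType) (res : G -> kG) (T : kG -> G) : Prop :=
  [/\ (forall a, absG (T a) <= 1), (forall a, res (T a) = a)
    & (forall a b, T (a * b) = T a * T b)].

(* f = sum_(i >= 0) pi^i [d i], for f in Gamma^alg *)
Definition teichmuller_expansion (R : realType) (G : fieldType)
    (absG : G -> R) (kG : fieldType) (T : kG -> G) (pi : G) (f : G)
    (d : nat -> kG) : Prop :=
  absG (f - \sum_(i < N) pi ^+ i * T (d i)) @[N --> \oo] --> (0 : R).

(* v_n(f), in terms of the Teichmueller digits d of f *)
Definition partial_val (R : realType) (kG : fieldType) (v : kG -> \bar R)
    (d : nat -> kG) (n : nat) : \bar R :=
  \big[Order.min/+oo%E]_(i < n.+1) v (d i).

Definition gamma_alg_r (R : realType) (G : fieldType) (absG : G -> R)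
    (kG : fieldType) (T : kG -> G) (pi : G) (v : kG -> \bar R) (r : R)
    : set G :=
  [set f | absG f <= 1 /\
     exists2 d, teichmuller_expansion absG T pi f d &
       (r%:E * partial_val v d n + (n%:R)%:E)%E @[n --> \oo] --> +oo%E].

Definition gamma_alg_con (R : realType) (G : fieldType) (absG : G -> R)
    (kG : fieldType) (T : kG -> G) (pi : G) (v : kG -> \bar R) : set G :=
  [set f | exists2 r : R, 0 < r & gamma_alg_r absG T pi v r f].

Definition gamma_alg_con_inv (R : realType) (p : nat) (G : fieldType)
    (absG : G -> R) (kG : fieldType) (T : kG -> G) (pi : G)
    (v : kG -> \bar R) : set G :=
  [set g | exists k, gamma_alg_con absG T pi v (p%:R ^+ k * g)].

(* sigma-modules: a finite free module is a vectType, and a sigma-semilinear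
   endomorphism is a map linear for the scaling sigma \; *:%R *)

Definition is_basis (A : nzRingType) (M : lmodType A) (n : nat)
    (b : 'I_n -> M) : Prop :=
  forall x, exists! c : 'rV[A]_n, x = \sum_i c 0 i *: b i.

Definition sigma_module (A : comNzRingType) (s : {rmorphism A -> A})
    (M : vectType A) (phi : {linear M -> M | s \; *:%R}) : Prop :=
  exists b : 'I_(dim M) -> M, is_basis b /\ is_basis (fun i => phi (b i)).

Definition is_lattice (R : realType) (F : fieldType) (absF : F -> R)
    (N : vectType F) (T : set N) : Prop :=
  exists2 b : 'I_(dim N) -> N, is_basis b &
    T = [set x | exists2 c : 'rV[F]_(dim N),
           (forall i, absF (c 0 i) <= 1) & x = \sum_i c 0 i *: b i].

Definition etale (R : realType) (F : fieldType) (absF : F -> R)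
    (N : vectType F) (f : N -> N) : Prop :=
  exists T : set N,
    [/\ is_lattice absF T, (forall x, T x -> T (f x))
      & (forall x, T x -> exists k (c : 'I_k -> F) (y : 'I_k -> N),
          (forall i, absF (c i) <= 1 /\ T (y i)) /\
          x = \sum_i c i *: f (y i))].

Definition pure_of_slope (R : realType) (F : fieldType) (absF : F -> R)
    (q : nat) (N : vectType F) (phi : N -> N) (lambda : R) : Prop :=
  exists m alpha, [/\ (0 < m)%N, alpha != 0,
    ln (absF alpha) / ln ((q ^ m)%N%:R) = - lambda
    & etale absF (fun x => alpha^-1 *: iter m phi x)].

(* The quotient V / W of phi-stable subspaces W <= V of N, realized by a
   surjection g : V -> P with kernel W, is pure of slope lambda. *)
Definition pure_quotient (R : realType) (F : fieldType) (absF : F -> R)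
    (q : nat) (s : {rmorphism F -> F}) (N : vectType F)
    (phi : {linear N -> N | s \; *:%R}) (V W : {vspace N}) (lambda : R)
    : Prop :=
  exists (P : vectType F) (psi : {linear P -> P | s \; *:%R}) (g : 'Hom(N, P)),
    [/\ (g @: V)%VS = fullv, (lker g :&: V)%VS = W,
        (forall x, x \in V -> g (phi x) = psi (g x))
      & pure_of_slope absF q psi lambda].

Record slope_filtration (R : realType) (F : fieldType) (absF : F -> R)
    (q : nat) (s : {rmorphism F -> F}) (N : vectType F)
    (phi : {linear N -> N | s \; *:%R})
    (l : nat) (Fil : nat -> {vspace N}) (slope : nat -> R) : Prop :=
  SlopeFiltration {
    fil_bot : Fil 0%N = 0%VS;
    fil_top : Fil l = fullv;
    fil_strict : forall i, (i < l)%N ->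
      (Fil i <= Fil i.+1)%VS /\ Fil i <> Fil i.+1;
    fil_stable : forall i x, (i <= l)%N -> x \in Fil i -> phi x \in Fil i;
    fil_slopes : forall i j, (i < j)%N -> (j < l)%N -> slope i < slope j;
    fil_pure : forall i, (i < l)%N ->
      pure_quotient absF q phi (Fil i.+1) (Fil i) (slope i) }.

Definition frobenius_slope (R : realType) (F : fieldType) (absF : F -> R)
    (q : nat) (s : {rmorphism F -> F}) (N : vectType F)
    (phi : {linear N -> N | s \; *:%R}) (lambda : R) : Prop :=
  exists l Fil slope, slope_filtration absF q phi l Fil slope /\
    exists2 i, (i < l)%N & lambda = slope i.

(* eta : M -> N exhibits (N, phiN) as the base change of (M, phi) along j. *)
Definition base_change (A : comNzRingType) (s : {rmorphism A -> A})
    (F : fieldType) (j : {rmorphism A -> F}) (sF : {rmorphism F -> F})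
    (M : vectType A) (phi : {linear M -> M | s \; *:%R})
    (N : vectType F) (phiN : {linear N -> N | sF \; *:%R})
    (eta : {linear M -> N | j \; *:%R}) : Prop :=
  (exists b : 'I_(dim M) -> M, is_basis b /\ is_basis (fun i => eta (b i))) /\
  (forall x, eta (phi x) = phiN (eta x)).

Definition generic_frobenius_slope (R : realType) (A : comNzRingType)
    (s : {rmorphism A -> A}) (F : fieldType) (absF : F -> R) (q : nat)
    (j : {rmorphism A -> F}) (sF : {rmorphism F -> F})
    (M : vectType A) (phi : {linear M -> M | s \; *:%R}) (lambda : R) : Prop :=
  exists (N : vectType F) (phiN : {linear N -> N | sF \; *:%R})
         (eta : {linear M -> N | j \; *:%R}),
    base_change phi phiN eta /\ frobenius_slope absF q phiN lambda.

(* "q^t is in Q": t is a rational a/b in lowest terms with b | log_p q *)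
Definition qpow_rational (R : realType) (p q : nat) (t : R) : Prop :=
  exists2 r : rat, t = ratr r & (`|denq r| %| logn p q)%N.

Definition cyclic_vector (A : comNzRingType) (M : vectType A) (phi : M -> M)
    (e : M) : Prop :=
  is_basis (fun i : 'I_(dim M) => iter i phi e).

(* a 0, ..., a n are the coefficients of f_e(sigma), with a n = 1 *)
Definition cyclic_coefs (A : comNzRingType) (M : vectType A) (phi : M -> M)
    (e : M) (a : nat -> A) : Prop :=
  a (dim M) = 1 /\
  iter (dim M) phi e = - \sum_(i < dim M) a i *: iter i phi e.

Definition np_point (R : realType) (q : nat) (A : comNzRingType)
    (absA : A -> R) (i : nat) (c : A) : R * R :=
  (i%:R, - (ln (absA c) / ln q%:R)).

(* vanishing coefficients give points at infinity, which are discarded *)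
Definition np_points (R : realType) (q : nat) (A : comNzRingType)
    (absA : A -> R) (n : nat) (a : nat -> A) : set (R * R) :=
  [set np_point q absA i (a i) | i in [set i | (i <= n)%N /\ a i != 0]].

Definition convex_hull (R : realType) (S : set (R * R)) : set (R * R) :=
  smallest (@convex_set R (R^o * R^o)%type) S.

Definition lower_boundary (R : realType) (S : set (R * R)) : set (R * R) :=
  [set P | S P /\ forall y, S (P.1, y) -> P.2 <= y].

Definition newton_polygon (R : realType) (q : nat) (A : comNzRingType)
    (absA : A -> R) (n : nat) (a : nat -> A) : set (R * R) :=
  lower_boundary (convex_hull (np_points q absA n a)).

Definition generic_cyclic_vector (R : realType) (q : nat) (A : comNzRingType)
    (absA : A -> R) (M : vectType A) (phi : M -> M) (e : M) : Prop :=
  cyclic_vector phi e /\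
  exists2 a : nat -> A, cyclic_coefs phi e a &
    forall i, (i <= dim M)%N -> a i != 0 /\
      newton_polygon q absA (dim M) a (np_point q absA i (a i)).

(* Main.v *)
(** Over Gamma^alg[1/p], whose residue field is perfect and separably closed,
    every twisted polynomial in sigma is surjective, and one whose Newton
    polygon has slope 0 kills a nonzero element. The spectral radius of phi on a
    cyclic submodule is a rational power of |p|, so some phi^D has an
    eigenvector with eigenvalue a power of p; lifting from quotients gives the
    Dieudonne-Manin theorem, a basis with phi^D z_i = p^(c_i) z_i. Grouping the
    z_i by c_i yields the slope filtration, so every c_i/(D log_p q) is a
    Frobenius slope and the hypothesis forces D | c_i. By Hilbert 90 phi itself
    then has a basis of eigenvectors v_i with phi v_i = p^(d_i) v_i.

    Order the d_i increasingly and build a generic vector inductively: adding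
    t v_m multiplies the twisted polynomial by sigma - mu on the left, where
    |mu| = |p|^(d_m), and t can be chosen so that no coefficient suffers
    cancellation, since mu may be multiplied by any power of sigma(X)/X, whose
    residue is not a root of unity.

    The coefficients keep their absolute values under a small perturbation of
    the vector, so the second statement follows from the first because
    Gamma^alg_con[1/p] is a dense subfield. *)

Require Import Defs.
From HB Require Import structures.
From mathcomp Require Import all_boot all_order all_algebra all_field cyclic.
From mathcomp Require Import all_classical all_reals all_analysis.
From mathcomp Require Import zify ring lra.

Set Implicit Arguments.
Unset Strict Implicit.
Unset Printing Implicit Defensive.

Import Order.TTheory GRing.Theory Num.Theory.
Import numFieldNormedType.Exports.

Local Open Scope classical_set_scope.
Local Open Scope ring_scope.

(** * Ultrametric absolute values and residue maps *)

(** Two obstacles shape the argument. First, an eigenvalue has to be fixed by [s], and powers of [p]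
    are what is at hand, whereas the spectral radius is only commensurable with [|p|]; hence the
    passage to iterates of [phi]. Under an iterate the cyclic submodule of a vector may shrink and
    its relation changes completely, so the radius is defined by the growth of the orbit, which
    passes to iterates at once. For the same reason the induction on the dimension lets [q] and [s]
    vary. Second, Gamma^alg_con[1/p] has to be shown closed under inverses, which cannot be read off
    the Teichmueller digits because of carries. The remedy is a family of closed subrings in which
    the pole of the i-th digit grows linearly in i; they have the uniformizer [z = pi / T (w ^+ a)],
    where [w], the residue of [x], has valuation 1. Carries are controlled by sums of Teichmueller
    lifts of integral residues adding up to 0. The element [w] serves a second time: [sigma(x) / x]
    has residue [w^(q-1)], whose positive valuation prevents it from being a root of unity. *)

Section RealLemmas.
Variable R : realType.
Implicit Types (r c x y : R).

Lemma expr_mul_lt r c e : 0 <= r < 1 -> 0 < e -> exists n, r ^+ n * c < e.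
Proof.
move=> /andP[r0 r1] e0.
have [c0|c0] := leP c 0.
  exists 0%N; rewrite expr0 mul1r; exact: le_lt_trans c0 e0.
have /cvgrPdist_lt : (fun n => r ^+ n) @ \oo --> (0 : R).
  by apply: cvg_expr; rewrite ger0_norm.
move=> /(_ (e / c) (divr_gt0 e0 c0)) [N _ /(_ N (leqnn _))] /=.
rewrite sub0r normrN ger0_norm ?exprn_ge0 // ltr_pdivlMr // => ?.
by exists N.
Qed.

Lemma le0_of_expr r c x : 0 <= r < 1 -> (forall n, x <= r ^+ n * c) -> x <= 0.
Proof.
move=> r01 H; rewrite leNgt; apply/negP => x0.
have [n] := expr_mul_lt c r01 x0.
by rewrite ltNge H.
Qed.

Lemma le_of_expr_le x y c N : 0 < x -> 0 < y ->
  (forall M, (N <= M)%N -> x ^+ M <= c * y ^+ M) -> x <= y.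
Proof.
move=> x0 y0 H; rewrite leNgt; apply/negP => ltyx.
have r01 : 0 <= y / x < 1.
  by rewrite divr_ge0 ?ltW //= ltr_pdivrMr // mul1r.
have [M HM] := expr_mul_lt `|c| r01 ltr01.
have := H (M + N)%N (leq_addl _ _); apply/negP; rewrite -ltNge.
have : (y / x) ^+ (M + N) * `|c| < 1.
  apply: le_lt_trans HM; rewrite exprD ler_wpM2r // ler_piMr ?exprn_ge0 //.
    by case/andP: r01.
  by apply: exprn_ile1; [case/andP: r01|case/andP: r01 => _ /ltW].
rewrite expr_div_n mulrAC ltr_pdivrMr ?exprn_gt0 // mul1r.
apply: le_lt_trans; rewrite [leRHS]mulrC ler_wpM2r ?exprn_ge0 ?(ltW y0) //.
exact: ler_norm.
Qed.

Lemma ler_iXz2l x : 0 < x -> x < 1 -> {mono exprz x : m n / (m <= n)%R >-> n <= m}.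
Proof.
move=> x0 x1 m n; have x1' : 1 < x^-1 by rewrite invf_gt1.
have e i : x ^ i = x^-1 ^ (- i) by rewrite exprz_inv opprK.
by rewrite !e ler_eXz2l // lerN2.
Qed.

Lemma ltr_iXz2l x : 0 < x -> x < 1 -> {mono exprz x : m n / (m < n)%R >-> n < m}.
Proof. by move=> x0 x1 m n; rewrite !ltNge ler_iXz2l. Qed.

End RealLemmas.

Section Ultrametric.
Variables (R : realType) (F : fieldType) (absF : F -> R).
Hypothesis uF : ultrametric_abs absF.
Implicit Types a b : F.

Lemma uabs_ge0 a : 0 <= absF a. Proof. by case: uF. Qed.

Lemma uabs0 : absF 0 = 0. Proof. by apply/(abs_eq0 uF). Qed.

Lemma uabs_eq0 a : (absF a == 0) = (a == 0).
Proof. by apply/eqP/eqP => /(abs_eq0 uF). Qed.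

Lemma uabs_gt0 a : (0 < absF a) = (a != 0).
Proof. by rewrite lt_def uabs_ge0 andbT uabs_eq0. Qed.

Lemma uabsM a b : absF (a * b) = absF a * absF b. Proof. by case: uF. Qed.

Lemma uabs1 : absF 1 = 1.
Proof.
have nz : absF 1 != 0 by rewrite uabs_eq0 oner_eq0.
by apply: (mulfI nz); rewrite -uabsM !mulr1.
Qed.

Lemma uabsN a : absF (- a) = absF a.
Proof.
have H : absF (-1) ^+ 2 = 1 by rewrite expr2 -uabsM mulrNN mulr1 uabs1.
have /eqP N1 : absF (-1) == 1.
  by rewrite -(eqrXn2 (n := 2)) ?uabs_ge0 // H expr1n.
by rewrite -mulN1r uabsM N1 mul1r.
Qed.

Lemma uabsV a : absF a^-1 = (absF a)^-1.
Proof.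
have [->|a0] := eqVneq a 0; first by rewrite invr0 uabs0 invr0.
have nz : absF a != 0 by rewrite uabs_eq0.
by apply: (mulfI nz); rewrite -uabsM !divff ?uabs1.
Qed.

Lemma uabs_div a b : absF (a / b) = absF a / absF b.
Proof. by rewrite uabsM uabsV. Qed.

Lemma uabsX a n : absF (a ^+ n) = absF a ^+ n.
Proof.
elim: n => [|n IH]; first by rewrite !expr0 uabs1.
by rewrite !exprS uabsM IH.
Qed.

Lemma uabsXz a (z : int) : absF (a ^ z) = absF a ^ z.
Proof. by case: z => n; rewrite ?NegzE -?exprnN -?exprnP ?uabsV uabsX. Qed.

Lemma uabsD_le a b c : absF a <= c -> absF b <= c -> absF (a + b) <= c.
Proof.
by move=> ha hb; apply: le_trans (absD uF a b) _; rewrite ge_max ha hb.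
Qed.

Lemma uabsB_le a b c : absF a <= c -> absF b <= c -> absF (a - b) <= c.
Proof. by move=> ha hb; apply: uabsD_le => //; rewrite uabsN. Qed.

Lemma uabsD_lt a b c : absF a < c -> absF b < c -> absF (a + b) < c.
Proof.
by move=> ha hb; apply: le_lt_trans (absD uF a b) _; rewrite gt_max ha hb.
Qed.

Lemma uabsB_lt a b c : absF a < c -> absF b < c -> absF (a - b) < c.
Proof. by move=> ha hb; apply: uabsD_lt => //; rewrite uabsN. Qed.

Lemma uabs_distC a b : absF (a - b) = absF (b - a).
Proof. by rewrite -uabsN opprB. Qed.

Lemma uabsD_eq a b : absF b < absF a -> absF (a + b) = absF a.
Proof.
move=> h; apply/le_anti/andP; split; first by apply: uabsD_le => //; exact: ltW.
rewrite leNgt; apply/negP => h2.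
by have := uabsB_lt h2 h; rewrite addrK ltxx.
Qed.

Lemma uabsB_eq a b : absF b < absF a -> absF (a - b) = absF a.
Proof. by move=> h; apply: uabsD_eq; rewrite uabsN. Qed.

Lemma uabs_near a b : absF (b - a) < absF a -> absF b = absF a.
Proof. by move=> /uabsD_eq; rewrite addrC subrK. Qed.

Lemma uabs_sum_le (I : Type) (r : seq I) (P : pred I) (f : I -> F) c :
  0 <= c -> (forall i, P i -> absF (f i) <= c) ->
  absF (\sum_(i <- r | P i) f i) <= c.
Proof.
move=> c0 H; elim/big_rec: _ => [|i y Pi Hy]; first by rewrite uabs0.
by apply: uabsD_le => //; exact: H.
Qed.

Lemma uabs_nat n : absF n%:R <= 1.
Proof.
elim: n => [|n IH]; first by rewrite uabs0.
by rewrite -natr1; apply: uabsD_le => //; rewrite uabs1.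
Qed.

Lemma uabs_le1X a n : absF a <= 1 -> absF (a ^+ n) <= 1.
Proof. by move=> h; rewrite uabsX exprn_ile1 ?uabs_ge0. Qed.

Lemma uabs_le1M a b : absF a <= 1 -> absF b <= 1 -> absF (a * b) <= 1.
Proof. by move=> ha hb; rewrite uabsM mulr_ile1 ?uabs_ge0. Qed.

(** Discreteness of the value group: an error that shrinks strictly shrinks by the fixed factor
    [absF pi], which makes successive approximations converge geometrically. *)
Lemma uabs_unif_le (pi a b : F) : is_uniformizer absF pi ->
  absF a < absF b -> absF a <= absF pi * absF b.
Proof.
move=> [/andP[pi0 pi1] H] hab.
have [->|a0] := eqVneq a 0; first by rewrite uabs0 mulr_ge0 ?uabs_ge0.
have b0 : b != 0 by rewrite -uabs_gt0; apply: le_lt_trans hab; exact: uabs_ge0.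
have [z Ez] := H _ a0; have [w Ew] := H _ b0.
move: hab; rewrite Ez Ew -[X in X * _]expr1z -expfzDr ?gt_eqF //.
by rewrite (ltr_iXz2l pi0 pi1) (ler_iXz2l pi0 pi1) -lezD1 addrC.
Qed.

Lemma uabs_telescope (u : nat -> F) r c :
  abs_complete absF -> 0 <= r < 1 -> 0 <= c ->
  (forall n, absF (u n.+1 - u n) <= r ^+ n * c) ->
  exists l, forall n, absF (l - u n) <= r ^+ n * c.
Proof.
move=> cF /[dup] r01 /andP[r0 r1] c0 H.
have H2 : forall n m, absF (u (n + m)%N - u n) <= r ^+ n * c.
  move=> n; elim=> [|m IH].
    by rewrite addn0 subrr uabs0 mulr_ge0 // exprn_ge0.
  rewrite addnS -[X in absF (X - _)](subrK (u (n + m)%N)) -addrA.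
  apply: uabsD_le => //; apply: le_trans (H _) _.
  by rewrite ler_wpM2r // exprD ler_piMr ?exprn_ge0 // exprn_ile1 // ltW.
have [|l Hl] := cF u.
  move=> e e0; have [N HN] := expr_mul_lt c r01 e0; exists N => m n hm hn.
  rewrite -(subnKC hm) -(subnKC hn).
  have -> (a b : F) : a - b = (a - u N) - (b - u N) by ring.
  by apply: uabsB_lt; apply: le_lt_trans HN; apply: H2.
exists l => n; rewrite leNgt; apply/negP => hlt.
have e0 : 0 < absF (l - u n) by apply: le_lt_trans hlt; rewrite mulr_ge0 ?exprn_ge0.
move/cvgrPdist_lt: Hl => /(_ _ e0) [N _ /(_ (n + N)%N (leq_addl _ _))] /=.
rewrite sub0r normrN ger0_norm ?uabs_ge0 // uabs_distC => h3.
have := uabsD_lt h3 (le_lt_trans (H2 n N) hlt).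
by rewrite addrA subrK ltxx.
Qed.

(** Successive approximation: solve up to the relative error [r], then solve again for the
    remainder. The corrections are bounded by the remainders, so their sums converge, and
    [|f t| <= |t|] makes [f] continuous enough for the limit to be an exact solution. *)
Lemma uabs_surj (f : F -> F) r :
  abs_complete absF -> 0 <= r < 1 ->
  (forall a b, f (a + b) = f a + f b) ->
  (forall t, absF (f t) <= absF t) ->
  (forall a, exists2 t, absF t <= absF a & absF (f t - a) <= r * absF a) ->
  forall a, exists2 t, absF t <= absF a & f t = a.
Proof.
move=> cF r01 fD f1 H a; have /andP[r0 r1] := r01.
have {H}[g Hg] : {g : F -> F | forall a, absF (g a) <= absF a /\
    absF (f (g a) - a) <= r * absF a}.
  have {}H b : exists t, absF t <= absF b /\ absF (f t - b) <= r * absF b.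
    by have [t ? ?] := H b; exists t.
  exists (fun b => projT1 (cid (H b))) => b; exact: (projT2 (cid (H b))).
pose rem n := iter n (fun b => b - f (g b)) a.
have Hrem n : absF (rem n) <= r ^+ n * absF a.
  elim: n => [|n IH]; first by rewrite expr0 mul1r.
  rewrite /rem iterS -/(rem n) uabs_distC exprS -mulrA.
  by apply: le_trans (proj2 (Hg _)) _; rewrite ler_wpM2l.
pose u n := \sum_(i < n) g (rem i).
have f0 : f 0 = 0 by apply: (addrI (f 0)); rewrite -fD !addr0.
have fN x : f (- x) = - f x by apply: (addrI (f x)); rewrite -fD !subrr f0.
have fu n : f (u n) = a - rem n.
  elim: n => [|n IH]; first by rewrite /u big_ord0 f0 subrr.
  by rewrite /u big_ord_recr /= -/(u n) fD IH -/(rem n); ring.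
have [|l Hl] := @uabs_telescope u r (absF a) cF r01 (uabs_ge0 _).
  move=> n; rewrite /u big_ord_recr /= [X in X - _]addrC addrK.
  exact: le_trans (proj1 (Hg _)) (Hrem n).
exists l.
  by have := Hl 0%N; rewrite /u big_ord0 subr0 expr0 mul1r.
apply/eqP; rewrite -subr_eq0 -uabs_eq0 eq_le uabs_ge0 andbT.
apply: (le0_of_expr r01 (c := absF a)) => n.
have -> : f l - a = f (l - u n) - rem n by rewrite fD fN fu; ring.
by apply: uabsB_le => //; apply: le_trans (f1 _) _.
Qed.

End Ultrametric.

Section Residue.
Variables (R : realType) (F : fieldType) (absF : F -> R).
Variables (k : fieldType) (res : F -> k).
Hypothesis uF : ultrametric_abs absF.
Hypothesis rF : residue_map absF res.
Implicit Types a b : F.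

Lemma res0 : res 0 = 0.
Proof. by apply/(res_eq0 rF); rewrite ?(uabs0 uF) ?ler01 ?ltr01. Qed.

Lemma resN a : absF a <= 1 -> res (- a) = - res a.
Proof.
move=> ha; apply: (addrI (res a)); rewrite -(resD rF) ?(uabsN uF) //.
by rewrite !subrr res0.
Qed.

Lemma resB a b : absF a <= 1 -> absF b <= 1 -> res (a - b) = res a - res b.
Proof. by move=> ha hb; rewrite (resD rF) ?resN ?(uabsN uF). Qed.

Lemma res_eq a b : absF a <= 1 -> absF b <= 1 ->
  (res a = res b <-> absF (a - b) < 1).
Proof.
move=> ha hb; rewrite -(res_eq0 rF); last exact: uabsB_le.
by rewrite resB //; split=> [->|/eqP]; [exact: subrr|rewrite subr_eq0 => /eqP].
Qed.

Lemma resX a n : absF a <= 1 -> res (a ^+ n) = res a ^+ n.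
Proof.
move=> ha; elim: n => [|n IH]; first by rewrite !expr0 (res1 rF).
by rewrite !exprS (resM rF) ?(uabs_le1X uF) // IH.
Qed.

Lemma res_sum n (f : 'I_n -> F) : (forall i, absF (f i) <= 1) ->
  res (\sum_i f i) = \sum_i res (f i).
Proof.
elim: n f => [|n IH] f H; first by rewrite !big_ord0 res0.
rewrite !big_ord_recr /= (resD rF) ?IH //.
by apply: uabs_sum_le.
Qed.

Lemma res_neq0 a : absF a <= 1 -> (res a != 0) = (absF a == 1).
Proof.
move=> ha; apply/idP/eqP => [/eqP nz|a1].
  apply/eqP; rewrite eq_le ha leNgt; apply/negP => /(res_eq0 rF ha).
  exact: nz.
by apply/eqP => /(res_eq0 rF ha); rewrite a1 ltxx.
Qed.

Lemma resV a : absF a = 1 -> res a^-1 = (res a)^-1.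
Proof.
move=> a1; have a0 : a != 0 by rewrite -(uabs_gt0 uF) a1.
have ra0 : res a != 0 by rewrite res_neq0 a1.
apply: (mulfI ra0); rewrite -(resM rF) ?(uabsV uF) ?a1 ?invr1 //.
by rewrite !divff ?(res1 rF).
Qed.

End Residue.

(** * Twisted polynomials *)

(* The properties of Gamma^alg[1/p] on which the theory of sigma-modules
   rests. Its residue field is algebraically closed, but only these two
   consequences are needed. *)
Record strict_witt (R : realType) (p : nat) (F : fieldType) (absF : F -> R)
    (k : fieldType) (res : F -> k) : Prop := StrictWitt {
  sw_prime : prime p;
  sw_abs : ultrametric_abs absF;
  sw_complete : abs_complete absF;
  sw_res : residue_map absF res;
  sw_unif : exists pi, is_uniformizer absF pi;
  sw_p : 0 < absF p%:R < 1;
  sw_sep : forall f : {poly k}, separable_poly f -> (1 < size f)%N ->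
    exists c, root f c;
  sw_perfect : forall c : k, exists d, d ^+ p = c }.

Definition frob_power (R : realType) (p : nat) (F : fieldType) (absF : F -> R)
    (q : nat) (s : F -> F) : Prop :=
  [/\ p.-nat q, (1 < q)%N & frobenius_lift absF q s].

Section Frobenius.
Variables (R : realType) (p : nat) (F : fieldType) (absF : F -> R).
Variables (k : fieldType) (res : F -> k).
Hypothesis wF : strict_witt p absF res.
Let uF := sw_abs wF.
Let rF := sw_res wF.

Lemma sw_p_neq0 : (p%:R : F) != 0.
Proof. by rewrite -(uabs_gt0 uF); case/andP: (sw_p wF). Qed.

Lemma sw_pchar : p \in [pchar k].
Proof.
rewrite inE (sw_prime wF) /=; apply/eqP.
have <- : res (p%:R) = p%:R.
  elim: (p) => [|n IH]; first exact: (res0 uF rF).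
  by rewrite -!natr1 (resD rF) ?(uabs1 uF) ?(uabs_nat uF) // IH (res1 rF).
by apply/(res_eq0 rF); [exact: uabs_nat|case/andP: (sw_p wF)].
Qed.

Lemma sw_root_pow (q : nat) : p.-nat q -> forall c : k, exists d, d ^+ q = c.
Proof.
move=> /p_natP[n ->] c.
elim: n c => [|n IH] c; first by exists c; rewrite expn0 expr1.
have [d <-] := sw_perfect wF c; have [d' <-] := IH d.
by exists d'; rewrite expnSr exprM.
Qed.

Lemma sw_natq (q : nat) : p.-nat q -> (1 < q)%N -> (q%:R : k) = 0.
Proof.
move=> /p_natP[[|n] ->]; first by rewrite expn0.
by move=> _; rewrite expnS natrM (eqP (andP sw_pchar).2) mul0r.
Qed.

(* Substituting the root of order q^i0 of the lowest term makes the
   q-polynomial separable. *)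
Lemma sw_qpoly_root (q : nat) (n : nat) (c : nat -> k) (a : k) :
  p.-nat q -> (1 < q)%N ->
  (exists2 i, (i < n)%N & c i != 0) ->
  exists t, \sum_(i < n) c i * t ^+ (q ^ i)%N = a.
Proof.
move=> pq q1 ex.
have [m [mn cm min_m]] : exists m, [/\ (m < n)%N, c m != 0 &
    forall i, (i < m)%N -> c i = 0].
  have ex' : exists i, (i < n)%N && (c i != 0) by have [i ? ?] := ex; exists i; apply/andP.
  case: (ex_minnP ex') => m /andP[mn cm] min_m; exists m; split=> // i im.
  apply/eqP; apply/negPn/negP => ci; have := min_m i.
  by rewrite ci (ltn_trans im mn) leqNgt im => /(_ isT).
have [l en] : exists l, n = (m + l.+1)%N.
  by exists (n - m.+1)%N; rewrite addnS -addSn subnKC.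
pose f : {poly k} := \sum_(i < l.+1) (c (m + i)%N *: 'X^(q ^ i)%N) - a%:P.
(* As [q] vanishes in [k], only the linear term survives differentiation; a nonzero constant
   derivative makes [f] separable. *)
have df : f^`() = (c m)%:P.
  rewrite /f derivB derivC subr0 raddf_sum /= big_ord_recl /= expn0 addn0 derivZ.
  rewrite expr1 derivX alg_polyC big1 ?addr0 // => i _.
  rewrite derivZ derivXn /bump add1n expnS -scaler_nat natrM (sw_natq pq q1).
  by rewrite mul0r scale0r scaler0.
have sepf : separable_poly f.
  by rewrite separable_poly.unlock df coprimep_sym -alg_polyC coprimepZl // coprime1p.
have sizef : (1 < size f)%N.
  rewrite ltnNge; apply/negP => /size1_polyC ef.
  by move: df; rewrite ef derivC => /esym/eqP; rewrite polyC_eq0 (negPf cm).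
have [y] := sw_sep wF sepf sizef.
rewrite /root /f !hornerE horner_sum subr_eq0 => /eqP hy.
have pqm : p.-nat (q ^ m)%N by rewrite pnatX pq.
have [t ht] := sw_root_pow pqm y.
exists t; rewrite en big_split_ord /= big1 ?add0r; last first.
  by move=> i _; rewrite min_m ?mul0r.
rewrite -hy; apply: eq_bigr => i _.
by rewrite !hornerE expnD exprM ht.
Qed.

Section Operators.
Variables (q : nat) (s : {rmorphism F -> F}).
Hypothesis fs : frob_power p absF q s.
Hypothesis s_abs : forall a, absF (s a) = absF a.

Lemma frob_res a : absF a <= 1 -> res (s a) = res a ^+ q.
Proof.
case: fs => _ _ H ha; have [h1 h2] := H a ha.
by rewrite -(resX uF rF) //; apply/(res_eq uF rF) => //; exact: uabs_le1X.
Qed.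

Lemma frob_iter_abs i a : absF (iter i s a) = absF a.
Proof. by elim: i => //= i <-. Qed.

Lemma frob_iter_res i a : absF a <= 1 -> res (iter i s a) = res a ^+ (q ^ i).
Proof.
move=> ha; elim: i => [|i IH] /=; first by rewrite expr1.
by rewrite frob_res ?frob_iter_abs // IH -exprM expnSr.
Qed.

Lemma iter_rmorphM i a b : iter i s (a * b) = iter i s a * iter i s b.
Proof. by elim: i => //= i ->; rewrite rmorphM. Qed.

Lemma iter_rmorphD i a b : iter i s (a + b) = iter i s a + iter i s b.
Proof. by elim: i => //= i ->; rewrite rmorphD. Qed.

(** After the substitution [a * t] and division by [a], the equation reduces over the residue field
    to a q-polynomial equation with right-hand side 1. The alternative [a == 0] is the case in which
    no strict inequality can hold. *)
Lemma skew_poly_step n (g : nat -> F) a :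
  (forall i, (i < n)%N -> absF (g i) <= 1) ->
  (exists2 i, (i < n)%N & absF (g i) = 1) ->
  exists2 t, absF t <= absF a & (absF (\sum_(i < n) g i * iter i s t - a) < absF a) || (a == 0).
Proof.
move=> g1 [i0 i0n gi0].
have [->|a0] := eqVneq a 0; first by exists 0; rewrite ?orbT.
have aa0 : absF a != 0 by rewrite uabs_eq0.
pose u i := iter i s a / a.
have u1 i : absF (u i) = 1 by rewrite (uabs_div uF) frob_iter_abs divff.
have gu1 i : (i < n)%N -> absF (g i * u i) <= 1.
  by move=> hi; rewrite (uabsM uF) u1 mulr1 g1.
case: (fs) => pq q1 _.
have [|tb htb] := @sw_qpoly_root q n (fun i => res (g i * u i)) 1 pq q1.
  by exists i0 => //; rewrite (res_neq0 rF) ?gu1 // (uabsM uF) u1 gi0 mulr1.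
have [t ht rt] := res_surj rF tb.
exists (a * t); first by rewrite (uabsM uF) ler_piMr ?(uabs_ge0 uF).
rewrite orbF.
have -> : \sum_(i < n) g i * iter i s (a * t) - a =
    a * (\sum_(i < n) (g i * u i) * iter i s t - 1).
  rewrite mulrBr mulr1 mulr_sumr; congr (_ - _); apply: eq_bigr => i _.
  by rewrite iter_rmorphM /u; field.
rewrite (uabsM uF) gtr_pMr ?(uabs_gt0 uF) //.
have h2 (i : 'I_n) : absF (g i * u i * iter i s t) <= 1.
  by apply: uabs_le1M; rewrite ?gu1 // frob_iter_abs.
have S1 : absF (\sum_(i < n) (g i * u i) * iter i s t) <= 1.
  by apply: uabs_sum_le.
apply/(res_eq uF rF) => //; first by rewrite (uabs1 uF).
rewrite (res_sum uF rF) // (res1 rF) -htb; apply: eq_bigr => i _.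
by rewrite (resM rF) ?gu1 ?frob_iter_abs // frob_iter_res // rt.
Qed.

Lemma skew_poly_sumD n (g : nat -> F) a b :
  \sum_(i < n) g i * iter i s (a + b) =
  \sum_(i < n) g i * iter i s a + \sum_(i < n) g i * iter i s b.
Proof.
by rewrite -big_split; apply: eq_bigr => i _; rewrite iter_rmorphD mulrDr.
Qed.

Lemma skew_poly_surj_int n (g : nat -> F) a :
  (forall i, (i < n)%N -> absF (g i) <= 1) ->
  (exists2 i, (i < n)%N & absF (g i) = 1) ->
  exists2 t, absF t <= absF a & \sum_(i < n) g i * iter i s t = a.
Proof.
move=> g1 gi; have [pi upi] := sw_unif wF.
apply: (@uabs_surj R F absF uF (fun t => \sum_(i < n) g i * iter i s t) (absF pi)).
- exact: sw_complete wF.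
- by case: upi => /andP[/ltW-> ->].
- by move=> x y; exact: skew_poly_sumD.
- move=> t; apply: uabs_sum_le => //; first exact: uabs_ge0.
  move=> i _; rewrite (uabsM uF) frob_iter_abs.
  by rewrite ler_piMl ?(uabs_ge0 uF) // g1.
move=> b; have [t ht /orP[hb|/eqP b0]] := skew_poly_step b g1 gi; exists t => //.
  exact: uabs_unif_le.
move: ht; rewrite b0 (uabs0 uF) => ht.
have /eqP -> : t == 0 by rewrite -(uabs_eq0 uF) eq_le ht (uabs_ge0 uF).
rewrite mulr0 subr0 big1 ?(uabs0 uF) // => i _.
by rewrite (_ : iter i s 0 = 0) ?mulr0 //; elim: (nat_of_ord i) => //= j ->; rewrite rmorph0.
Qed.

(** Dividing by a coefficient of maximal absolute value leads back to the integral case. *)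
Lemma skew_poly_surj n (g : nat -> F) a :
  (exists2 i, (i < n)%N & g i != 0) ->
  exists t, \sum_(i < n) g i * iter i s t = a.
Proof.
move=> [i0 i0n gi0].
pose m := [arg max_(i > Ordinal i0n) absF (g (i : 'I_n))]%O.
have Hm (i : 'I_n) : absF (g i) <= absF (g m).
  by rewrite /m; case: arg_maxP => //= j _; exact.
have gm0 : g m != 0.
  rewrite -(uabs_gt0 uF); apply: lt_le_trans (Hm (Ordinal i0n)).
  by rewrite (uabs_gt0 uF).
have agm : absF (g m) != 0 by rewrite (uabs_eq0 uF).
have [||t _ ht] := @skew_poly_surj_int n (fun i => g i / g m) (a / g m).
- move=> i hi; rewrite (uabs_div uF) ler_pdivrMr ?mul1r; first exact: (Hm (Ordinal hi)).
  by rewrite (uabs_gt0 uF).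
- by exists m => //; rewrite (uabs_div uF) divff.
exists t; apply: (mulIf (invr_neq0 gm0)); rewrite -ht mulr_suml.
by apply: eq_bigr => i _; ring.
Qed.

(** The reduced q-polynomial is separable because its linear coefficient is nonzero, and of degree
    above 1 because another coefficient is a unit; removing the root 0 leaves a nonzero root. Its
    lift [t0] is a kernel element up to a value of norm below 1, which surjectivity corrects by some
    [t1] that is too small to cancel [t0]. *)
Lemma skew_poly_ker n (g : nat -> F) :
  (forall i, (i < n)%N -> absF (g i) <= 1) -> absF (g 0%N) = 1 ->
  (exists2 i, (0 < i < n)%N & absF (g i) = 1) ->
  exists2 t, t != 0 & \sum_(i < n) g i * iter i s t = 0.
Proof.
move=> g1 g0 [i0 /andP[i00 i0n] gi0]; case: (fs) => pq q1 _.
have [n' en] : exists n', n = n'.+1 by case: (n) i0n => // n' _; exists n'.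
rewrite {}en in g1 i0n *.
pose c i := res (g i).
have c0 : c 0%N != 0 by rewrite (res_neq0 rF) ?g0.
have ci0 : c i0 != 0 by rewrite (res_neq0 rF) ?gi0.
pose f : {poly k} := \sum_(i < n'.+1) (c i *: 'X^(q ^ i)%N).
have fE t : f.[t] = \sum_(i < n'.+1) c i * t ^+ (q ^ i)%N.
  by rewrite horner_sum; apply: eq_bigr => i _; rewrite !hornerE.
have q0 : (0 < q)%N by exact: ltnW.
have root0 : root f 0.
  by rewrite /root fE big1 // => i _; rewrite expr0n expn_eq0 -leqn0 leqNgt q0 mulr0.
have df : f^`() = (c 0%N)%:P.
  rewrite raddf_sum /= big_ord_recl /= expn0 derivZ.
  rewrite expr1 derivX alg_polyC big1 ?addr0 // => i _.
  rewrite derivZ derivXn /bump add1n expnS -scaler_nat natrM (sw_natq pq q1).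
  by rewrite mul0r scale0r scaler0.
have sepf : separable_poly f.
  by rewrite separable_poly.unlock df coprimep_sym -alg_polyC coprimepZl // coprime1p.
have sizef : (2 < size f)%N.
  have : f`_(q ^ i0) != 0.
    rewrite coef_sum (bigD1 (Ordinal i0n)) //= big1 ?addr0.
      by rewrite coefZ coefXn eqxx mulr1.
    move=> i; rewrite -val_eqE /= => ne; rewrite coefZ coefXn.
    by rewrite eqn_exp2l // eq_sym (negPf ne) mulr0.
  apply: contraR; rewrite -leqNgt => h; apply/eqP/nth_default.
  by apply: leq_trans h _; rewrite -[1%N](expn0 q) ltn_exp2l.
have [h fh] := factor_theorem f 0 root0.
have hn0 : h != 0 by apply: contraTneq sizef => h0; rewrite fh h0 mul0r size_poly0.
have sizeh : (1 < size h)%N by move: sizef; rewrite fh size_Mmonic ?monicXsubC ?hn0 // size_XsubC addn2.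
have /andP[seph nrh] : separable_poly h && ~~ root h 0.
  by rewrite -separable_root -fh.
have [tb rtb] := sw_sep wF seph sizeh.
have tb0 : tb != 0 by apply: contraNneq nrh => <-.
have htb : \sum_(i < n'.+1) c i * tb ^+ (q ^ i)%N = 0.
  by rewrite -fE fh hornerM (eqP rtb) mul0r.
have [t0 ht0 rt0] := res_surj rF tb.
have h1 (i : 'I_n'.+1) : absF (g i * iter i s t0) <= 1.
  by apply: uabs_le1M; rewrite ?g1 // frob_iter_abs.
have [|t1 ht1 e1] := @skew_poly_surj_int n'.+1 g (\sum_(i < n'.+1) g i * iter i s t0) g1.
  by exists 0%N.
have at0 : absF t0 = 1 by apply/eqP; rewrite -(res_neq0 rF) // rt0.
have lt1 : absF t1 < 1.
  apply: le_lt_trans ht1 _; apply/(res_eq0 rF); first exact: uabs_sum_le.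
  rewrite (res_sum uF rF) //; apply: etrans htb; apply: eq_bigr => i _.
  by rewrite (resM rF) ?g1 ?frob_iter_abs // frob_iter_res // rt0.
exists (t0 - t1).
  by rewrite -(uabs_gt0 uF) (uabsB_eq uF) ?at0.
apply: (addIr (\sum_(i < n'.+1) g i * iter i s t1)).
by rewrite add0r -skew_poly_sumD subrK e1.
Qed.

End Operators.
End Frobenius.

(** * The spectral radius on a cyclic submodule *)

Section IterRmorphism.
Variables (F : fieldType) (s : {rmorphism F -> F}) (n : nat).

Lemma iter_is_zmod_morphism : zmod_morphism (iter n s).
Proof. by elim: n => // m IH x y /=; rewrite IH rmorphB. Qed.

Lemma iter_is_monoid_morphism : monoid_morphism (iter n s).
Proof.
elim: n => // m [IH1 IHM]; split=> [|x y] /=; first by rewrite IH1 rmorph1.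
by rewrite IHM rmorphM.
Qed.

HB.instance Definition _ :=
  GRing.isZmodMorphism.Build F F (iter n s) iter_is_zmod_morphism.
HB.instance Definition _ :=
  GRing.isMonoidMorphism.Build F F (iter n s) iter_is_monoid_morphism.

End IterRmorphism.

Lemma iter_iter_mul (T : Type) (f : T -> T) d n x :
  iter n (iter d f) x = iter (n * d) f x.
Proof. by elim: n => //= n ->; rewrite mulSn iterD. Qed.

Definition sigma_linear (F : fieldType) (s : F -> F) (V : lmodType F)
    (f : V -> V) : Prop :=
  (forall x y, f (x + y) = f x + f y) /\ (forall a x, f (a *: x) = s a *: f x).

Definition linear_form (F : fieldType) (V : lmodType F) (l : V -> F) : Prop :=
  (forall x y, l (x + y) = l x + l y) /\ (forall a x, l (a *: x) = a * l x).

Section Semilinear.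
Variables (F : fieldType) (s : F -> F) (V : lmodType F) (f : V -> V).
Hypothesis sf : sigma_linear s f.

Lemma semilinear0 : f 0 = 0.
Proof. by apply: (addrI (f 0)); rewrite -(proj1 sf) !addr0. Qed.

Lemma semilinearN x : f (- x) = - f x.
Proof. by apply: (addrI (f x)); rewrite -(proj1 sf) !subrr semilinear0. Qed.

Lemma semilinearB x y : f (x - y) = f x - f y.
Proof. by rewrite (proj1 sf) semilinearN. Qed.

Lemma semilinear_sum n (a : 'I_n -> F) (v : 'I_n -> V) :
  f (\sum_i a i *: v i) = \sum_i s (a i) *: f (v i).
Proof.
elim: n a v => [|n IH] a v; first by rewrite !big_ord0 semilinear0.
by rewrite !big_ord_recr /= (proj1 sf) (proj2 sf) IH.
Qed.

Lemma semilinear_iter n : sigma_linear (iter n s) (iter n f).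
Proof.
elim: n => // n [IHD IHZ]; split=> [x y|a x] /=.
  by rewrite IHD (proj1 sf).
by rewrite IHZ (proj2 sf).
Qed.

End Semilinear.

Lemma linear_form_sum (F : fieldType) (V : lmodType F) (l : V -> F) n
    (a : 'I_n -> F) (v : 'I_n -> V) : linear_form l ->
  l (\sum_i a i *: v i) = \sum_i a i * l (v i).
Proof.
move=> [lD lZ]; elim: n a v => [|n IH] a v; last first.
  by rewrite !big_ord_recr /= lD lZ IH.
by rewrite !big_ord0 -(scale0r 0) lZ mul0r.
Qed.

(* [rho] is the spectral radius of [f] on the cyclic submodule of [e]; testing
   on linear forms makes the notion independent of a basis. *)
Definition growth (R : realType) (F : fieldType) (absF : F -> R)
    (V : lmodType F) (f : V -> V) (e : V) (rho : R) : Prop :=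
  (forall l, linear_form l -> exists K N, forall M, (N <= M)%N ->
     absF (l (iter M f e)) <= K * rho ^+ M) /\
  (exists n (l : 'I_n -> V -> F), (forall i, linear_form (l i)) /\
     exists K N, forall M, (N <= M)%N ->
       exists i, rho ^+ M <= K * absF (l i (iter M f e))).

Section GrowthUniq.
Variables (R : realType) (F : fieldType) (absF : F -> R).
Hypothesis uF : ultrametric_abs absF.
Variables (V : lmodType F) (f : V -> V) (e : V).

Lemma growth_le r1 r2 : 0 < r1 -> 0 < r2 ->
  growth absF f e r1 -> growth absF f e r2 -> r1 <= r2.
Proof.
move=> r10 r20 [_ [n [l [hl [K [N HK]]]]]] [up _].
have {}up i := cid (up (l i) (hl i)).
pose K' i := projT1 (up i).
have up' i := cid (projT2 (up i)).
pose N' i := projT1 (up' i).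
have upK i M : (N' i <= M)%N -> absF (l i (iter M f e)) <= K' i * r2 ^+ M.
  exact: (projT2 (up' i)).
apply: (@le_of_expr_le R r1 r2 (`|K| * \sum_i `|K' i|) (N + \sum_i N' i)) => // M hM.
have [|i hi] := HK M; first exact: leq_trans (leq_addr _ _) hM.
apply: le_trans hi _.
have hN : (N' i <= M)%N.
  apply: leq_trans hM; apply: leq_trans (leq_addl _ _).
  by rewrite (bigD1 i) //= leq_addr.
apply: (@le_trans _ _ (`|K| * absF (l i (iter M f e)))).
  by rewrite ler_wpM2r ?(uabs_ge0 uF) // ler_norm.
rewrite -mulrA ler_wpM2l ?normr_ge0 //; apply: le_trans (upK i M hN) _.
rewrite ler_wpM2r ?exprn_ge0 ?(ltW r20) //.
apply: le_trans (ler_norm _) _; rewrite (bigD1 i) //= lerDl.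
by apply: sumr_ge0 => j _; exact: normr_ge0.
Qed.

Lemma growth_uniq r1 r2 : 0 < r1 -> 0 < r2 ->
  growth absF f e r1 -> growth absF f e r2 -> r1 = r2.
Proof. by move=> ? ? ? ?; apply/le_anti/andP; split; apply: growth_le. Qed.

(** The orbit under [iter d f] is a subsequence of the orbit under [f]. *)
Lemma growth_iter d r : (0 < d)%N -> growth absF f e r ->
  growth absF (iter d f) e (r ^+ d).
Proof.
move=> d0 [up [n [l [hl [K [N lo]]]]]]; split=> [l' /up[K' [N' H]]|].
  exists K', N' => M hM; rewrite iter_iter_mul -exprM mulnC; apply: H.
  by apply: leq_trans hM _; rewrite ?(leq_pmull _ d0) ?(leq_pmulr _ d0).
exists n, l; split=> //; exists K, N => M hM.
rewrite iter_iter_mul -exprM mulnC; apply: lo.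
by apply: leq_trans hM _; rewrite ?(leq_pmull _ d0) ?(leq_pmulr _ d0).
Qed.

End GrowthUniq.

Section Cyclic.
Variables (R : realType) (p : nat) (F : fieldType) (absF : F -> R).
Variables (k : fieldType) (res : F -> k).
Hypothesis wF : strict_witt p absF res.
Let uF := sw_abs wF.
Variables (q : nat) (s : {rmorphism F -> F}).
Hypothesis fs : frob_power p absF q s.
Hypothesis s_abs : forall a, absF (s a) = absF a.
Variables (V : vectType F) (f : V -> V).
Hypothesis sf : sigma_linear s f.
Variable e : V.

Let ei i := iter i f e.

Lemma dependent_top n (c : nat -> F) :
  \sum_(i < n) c i *: ei i = 0 -> (exists2 i, (i < n)%N & c i != 0) ->
  exists2 r, (r < n)%N &
    exists b : nat -> F, ei r = \sum_(i < r) b i *: ei i.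
Proof.
elim: n => [|n IH]; first by move=> _ [].
rewrite big_ord_recr /= => S [i hi ci].
have [cn|cn] := eqVneq (c n) 0.
  rewrite cn scale0r addr0 in S.
  have [|r hr Hb] := IH S; last by exists r => //; exact: ltnW.
  exists i => //; move: hi; rewrite ltnS leq_eqVlt => /orP[/eqP ein|//].
  by rewrite ein cn eqxx in ci.
exists n => //; exists (fun i => - (c n)^-1 * c i).
apply: (scalerI cn); rewrite scaler_sumr; apply: (addrI (\sum_(i < n) c i *: ei i)).
rewrite S -big_split /= big1 // => j _.
by rewrite scalerA mulrA mulrN divff // mulN1r scaleNr subrr.
Qed.

(** The least length at which an iterate depends on the previous ones is positive since [e != 0],
    hence written [m.+1]; its minimality gives the independence. *)
Lemma cyclic_relation : e != 0 -> exists m (b : nat -> F),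
  (forall c : nat -> F, \sum_(i < m.+1) c i *: ei i = 0 ->
     forall i, (i <= m)%N -> c i = 0) /\
  ei m.+1 = \sum_(i < m.+1) b i *: ei i.
Proof.
move=> e0.
pose P r := `[< exists b : nat -> F, ei r = \sum_(i < r) b i *: ei i >].
have exP : exists r, P r.
  pose n := (dim V).+1.
  pose X := [tuple ei (i : 'I_n) | i < n].
  have nfX : ~~ free X.
    apply/negP => /eqP fX; have := dimvS (subvf <<X>>%VS).
    by rewrite fX size_tuple dimvf ltnn.
  have [c Sc [i ci]] : exists2 c : 'I_n -> F, \sum_(i < n) c i *: X`_i = 0 &
      exists i, c i != 0.
    move: nfX; apply: contraNP => H; apply/freeP => c Sc i.
    apply/eqP/negPn/negP => ci; apply: H; exists c => //; by exists i.
  have [||r _ Hr] := @dependent_top n (fun i => c (inord i)).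
  - rewrite -[RHS]Sc; apply: eq_bigr => j _.
    by rewrite inord_val -tnth_nth tnth_mktuple.
  - by exists i => //; rewrite inord_val.
  by exists r; apply/asboolP.
case: (ex_minnP exP) => r /asboolP[b Hb] min_r.
case: r => [|m] in Hb min_r *.
  by case/eqP: e0; rewrite -[LHS]/(ei 0%N) Hb big_ord0.
exists m, b; split=> // c Sc i im; apply/eqP/negPn/negP => ci.
have [|r hr Hr] := dependent_top Sc; first by exists i.
by have := min_r r; rewrite leqNgt hr => H; have := H (introT (asboolP _) Hr).
Qed.

Variables (m : nat) (b : nat -> F).
Hypothesis indep : forall c : nat -> F, \sum_(i < m.+1) c i *: ei i = 0 ->
  forall i, (i <= m)%N -> c i = 0.
Hypothesis rel : ei m.+1 = \sum_(i < m.+1) b i *: ei i.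

(** The semilinear companion matrix, acting on coordinates in [e, f e, ..., f^m e]. *)
Definition companion (y : nat -> F) (i : nat) : F :=
  (if i is i'.+1 then s (y i') else 0) + s (y m) * b i.

Lemma companionE (y : nat -> F) : f (\sum_(i < m.+1) y i *: ei i) =
  \sum_(i < m.+1) companion y i *: ei i.
Proof.
rewrite (semilinear_sum sf) /companion.
under [RHS]eq_bigr do rewrite scalerDl.
rewrite big_split /= [X in _ = X + _]big_ord_recl /= scale0r add0r [LHS]big_ord_recr /=.
congr (_ + _).
rewrite -[f (ei m)]/(ei m.+1) rel scaler_sumr.
by apply: eq_bigr => i _; rewrite scalerA.
Qed.

(** Comparing coordinates in [f v = lam *: v] expresses every coordinate through the last one, [y];
    requiring that the last coordinate be [y] again is then one twisted polynomial equation in [y].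
    The conditions on [b] say that its coefficients are integral, the constant one being 1 and some
    other one a unit. *)
Lemma cyclic_eigenvector lam : s lam = lam -> lam != 0 ->
  (forall i, (i <= m)%N -> absF (b i) <= absF lam ^+ (m.+1 - i)) ->
  (exists2 i, (i <= m)%N & absF (b i) = absF lam ^+ (m.+1 - i)) ->
  exists2 v, v != 0 & f v = lam *: v.
Proof.
move=> slam lam0 hb [i0 i0m hi0].
have al0 : 0 < absF lam by rewrite (uabs_gt0 uF).
pose g i := if i is j.+1 then - (lam ^- i * iter j s (b (m - j)%N)) else 1.
have ag j : absF (g j.+1) = absF (b (m - j)%N) / absF lam ^+ j.+1.
  by rewrite /g (uabsN uF) (uabsM uF) (uabsV uF) (uabsX uF) (frob_iter_abs s_abs) mulrC.
have [|||y y0 Hy] := @skew_poly_ker _ _ _ _ _ _ wF q s fs s_abs m.+2 g.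
- move=> [|j] hj; first by rewrite (uabs1 uF).
  rewrite ag ler_pdivrMr ?exprn_gt0 // mul1r; apply: le_trans (hb _ (leq_subr _ _)) _.
  by rewrite subSn ?leq_subr // subKn.
- by rewrite (uabs1 uF).
- exists (m - i0).+1; rewrite ?ltnS ?leq_subr //.
  by rewrite ag subKn // hi0 subSn // divff // expf_neq0 // gt_eqF.
pose x i := \sum_(j < i.+1) lam ^- j.+1 * iter j s (b (i - j)%N) * iter j.+1 s y.
have xm : x m = y.
  move: Hy; rewrite big_ord_recl /= mul1r => /eqP; rewrite addr_eq0 => /eqP ->.
  rewrite -sumrN; apply: eq_bigr => j _; rewrite /bump add1n /= /g.
  by rewrite mulNr opprK.
have x0 : lam * x 0%N = b 0%N * s y.
  by rewrite /x big_ord1 /= subn0 expr1 !mulrA divff // mul1r.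
have xS i : lam * x i.+1 = s (x i) + b i.+1 * s y.
  rewrite {1}/x big_ord_recl mulrDr addrC; congr (_ + _); last first.
    by rewrite /= subn0 expr1 !mulrA divff // mul1r.
  rewrite rmorph_sum mulr_sumr; apply: eq_bigr => j _.
  rewrite lift0 subSS !rmorphM /= fmorphV rmorphXn /= slam.
  by rewrite [lam ^+ j.+2]exprS invfM !mulrA divff // mul1r.
exists (\sum_(i < m.+1) x i *: ei i).
  apply: contraNneq y0 => /indep /(_ m (leqnn m)). by rewrite xm => ->.
rewrite companionE scaler_sumr; apply: eq_bigr => i _; rewrite scalerA.
congr (_ *: _); rewrite /companion xm; case: i => [[|i] hi] /=.
  by rewrite add0r x0 mulrC.
by rewrite xS [s y * _]mulrC.
Qed.

Section Radius.
Variable rho : R.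
Hypothesis rho0 : 0 < rho.
Hypothesis hb : forall i, (i <= m)%N -> absF (b i) * rho ^+ i <= rho ^+ m.+1.
Variable i0 : nat.
Hypothesis i0m : (i0 <= m)%N.
Hypothesis hi0 : absF (b i0) * rho ^+ i0 = rho ^+ m.+1.
Hypothesis min_i0 : forall i, (i < i0)%N -> absF (b i) * rho ^+ i < rho ^+ m.+1.

Let y N := iter N companion (fun i => (i == m)%:R).

Lemma cyclic_coordE N : ei (m + N)%N = \sum_(i < m.+1) y N i *: ei i.
Proof.
elim: N => [|N IH].
  rewrite addn0 (bigD1 ord_max) //= eqxx scale1r big1 ?addr0 // => i.
  by rewrite -val_eqE /= => /negPf ->; rewrite scale0r.
by rewrite addnS /ei iterS -/(ei (m + N)%N) IH companionE.
Qed.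

(** Coordinates are weighted by [rho ^+ i]. The maximal weight has to grow by exactly [rho] at each
    step, and the danger is cancellation between the shifted term and the one coming from the
    relation. Taking [i0] least, and keeping the weights below [i0] strictly smaller, excludes
    it. *)
Lemma cyclic_coord_growth N :
  [/\ forall i, (i <= m)%N -> absF (y N i) * rho ^+ i <= rho ^+ (m + N),
      forall i, (i < i0)%N -> absF (y N i) * rho ^+ i < rho ^+ (m + N) &
      exists2 i, (i0 <= i <= m)%N & absF (y N i) * rho ^+ i = rho ^+ (m + N)].
Proof.
have r0 i : 0 < rho ^+ i by rewrite exprn_gt0.
elim: N => [|N [Ha Hb [i /andP[i0i im] Hc]]].
  rewrite addn0; split=> [i _|i hi|].
  - rewrite /y /=; case: eqP => [->|_]; first by rewrite (uabs1 uF) mul1r.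
    by rewrite (uabs0 uF) mul0r ltW.
  - rewrite /y /= (_ : (i == m) = false) ?(uabs0 uF) ?mul0r //.
    by apply/ltn_eqF; exact: leq_trans i0m.
  exists m; first by rewrite i0m leqnn.
  by rewrite /y /= eqxx (uabs1 uF) mul1r.
have ym : absF (y N m) <= rho ^+ N.
  by rewrite -(ler_pM2r (r0 m)) -exprD addnC; exact: Ha.
have yS j : y N.+1 j = companion (y N) j by [].
have sc x j c : (absF x * rho ^+ j <= c) = (absF x <= c / rho ^+ j).
  by rewrite ler_pdivlMr.
have sc' x j c : (absF x * rho ^+ j < c) = (absF x < c / rho ^+ j).
  by rewrite ltr_pdivlMr.
have e2 : rho ^+ (m + N.+1) = rho ^+ N * rho ^+ m.+1 by rewrite -exprD; congr (_ ^+ _); lia.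
have e3 : rho ^+ (m + N.+1) = rho ^+ (m + N) * rho by rewrite -exprSr; congr (_ ^+ _); lia.
have t2 j : (j <= m)%N -> absF (s (y N m) * b j) * rho ^+ j <= rho ^+ (m + N.+1).
  move=> jm; rewrite (uabsM uF) s_abs e2 -mulrA.
  by apply: ler_pM; rewrite ?(uabs_ge0 uF) ?mulr_ge0 ?(uabs_ge0 uF) ?hb // ltW.
have t2' j : (j < i0)%N -> absF (s (y N m) * b j) * rho ^+ j < rho ^+ (m + N.+1).
  move=> jm; rewrite (uabsM uF) s_abs e2 -mulrA.
  apply: (@le_lt_trans _ _ (rho ^+ N * (absF (b j) * rho ^+ j))).
    by rewrite ler_wpM2r // mulr_ge0 ?(uabs_ge0 uF) // ltW.
  by rewrite ltr_pM2l ?min_i0.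
have t1 j : (j.+1 <= m)%N -> absF (s (y N j)) * rho ^+ j.+1 <= rho ^+ (m + N.+1).
  by move=> jm; rewrite s_abs exprSr mulrA e3 ler_pM2r ?Ha // ltnW.
have t1' j : (j < i0)%N -> absF (s (y N j)) * rho ^+ j.+1 < rho ^+ (m + N.+1).
  by move=> jm; rewrite s_abs exprSr mulrA e3 ltr_pM2r ?Hb.
split=> [j jm|j jm|].
- rewrite yS /companion sc; apply: (uabsD_le uF); rewrite -sc ?t2 //.
  by case: j jm => [|j] jm; [rewrite (uabs0 uF) mul0r ltW|rewrite t1].
- rewrite yS /companion sc'; apply: (uabsD_lt uF); rewrite -sc' ?t2' //.
  by case: j jm => [|j] jm; [rewrite (uabs0 uF) mul0r|rewrite t1' // ltnW].
(* If the last coordinate is not maximal, a maximal one moves up by one place undisturbed. If it is,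
   the relation feeds it into place [i0], where the shifted term is strictly smaller. *)
have [ym1|ym1] := ltP (absF (y N m)) (rho ^+ N).
  have im' : (i < m)%N.
    rewrite ltn_neqAle im andbT; apply: contraTneq ym1 => eim.
    by rewrite -leNgt -(ler_pM2r (r0 m)) -exprD addnC -Hc eim.
  exists i.+1; first by rewrite im' leqW.
  have ei1 : absF (s (y N i)) * rho ^+ i.+1 = rho ^+ (m + N.+1).
    by rewrite s_abs exprSr mulrA Hc e3.
  rewrite yS /companion (uabsD_eq uF) //.
  rewrite -(ltr_pM2r (r0 i.+1)) ei1 (uabsM uF) s_abs -mulrA e2.
  apply: (@le_lt_trans _ _ (absF (y N m) * rho ^+ m.+1)).
    by rewrite ler_wpM2l ?(uabs_ge0 uF) ?hb.
  by rewrite ltr_pM2r.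
have {}ym1 : absF (y N m) = rho ^+ N by apply/le_anti/andP.
exists i0; first by rewrite leqnn.
have ei1 : absF (s (y N m) * b i0) * rho ^+ i0 = rho ^+ (m + N.+1).
  by rewrite (uabsM uF) s_abs -mulrA hi0 ym1 e2.
rewrite yS /companion addrC (uabsD_eq uF) // -(ltr_pM2r (r0 i0)) ei1.
by case: i0 t1' => [|j] t1'; [rewrite (uabs0 uF) mul0r|rewrite t1'].
Qed.

(** The lower bound is tested on the coordinate forms of the free family of iterates: at each step
    one of them has maximal weight. *)
Lemma cyclic_growth : growth absF f e rho.
Proof.
have r0 i : 0 < rho ^+ i by rewrite exprn_gt0.
split=> [l hl|].
  exists (\sum_(i < m.+1) rho ^- i * absF (l (ei i))), m => M hM.
  rewrite -[M](subnKC hM) -/(ei _) cyclic_coordE (linear_form_sum _ _ hl).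
  have [Ha _ _] := cyclic_coord_growth (M - m)%N.
  have H0 (i : 'I_m.+1) : 0 <= rho ^- i * absF (l (ei i)).
    by rewrite mulr_ge0 ?(uabs_ge0 uF) // invr_ge0 ltW.
  apply: (uabs_sum_le uF) => [|i _].
    by rewrite mulr_ge0 ?sumr_ge0 // ltW.
  have hi : (i <= m)%N by rewrite -ltnS.
  rewrite (uabsM uF) mulrC; apply: (@le_trans _ _ (absF (l (ei i)) * (rho ^- i * rho ^+ (m + (M - m))))).
    by rewrite ler_wpM2l ?(uabs_ge0 uF) // mulrC ler_pdivlMr // Ha.
  rewrite mulrA [X in X * _ <= _]mulrC ler_pM2r // (bigD1 i) //= lerDl.
  exact: sumr_ge0.
pose X := [tuple ei (i : 'I_m.+1) | i < m.+1].
have XE (i : 'I_m.+1) : X`_i = ei i by rewrite -tnth_nth tnth_mktuple.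
have fX : free X.
  apply/freeP => c Sc i; have := @indep (fun i => c (inord i)) _ i.
  rewrite inord_val; apply; last by rewrite -ltnS.
  by rewrite -[RHS]Sc; apply: eq_bigr => j _; rewrite inord_val XE.
exists m.+1, (coord X); split=> [i|].
  by split=> [x z|a x]; rewrite ?linearD ?linearZ.
exists (\sum_(i < m.+1) rho ^+ i), m => M hM.
have [_ _ [i /andP[_ im] Hi]] := cyclic_coord_growth (M - m)%N.
exists (Ordinal (im : (i < m.+1)%N)).
rewrite -[M](subnKC hM) -Hi -/(ei _) cyclic_coordE.
under [X in coord _ _ X]eq_bigr do rewrite -XE.
rewrite (@coord_sum_free _ _ _ X (fun j => y (M - m)%N j)) //=.
rewrite mulrC ler_wpM2r ?(uabs_ge0 uF) //.
rewrite (bigD1 (Ordinal (im : (i < m.+1)%N))) //= lerDl sumr_ge0 // => j _.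
by rewrite ltW.
Qed.

End Radius.
End Cyclic.

(** * Eigenvectors and Frobenius slopes *)

Section Dieudonne.
Variables (R : realType) (p : nat) (F : fieldType) (absF : F -> R).
Variables (k : fieldType) (res : F -> k).
Hypothesis wF : strict_witt p absF res.
Let uF := sw_abs wF.

(** The value group is infinite cyclic, so any two absolute values are commensurable; the exponent
    [n] is the absolute ramification index. *)
Lemma sw_abs_pow a : a != 0 -> exists n (c : int), (0 < n)%N /\
  absF a ^+ n = absF (p%:R ^ c).
Proof.
move=> a0; have [pi [/andP[pi0 pi1] H]] := sw_unif wF.
have [z Ez] := H a a0; have [e Ee] := H _ (sw_p_neq0 wF).
have /andP[_ p1] := sw_p wF.
have e0 : 0 < e.
  by move: p1; rewrite Ee -[X in _ < X](expr0z (absF pi)) (ltr_iXz2l pi0 pi1).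
case: e e0 Ee => // n n0 Ee; exists n, z; split=> //.
by rewrite (uabsXz uF) Ee Ez exprnP !exprz_exp mulrC.
Qed.

Section OneFrobenius.
Variables (q : nat) (s : {rmorphism F -> F}).
Hypothesis fs : frob_power p absF q s.
Hypothesis s_abs : forall a, absF (s a) = absF a.

Lemma frob_power_iter d : (0 < d)%N -> frob_power p absF (q ^ d) (iter d s).
Proof.
case: fs => pq q1 H d0; split=> [||a ha].
- by rewrite pnatX pq.
- by rewrite -[1%N](exp1n d) ltn_exp2r.
rewrite (frob_iter_abs s_abs); split=> //.
apply/(res_eq uF (sw_res wF)); rewrite ?(frob_iter_abs s_abs) ?(uabs_le1X uF) //.
by rewrite (frob_iter_res wF fs s_abs) // (resX uF (sw_res wF)).
Qed.

Lemma rmorph_pz (c : int) : s (p%:R ^ c) = p%:R ^ c.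
Proof. by rewrite fmorphXz rmorph_nat. Qed.

Lemma frob_surj a : exists t, s t = a.
Proof.
have [|t] := @skew_poly_surj _ _ _ _ _ _ wF q s fs s_abs 2
  (fun i => if i == 0%N then 0 else 1) a.
  by exists 1%N => //; exact: oner_neq0.
by rewrite big_ord_recl big_ord1 /= mul0r add0r mul1r => ?; exists t.
Qed.

Section Module.
Variables (V : vectType F) (f : V -> V).
Hypothesis sf : sigma_linear s f.
Hypothesis f_inj : forall x, f x = 0 -> x = 0.

Lemma iter_semilinear_inj n x : iter n f x = 0 -> x = 0.
Proof. by elim: n => //= n IH /f_inj. Qed.

(** [rho] is the largest of the numbers [|b i|^(1 / (m.+1 - i))], that is, the extreme slope of the
    Newton polygon of the relation; it is nonzero because [f] is injective. The growth is computed
    with the least index attaining this maximum, and attainment is also what an eigenvalue of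
    absolute value [rho] requires. *)
Lemma cyclic_radius e : e != 0 -> exists rho : R,
  [/\ 0 < rho, growth absF f e rho,
      (exists n a, [/\ (0 < n)%N, a != 0 & rho ^+ n = absF a]) &
      forall lam, s lam = lam -> lam != 0 -> absF lam = rho ->
        exists2 v, v != 0 & f v = lam *: v].
Proof.
move=> e0; have [m [b [indep rel]]] := @cyclic_relation F V f e e0.
pose w i := absF (b i) `^ (m.+1 - i)%:R^-1.
have wE i : (i <= m)%N -> w i ^+ (m.+1 - i) = absF (b i).
  move=> im; rewrite -powR_mulrn ?powR_ge0 // -powRrM mulVf ?powRr1 ?(uabs_ge0 uF) //.
  by rewrite pnatr_eq0 subn_eq0 -ltnNge.
pose j := [arg max_(i > (ord0 : 'I_m.+1)) w i]%O.
have wj i : (i <= m)%N -> w i <= w j.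
  move=> im; rewrite /j; case: arg_maxP => //= i0 _ /(_ (Ordinal (im : (i < m.+1)%N))).
  exact.
have jm : (j <= m)%N by rewrite -ltnS.
have [i1 i1m bi1] : exists2 i, (i <= m)%N & b i != 0.
  apply: contrapT => H.
  have : iter m.+1 f e = 0.
    rewrite rel big1 // => i _; have [->|bi] := eqVneq (b i) 0; first by rewrite scale0r.
    by case: H; exists i => //; rewrite -ltnS.
  by move/iter_semilinear_inj => ee; rewrite ee eqxx in e0.
have rho0 : 0 < w j.
  apply: lt_le_trans (wj _ i1m); rewrite lt_def powR_ge0 andbT.
  apply: contraNneq bi1 => wi; rewrite -(uabs_eq0 uF) -wE // wi expr0n.
  by rewrite subn_eq0 ltnNge i1m.
have hb i : (i <= m)%N -> absF (b i) <= w j ^+ (m.+1 - i).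
  move=> im; rewrite -wE //; apply: lerXn2r; rewrite ?nnegrE ?powR_ge0 ?wj //.
have splitE i : (i <= m)%N -> w j ^+ m.+1 = w j ^+ (m.+1 - i) * w j ^+ i.
  by move=> im; rewrite -exprD subnK // leqW.
exists (w j); split=> //.
- have ex : exists i, (i <= m)%N && (absF (b i) == w j ^+ (m.+1 - i)).
    by exists j; rewrite jm wE //= eqxx.
  case: (ex_minnP ex) => i0 /andP[i0m /eqP hi0] min_i0.
  apply: (@cyclic_growth _ _ _ _ _ _ wF s s_abs V f sf e m b indep rel (w j) rho0 _ i0 i0m).
  + by move=> i im; rewrite (splitE i) // ler_wpM2r ?hb // exprn_ge0 // ltW.
  + by rewrite hi0 -splitE.
  move=> i ii0; have im : (i <= m)%N by apply: leq_trans (ltnW ii0) i0m.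
  rewrite (splitE i) // ltr_pM2r ?exprn_gt0 // lt_neqAle hb // andbT.
  by apply/negP => H; have := min_i0 i; rewrite im H leqNgt ii0 => /(_ isT).
- exists (m.+1 - j)%N, (b j); split; first by rewrite subn_gt0.
    by rewrite -(uabs_gt0 uF) -wE // exprn_gt0.
  by rewrite wE.
move=> lam slam lam0 alam.
apply: (@cyclic_eigenvector _ _ _ _ _ _ wF q s fs s_abs V f sf e m b indep rel lam slam lam0).
  by move=> i im; rewrite alam hb.
by exists j => //; rewrite alam wE.
Qed.

End Module.
End OneFrobenius.

(** Some power [rho ^+ d] of the radius is [|p ^ c|]. Uniqueness of the growth identifies it with
    the radius of [iter d f] on [e], although the relation satisfied by [e] under [iter d f] is a
    different one. *)
Lemma eigenvector_exists q (s : {rmorphism F -> F}) (V : vectType F) (f : V -> V) :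
  frob_power p absF q s -> (forall a, absF (s a) = absF a) ->
  sigma_linear s f -> (forall x, f x = 0 -> x = 0) ->
  forall e : V, e != 0 ->
  exists d (c : int) v, [/\ (0 < d)%N, v != 0 & iter d f v = p%:R ^ c *: v].
Proof.
move=> fs s_abs sf f_inj e e0.
have [rho [rho0 gr [n [a [n0 a0 ha]]] _]] := cyclic_radius fs s_abs sf f_inj e0.
have [n' [c [n'0 hc]]] := sw_abs_pow a0.
pose d := (n * n')%N; have d0 : (0 < d)%N by rewrite muln_gt0 n0.
have [rho' [rho'0 gr' _]] := @cyclic_radius _ (iter d s) (frob_power_iter fs s_abs d0)
  (frob_iter_abs s_abs d) V (iter d f) (semilinear_iter sf d)
  (iter_semilinear_inj f_inj (n := d)) e e0.
move=> /(_ (p%:R ^ c)) [].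
- by elim: (d) => //= j ->; rewrite rmorph_pz.
- by rewrite expfz_neq0 // (sw_p_neq0 wF).
- rewrite (growth_uniq uF rho'0 _ gr' (growth_iter d0 gr)) ?exprn_gt0 //.
  by rewrite /d exprM ha hc.
by move=> v v0 hv; exists d, c, v.
Qed.

(** The correction solves [p^c s(x) - p^b x = - t], which is possible for all [b] and [c] by
    surjectivity of twisted polynomials: extensions of eigenlines split. *)
Lemma quotient_eigenvector_lift q (s : {rmorphism F -> F}) (V : vectType F)
  (f : V -> V) (v y : V) (b c : int) (t : F) :
  frob_power p absF q s -> (forall a, absF (s a) = absF a) ->
  sigma_linear s f -> f v = p%:R ^ c *: v -> f y = p%:R ^ b *: y + t *: v ->
  exists x, f (y + x *: v) = p%:R ^ b *: (y + x *: v).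
Proof.
move=> fs s_abs [fD fZ] fv fy.
have [|x] := @skew_poly_surj _ _ _ _ _ _ wF q s fs s_abs 2
  (fun i => if i == 0%N then - p%:R ^ b else p%:R ^ c) (- t).
  by exists 1%N => //=; rewrite expfz_neq0 // (sw_p_neq0 wF).
rewrite big_ord_recl big_ord1 /= => Hx; exists x.
rewrite fD fZ fv fy scalerDr !scalerA -addrA -scalerDl; congr (_ + _ *: _).
by apply/eqP; rewrite -subr_eq0; apply/eqP; move: Hx => /eqP; rewrite -addr_eq0 => /eqP <-; ring.
Qed.

(** Split off an eigenline of some iterate, apply the induction hypothesis to the quotient with that
    iterate as the new Frobenius structure, and lift the eigenvectors found there. A spanning family
    suffices, since a basis can be extracted from it. *)
Lemma dieudonne_manin n : forall q (s : {rmorphism F -> F}) (V : vectType F)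
  (f : V -> V), dim V = n ->
  frob_power p absF q s -> (forall a, absF (s a) = absF a) ->
  sigma_linear s f -> (forall x, f x = 0 -> x = 0) ->
  exists D (X : seq V), [/\ (0 < D)%N, <<X>>%VS = fullv &
    forall x, x \in X -> exists c : int, iter D f x = p%:R ^ c *: x].
Proof.
elim: n => [|n IH] q s V f dV fs s_abs sf f_inj.
  exists 1%N, [::]; split=> //; apply/eqP.
  by rewrite span_nil eq_sym -dimv_eq0 dimvf dV.
have V0 : fullv != 0%VS :> {vspace V} by rewrite -dimv_eq0 dimvf dV.
have e0 : vpick (@fullv F V) != 0 by rewrite vpick0.
have [d [c [v [d0 v0 fv]]]] := eigenvector_exists fs s_abs sf f_inj e0.
pose g := iter d f; have sg : sigma_linear (iter d s) g := semilinear_iter sf d.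
have g_inj x : g x = 0 -> x = 0 := @iter_semilinear_inj V f f_inj d x.
have fs' := frob_power_iter fs s_abs d0; have s_abs' := frob_iter_abs s_abs d.
pose U := <[v]>%VS; pose W := (U^C)%VS.
(* [P] projects along the line [U] onto a complement [W], so that [subvs_of W] with [P \o g] is a
   model of the quotient by [U]. *)
pose P x := x - projv U x.
have PW x : P x \in W by exact: memv_projC.
have Pid x : x \in W -> P x = x.
  move=> xW; have : projv U x \in (U :&: W)%VS.
    rewrite memv_cap memv_proj /= -[projv U x](subKr x) rpredB //; exact: memv_projC.
  by rewrite capv_compl memv0 /P => /eqP ->; rewrite subr0.
have PU x : x \in U -> P x = 0 by move=> xU; rewrite /P projv_id // subrr.
have PD x y : P (x + y) = P x + P y by rewrite /P linearD opprD addrACA.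
have PZ a x : P (a *: x) = a *: P x by rewrite /P linearZ /= scalerBr.
pose V' := subvs_of W.
pose f' (w : V') : V' := vsproj W (P (g (vsval w))).
have vf' w : vsval (f' w) = P (g (vsval w)) by rewrite vsprojK.
have sf' : sigma_linear (iter d s) f'.
  split=> [x y|a x]; apply: val_inj; rewrite /= vsprojK //.
    by rewrite (proj1 sg) PD -!vf'.
  by rewrite (proj2 sg) PZ -!vf'.
have gU a : g (a *: v) = (iter d s a * p%:R ^ c) *: v.
  by rewrite (proj2 sg) /g fv scalerA.
have gU' x : x \in U -> g x \in U.
  by move=> /vlineP[a ->]; rewrite gU rpredZ // memv_line.
have f'_inj w : f' w = 0 -> w = 0.
  move=> /(congr1 val) /=; rewrite vsprojK // => /eqP; rewrite subr_eq0 => /eqP gw.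
  have /vlineP[a ha] : g (vsval w) \in U by rewrite gw memv_proj.
  (* Surjectivity of the Frobenius makes [g] map [U] onto [U]; hence [g w] in [U] forces [w] in
     [U]. *)
  have [a' ha'] := frob_surj fs' s_abs' (a / p%:R ^ c).
  have : vsval w - a' *: v = 0.
    apply: g_inj; rewrite (semilinearB sg) gU ha [iter d s a']ha' divfK ?subrr //.
    by rewrite expfz_neq0 // (sw_p_neq0 wF).
  move/eqP; rewrite subr_eq0 => /eqP ew.
  have : vsval w \in (U :&: W)%VS.
    by rewrite memv_cap subvsP andbT ew rpredZ // memv_line.
  by rewrite capv_compl memv0 => /eqP w0; apply: val_inj.
have dV' : dim V' = n.
  by have := dimv_compl U; rewrite dimvf dV dim_vline v0 subSS subn0.
have [D' [Y [D'0 spY hY]]] := IH _ _ V' f' dV' fs' s_abs' sf' f'_inj.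
have Pg x : P (g (P x)) = P (g x).
  rewrite {2}/P (semilinearB sg) {1}/P -/(P _).
  have -> : P (g x - g (projv U x)) = P (g x) + P (- g (projv U x)) by exact: PD.
  by rewrite [X in _ + X]PU ?addr0 // rpredN gU' // memv_proj.
have itP j (w : V') : vsval (iter j f' w) = P (iter j g (vsval w)).
  elim: j => [|j IHj] /=; first by rewrite Pid // subvsP.
  by rewrite vsprojK // IHj Pg.
have [h hh] : exists h : V' -> V, forall y, y \in Y -> (exists x, h y = vsval y + x *: v) /\
    exists b : int, iter (D' * d) f (h y) = p%:R ^ b *: h y.
  have H (y : V') : exists h, y \in Y -> (exists x, h = vsval y + x *: v) /\
      exists b : int, iter (D' * d) f h = p%:R ^ b *: h; last first.
    exists (fun y => projT1 (cid (H y))) => y; exact: (projT2 (cid (H y))).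
  have [yY|] := boolP (y \in Y); last by exists 0.
  have [b hb] := hY y yY.
  (* [t] is the component along [v] by which the lift [vsval y] fails to be an eigenvector. *)
  pose r := iter D' g (vsval y); have /vlineP[t ht] : projv U r \in U by exact: memv_proj.
  have D'd0 : (0 < D' * d)%N by rewrite muln_gt0 D'0.
  have [||x hx] := @quotient_eigenvector_lift _ (iter (D' * d) s) V (iter (D' * d) f) v (vsval y)
    b (c * D'%:Z) t (frob_power_iter fs s_abs D'd0) (frob_iter_abs s_abs _) (semilinear_iter sf _).
  - rewrite -iter_iter_mul -/g; elim: (D') => [|j IHj]; first by rewrite mulr0 expr0z scale1r.
    rewrite iterS IHj gU; congr (_ *: _).
    have -> : iter d s (p%:R ^ (c * j%:Z)) = p%:R ^ (c * j%:Z).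
      by elim: (d) => //= i ->; rewrite rmorph_pz.
    by rewrite -expfzDr ?(sw_p_neq0 wF) // intS mulrDr mulr1 addrC.
  - rewrite -iter_iter_mul -/g -/r -[LHS](subrK (projv U r)) ht; congr (_ + _).
    by rewrite -ht -/(P r) -itP hb.
  exists (vsval y + x *: v) => _; split; first by exists x.
  by exists b.
exists (D' * d)%N, (v :: [seq h y | y <- Y]); split.
- by rewrite muln_gt0 D'0.
- apply/eqP; rewrite eqEsubv subvf /=; apply/subvP => x _.
  rewrite -[x](subrK (projv U x)); apply: memvD; last first.
    have /vlineP[t ->] : projv U x \in U by exact: memv_proj.
    by rewrite memvZ // memv_span // inE eqxx.
  rewrite -/(P x); have [w ->] : exists w : V', P x = vsval w.
    by exists (vsproj W (P x)); rewrite vsprojK.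
  have wY : w \in <<in_tuple Y>>%VS by rewrite spY memvf.
  rewrite (coord_span wY) linear_sum; apply: memv_suml => i _; rewrite linearZ memvZ //=.
  have iY : Y`_i \in Y by rewrite mem_nth.
  have [[t ht] _] := hh _ iY.
  have -> : vsval Y`_i = h Y`_i - t *: v by rewrite ht addrK.
  apply: memvB; first by rewrite memv_span // inE map_f ?orbT.
  by rewrite memvZ // memv_span // inE eqxx.
move=> x; rewrite inE => /predU1P[->|/mapP[y yY ->]].
  exists (c * D'%:Z); rewrite -iter_iter_mul -/g; elim: (D') => [|j IHj].
    by rewrite mulr0 expr0z scale1r.
  rewrite iterS IHj gU; congr (_ *: _).
  have -> : iter d s (p%:R ^ (c * j%:Z)) = p%:R ^ (c * j%:Z).
    by elim: (d) => //= i ->; rewrite rmorph_pz.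
  by rewrite -expfzDr ?(sw_p_neq0 wF) // intS mulrDr mulr1 addrC.
by have [_] := hh y yY.
Qed.

End Dieudonne.

Lemma free_subseq_span (F : fieldType) (V : vectType F) (X : seq V) :
  exists2 Y : seq V, {subset Y <= X} & free Y /\ <<Y>>%VS = <<X>>%VS.
Proof.
elim: X => [|x X [Y sYX [fY spY]]]; first by exists [::] => //; rewrite nil_free.
have [xY|xY] := boolP (x \in <<Y>>%VS).
  exists Y; first by move=> y yY; rewrite inE sYX ?orbT.
  split=> //; rewrite span_cons -spY; apply/esym/addv_idPr.
  by rewrite -memvE.
exists (x :: Y); first by move=> y; rewrite !inE => /predU1P[->|/sYX->]; rewrite ?eqxx ?orbT.
by rewrite free_cons xY fY !span_cons spY.
Qed.

Lemma is_basis_tuple (F : fieldType) (V : vectType F) n (X : n.-tuple V) :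
  basis_of fullv X -> is_basis (fun i : 'I_n => X`_i).
Proof.
move=> bX x; exists (\row_i coord X i x); split.
  by rewrite {1}(coord_basis bX (memvf x)); apply: eq_bigr => i _; rewrite mxE.
move=> c ->; apply/rowP => i; rewrite mxE coord_sum_free //; exact: basis_free bX.
Qed.

Lemma spanning_basis (F : fieldType) (V : vectType F) (X : seq V) :
  <<X>>%VS = fullv ->
  exists Y : (dim V).-tuple V, basis_of fullv Y /\ {subset Y <= X}.
Proof.
move=> spX; have [Y sYX [fY spY]] := free_subseq_span X.
have sY : size Y == dim V.
  by have /eqP <- := fY; rewrite spY spX dimvf.
exists (Tuple sY); split=> //.
by rewrite /basis_of /= spY spX eqxx.
Qed.

(** The lattice on a basis of fixed vectors is stable because [s] is isometric, and generated by its
    image because each basis vector is its own image. *)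
Lemma etale_fixed_span (R : realType) (F : fieldType) (absF : F -> R)
    (s : F -> F) (V : vectType F) (f : V -> V) (X : seq V) :
  ultrametric_abs absF -> (forall a, absF (s a) = absF a) ->
  sigma_linear s f -> <<X>>%VS = fullv ->
  (forall x, x \in X -> f x = x) -> etale absF f.
Proof.
move=> uF s_abs sf spX fX; have [Y [bY sYX]] := spanning_basis spX.
have fY (i : 'I_(dim V)) : f Y`_i = Y`_i.
  by apply/fX/sYX/mem_nth; rewrite size_tuple.
exists [set x | exists2 c : 'rV[F]_(dim V),
  (forall i, absF (c 0 i) <= 1) & x = \sum_i c 0 i *: Y`_i]; split.
- by exists (fun i => Y`_i) => //; exact: is_basis_tuple.
- move=> x [c hc ->]; exists (\row_i s (c 0 i)).
    by move=> i; rewrite mxE s_abs.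
  by rewrite (semilinear_sum sf) //; apply: eq_bigr => i _; rewrite mxE fY.
move=> x [c hc ->]; exists (dim V), (fun i => c 0 i), (fun i => Y`_i); split.
  move=> i; split=> //; exists (delta_mx 0 i).
    by move=> j; rewrite mxE; exact: (uabs_nat uF).
  rewrite (bigD1 i) //= mxE !eqxx scale1r big1 ?addr0 // => j ji.
  by rewrite mxE (negPf ji) andbF scale0r.
by apply: eq_bigr => i _; rewrite fY.
Qed.

Section SubSemilinear.
Variables (F : fieldType) (s : {rmorphism F -> F}) (V : vectType F).
Variables (phi : {linear V -> V | s \; *:%R}) (U : {vspace V}).

(** The projection makes this total for any [U]; on a [phi]-stable [U] it is the restriction of
    [phi]. *)
Definition sub_semilinear (x : subvs_of U) : subvs_of U :=
  vsproj U (phi (vsval x)).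

Lemma sub_semilinear_is_linear : linear_for (s \; *:%R) sub_semilinear.
Proof.
by move=> a x y; rewrite /sub_semilinear !linearP.
Qed.

HB.instance Definition _ :=
  GRing.isLinear.Build F (subvs_of U) (subvs_of U) (s \; *:%R) sub_semilinear
    sub_semilinear_is_linear.

End SubSemilinear.

(** * The slope filtration read off an eigenbasis of an iterate *)

Section EigenFiltration.
Variables (R : realType) (p : nat) (F : fieldType) (absF : F -> R).
Variables (k : fieldType) (res : F -> k).
Hypothesis wF : strict_witt p absF res.
Let uF := sw_abs wF.
Hypothesis absF_p : absF p%:R = p%:R^-1.
Variables (q : nat) (s : {rmorphism F -> F}).
Hypothesis fs : frob_power p absF q s.
Hypothesis s_abs : forall a, absF (s a) = absF a.
Variables (V : vectType F) (phi : {linear V -> V | s \; *:%R}).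

Lemma linear_sigma_linear : sigma_linear s phi.
Proof. by split=> [x y|a x]; rewrite ?linearD ?linearZ. Qed.

Variables (D : nat) (D0 : (0 < D)%N).
Variables (Z : (dim V).-tuple V) (bZ : basis_of fullv Z).
Variable (c : 'I_(dim V) -> int).
Hypothesis Zc : forall i : 'I_(dim V), iter D phi Z`_i = p%:R ^ c i *: Z`_i.

Definition slope_proj (Q : pred int) (x : V) : V :=
  \sum_(i | Q (c i)) coord Z i x *: Z`_i.

Lemma slope_proj_is_linear Q : linear (slope_proj Q).
Proof.
move=> a x y; rewrite /slope_proj scaler_sumr -big_split; apply: eq_bigr => i _ /=.
by rewrite linearP /= scalerDl scalerA.
Qed.

HB.instance Definition _ Q :=
  GRing.isLinear.Build F V V *:%R (slope_proj Q) (slope_proj_is_linear Q).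

Lemma coord_slope_proj Q i x :
  coord Z i (slope_proj Q x) = if Q (c i) then coord Z i x else 0.
Proof.
have fZ := basis_free bZ.
rewrite /slope_proj big_mkcond /=.
have -> : \sum_j (if Q (c j) then coord Z j x *: Z`_j else 0) =
    \sum_j (if Q (c j) then coord Z j x else 0) *: Z`_j.
  by apply: eq_bigr => j _; case: ifP => // _; rewrite scale0r.
by rewrite coord_sum_free.
Qed.

Lemma slope_projZ Q a x : slope_proj Q (a *: x) = a *: slope_proj Q x.
Proof.
by rewrite /slope_proj scaler_sumr; apply: eq_bigr => i _; rewrite linearZ scalerA.
Qed.

Lemma coordP x y : (forall i, coord Z i x = coord Z i y) -> x = y.
Proof.
move=> H; rewrite (coord_basis bZ (memvf x)) (coord_basis bZ (memvf y)).
by apply: eq_bigr => i _; rewrite H.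
Qed.

Lemma slope_projI Q Q' x :
  slope_proj Q (slope_proj Q' x) = slope_proj (predI Q Q') x.
Proof.
by apply: coordP => i; rewrite !coord_slope_proj /=; case: (Q _); case: (Q' _).
Qed.

Lemma iter_phi_comm n x : iter n phi (phi x) = phi (iter n phi x).
Proof. by rewrite -iterSr. Qed.

(** [phi] commutes with its iterate, so a nonzero coordinate of [phi Z_i] along [Z_j] is scaled by
    [|p|^(c i)] and by [|p|^(c j)] alike, which forces the exponents to agree. *)
Lemma coord_phi_eq0 i j : c j != c i -> coord Z j (phi Z`_i) = 0.
Proof.
move=> cji; apply/eqP; apply/negPn/negP => x0.
pose y := phi Z`_i.
have : coord Z j (iter D phi y) = p%:R ^ c i * coord Z j y.
  rewrite /y iter_phi_comm Zc (linearZ_LR phi) /= (rmorph_pz _ s (c i)).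
  by rewrite linearZ.
rewrite {1}(coord_basis bZ (memvf y)).
rewrite (semilinear_sum (semilinear_iter linear_sigma_linear D)).
have -> : \sum_l iter D s (coord Z l y) *: iter D phi Z`_l =
    \sum_l (iter D s (coord Z l y) * p%:R ^ c l) *: Z`_l.
  by apply: eq_bigr => l _; rewrite Zc scalerA.
rewrite (coord_sum_free _ _ (basis_free bZ)) => /(congr1 absF).
rewrite !(uabsM uF) (frob_iter_abs s_abs) mulrC => /mulIf.
rewrite (uabs_eq0 uF) => /(_ x0); rewrite !(uabsXz uF).
have /andP[p0 p1] := sw_p wF.
move=> H; case/eqP: cji; apply/le_anti.
by rewrite -!(ler_iXz2l p0 p1) H !lexx.
Qed.

Lemma slope_proj_phi Q x : slope_proj Q (phi x) = phi (slope_proj Q x).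
Proof.
have H (i : 'I_(dim V)) : slope_proj Q (phi Z`_i) = phi (slope_proj Q Z`_i).
  have e1 : slope_proj Q Z`_i = (if Q (c i) then 1 else 0) *: Z`_i.
    apply: coordP => j; rewrite coord_slope_proj linearZ /= (coord_free _ _ (basis_free bZ)).
    have [->|ij] := eqVneq i j; first by case: (Q _); rewrite ?mul1r ?mul0r.
    by rewrite mulr0; case: ifP.
  rewrite e1 (linearZ_LR phi) /=; apply: coordP => j; rewrite coord_slope_proj linearZ /=.
  have [cji|cji] := eqVneq (c j) (c i).
    by rewrite cji; case: (Q _); rewrite ?rmorph1 ?rmorph0 ?mul1r ?mul0r.
  by rewrite coord_phi_eq0 // mulr0; case: ifP.
rewrite (coord_basis bZ (memvf x)) (semilinear_sum linear_sigma_linear).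
have sp : sigma_linear id (slope_proj Q).
  by split=> [y z|a y]; [exact: (raddfD (slope_proj Q))|exact: slope_projZ].
rewrite !(semilinear_sum sp) (semilinear_sum linear_sigma_linear).
by apply: eq_bigr => i _; rewrite H.
Qed.

Definition slope_space (Q : pred int) : {vspace V} := limg (linfun (slope_proj Q)).

Lemma mem_slope_space Q x : (x \in slope_space Q) = (slope_proj Q x == x).
Proof.
apply/idP/eqP => [/memv_imgP[y _ ->]|<-].
  by rewrite lfunE slope_projI; apply: coordP => i; rewrite !coord_slope_proj /= andbb.
by rewrite -lfunE memv_img ?memvf.
Qed.

Lemma slope_proj_mem Q x : slope_proj Q x \in slope_space Q.
Proof. by rewrite -lfunE memv_img ?memvf. Qed.

Lemma slope_space_basis Q (i : 'I_(dim V)) : (Z`_i \in slope_space Q) = Q (c i).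
Proof.
rewrite mem_slope_space; apply/eqP/idP => [/(congr1 (coord Z i))|Qi].
  rewrite coord_slope_proj (coord_free _ _ (basis_free bZ)) eqxx.
  by case: (Q _) => // /eqP; rewrite eq_sym oner_eq0.
apply: coordP => j; rewrite coord_slope_proj (coord_free _ _ (basis_free bZ)).
by have [<-|] := eqVneq i j; rewrite ?Qi //; case: ifP.
Qed.

Lemma sub_slope_iter j n (x : subvs_of (slope_space j)) :
  vsval (iter n (sub_semilinear phi (U := slope_space j)) x) = iter n phi (vsval x).
Proof.
elim: n => //= n IH; rewrite vsprojK IH //.
have : iter n phi (vsval x) \in slope_space j by rewrite -IH subvsP.
by rewrite !mem_slope_space slope_proj_phi => /eqP ->.
Qed.

(** With [m = D] and [alpha = p ^ b], the logarithm of [|alpha|] in base [q ^ D] is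
    [- b / (D log_p q)], and [alpha^-1 phi^D] fixes the [Z_i] with [c i = b], which span the
    piece. *)
Lemma slope_pieceP b : pure_of_slope absF q
  (sub_semilinear phi (U := slope_space (pred1 b)))
  (b%:~R / (D * logn p q)%:R).
Proof.
have [pq q1 _] := fs; have pp := sw_prime wF; have p0 := prime_gt0 pp.
have [e qe] := p_natP pq; have e0 : (0 < e)%N by case: e qe q1 => // ->.
exists D, (p%:R ^ b); split=> //.
- by rewrite expfz_neq0 // (sw_p_neq0 wF).
- rewrite (uabsXz uF) absF_p qe pfactorK // -expnM natrX.
  have lnp : 0 < ln (p%:R : R) by rewrite ln_gt0 // ltr1n prime_gt1.
  have lnz (z : int) : ln ((p%:R : R)^-1 ^ z) = - (z%:~R * ln p%:R).
    have p0' : 0 < (p%:R : R) by rewrite ltr0n.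
    by rewrite exprz_inv -powR_intmul ?ltW // ln_powR rmorphN mulNr.
  rewrite lnz lnXn ?ltr0n // -mulr_natr !natrM.
  have : (e%:R : R) != 0 by rewrite pnatr_eq0 -lt0n.
  have : (D%:R : R) != 0 by rewrite pnatr_eq0 -lt0n.
  have := lt0r_neq0 lnp => h1 h2 h3; field.
  by rewrite h2 h3 mul1r h1.
pose U := slope_space (pred1 b).
have := (@etale_fixed_span R F absF (iter D s) (subvs_of U)
  (fun x => (p%:R ^ b)^-1 *: iter D (sub_semilinear phi (U := U)) x)
  [seq vsproj U Z`_(nat_of_ord i) | i <- enum 'I_(dim V) & c i == b]).
apply.
- exact: uF.
- exact: frob_iter_abs.
- have [hD hZ] := semilinear_iter (linear_sigma_linear) D.
  split=> [x y|a x]; apply: val_inj.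
    by rewrite /= !sub_slope_iter /= hD scalerDr.
  by rewrite /= !sub_slope_iter /= hZ !scalerA mulrC.
- apply/eqP; rewrite eqEsubv subvf /=; apply/subvP => w _.
  rewrite -[w](vsvalK w); have := subvsP w; rewrite mem_slope_space => /eqP {1}<-.
  rewrite /slope_proj linear_sum; apply: memv_suml => i ci; rewrite linearZ /=.
  apply/memvZ/memv_span/mapP; exists i => //; rewrite mem_filter mem_enum andbT.
  exact: ci.
move=> x /mapP[i]; rewrite mem_filter => /andP[/eqP ci _] ->.
have ZU : Z`_i \in U by rewrite slope_space_basis /= ci.
apply: val_inj; rewrite /= sub_slope_iter vsprojK // Zc ci scalerA mulVf ?scale1r //.
by rewrite expfz_neq0 // (sw_p_neq0 wF).
Qed.

Let sl := sort <=%O (undup [seq c i | i <- enum 'I_(dim V)]).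
Let Fil j := slope_space (mem (take j sl)).

Lemma mem_slopes i : c i \in sl.
Proof. by rewrite mem_sort mem_undup map_f // mem_enum. Qed.

Lemma slopes_uniq : uniq sl.
Proof. by rewrite sort_uniq undup_uniq. Qed.

Lemma take_slopes j : (j < size sl)%N ->
  take j.+1 sl = rcons (take j sl) (nth 0 sl j) /\ nth 0 sl j \notin take j sl.
Proof.
move=> jl; rewrite (take_nth 0) //; split=> //.
by have := take_uniq j.+1 slopes_uniq; rewrite (take_nth 0) // rcons_uniq => /andP[].
Qed.

(** Each step adds the part of the next larger exponent [b]; the projection [slope_proj (pred1 b)]
    commutes with [phi] and exhibits that part as the graded piece. *)
Lemma eigen_slope_filtration : slope_filtration absF q phi (size sl) Fil
  (fun j => (nth 0 sl j)%:~R / (D * logn p q)%:R).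
Proof.
have [pq q1 _] := fs.
have Df0 : 0 < ((D * logn p q)%:R : R).
  rewrite ltr0n muln_gt0 D0 logn_gt0 mem_primes (sw_prime wF) /=.
  have [[|e] qe] := p_natP pq; first by rewrite qe in q1.
  by rewrite qe expn_gt0 prime_gt0 ?(sw_prime wF) //= expnS dvdn_mulr.
split.
- apply/eqP; rewrite -subv0; apply/subvP => x; rewrite mem_slope_space => /eqP <-.
  by rewrite /slope_proj big1 ?mem0v // => i; rewrite take0.
- apply/eqP; rewrite eqEsubv subvf /=; apply/subvP => x _; rewrite mem_slope_space.
  by apply/eqP/coordP => i; rewrite coord_slope_proj take_size /= mem_slopes.
- move=> j jl; have [tj nj] := take_slopes jl; split.
    apply/subvP => x; rewrite !mem_slope_space => /eqP ex; rewrite -{1}ex slope_projI -{2}ex.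
    apply/eqP/coordP => i; rewrite !coord_slope_proj /= tj mem_rcons inE.
    by case: (c i \in take j sl); rewrite ?orbT ?andbF.
  have : nth 0 sl j \in sl by exact: mem_nth.
  rewrite mem_sort mem_undup => /mapP[i _ ci] eF.
  have : Z`_i \in Fil j.+1 by rewrite slope_space_basis /= tj mem_rcons inE ci eqxx.
  by rewrite -eF slope_space_basis /= -ci (negPf nj).
- by move=> j x _; rewrite !mem_slope_space slope_proj_phi => /eqP ->.
- move=> i j ij jl; rewrite ltr_pM2r ?invr_gt0 // ltr_int.
  have : sorted <%O sl by rewrite sort_lt_sorted undup_uniq.
  move/(sorted_ltn_nth lt_trans); apply=> //; rewrite inE //; exact: ltn_trans jl.
move=> j jl; have [tj nj] := take_slopes jl.
set b := nth 0 sl j in tj nj *.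
exists (subvs_of (slope_space (pred1 b))), (sub_semilinear phi (U := slope_space (pred1 b))).
exists (linfun (vsproj (slope_space (pred1 b))) \o linfun (slope_proj (pred1 b)))%VF.
have gE x : (linfun (vsproj (slope_space (pred1 b))) \o linfun (slope_proj (pred1 b)))%VF x
    = vsproj (slope_space (pred1 b)) (slope_proj (pred1 b) x).
  by rewrite comp_lfunE !lfunE.
have sub1 x : slope_proj (pred1 b) x \in Fil j.+1.
  rewrite mem_slope_space slope_projI; apply/eqP/coordP => i; rewrite !coord_slope_proj /=.
  by have [->|] := eqVneq (c i) b; rewrite ?andbF // tj mem_rcons inE eqxx.
have decomp x : slope_proj (mem (take j.+1 sl)) x =
    slope_proj (mem (take j sl)) x + slope_proj (pred1 b) x.
  apply: coordP => i; rewrite linearD /= !coord_slope_proj /= tj mem_rcons inE.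
  by have [->|] := eqVneq (c i) b; rewrite ?(negPf nj) /= ?add0r ?addr0.
split.
- apply/eqP; rewrite eqEsubv subvf /=; apply/subvP => w _.
  rewrite -[w](vsvalK w); have := subvsP w; rewrite mem_slope_space => /eqP ew.
  by rewrite -{1}ew -gE memv_img // -ew.
- apply/vspaceP => x; rewrite memv_cap memv_ker gE.
  have -> : (vsproj (slope_space (pred1 b)) (slope_proj (pred1 b) x) == 0) =
      (slope_proj (pred1 b) x == 0).
    apply/eqP/eqP => [/(congr1 val)|->]; last by rewrite linear0.
    by rewrite /= vsprojK ?slope_proj_mem.
  rewrite !mem_slope_space decomp.
  apply/andP/eqP => [[/eqP ->]|ex]; first by rewrite addr0 => /eqP.
  have x0 : slope_proj (pred1 b) x = 0.
    rewrite -ex slope_projI; apply: coordP => i; rewrite coord_slope_proj linear0 /=.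
    by have [->|] := eqVneq (c i) b; rewrite ?(negPf nj).
  by rewrite x0 ex addr0 !eqxx.
- move=> x _; rewrite !gE -[RHS]/(vsproj _ (phi (vsval _))) vsprojK ?slope_proj_mem //.
  by rewrite slope_proj_phi.
exact: slope_pieceP.
Qed.

Lemma eigen_frobenius_slope i :
  frobenius_slope absF q phi ((c i)%:~R / (D * logn p q)%:R).
Proof.
exists (size sl), Fil, (fun j => (nth 0 sl j)%:~R / (D * logn p q)%:R).
split; first exact: eigen_slope_filtration.
by exists (index (c i) sl); rewrite ?index_mem ?mem_slopes // nth_index ?mem_slopes.
Qed.

End EigenFiltration.

(** Write the slope as [a / b] in lowest terms and [log_p q = b g]; clearing denominators leaves
    [c = D a g]. *)
Lemma qpow_rational_div (R : realType) (p q D : nat) (c : int) :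
  (0 < D)%N -> (0 < logn p q)%N ->
  qpow_rational p q ((c%:~R : R) / (D * logn p q)%:R) ->
  exists c' : int, c = D%:Z * c'.
Proof.
move=> D0 f0 [r er /dvdnP[g hg]].
have dr0 : (denq r)%:~R != 0 :> R by rewrite intr_eq0 denq_neq0.
have dg : (logn p q)%:Z = denq r * g%:Z.
  by rewrite hg PoszM absz_denq mulrC.
exists (numq r * g%:Z).
have /eqP : (c%:~R : R) = ratr r * (D * logn p q)%:R.
  by rewrite -er divfK // pnatr_eq0 -lt0n muln_gt0 D0 f0.
rewrite -{1}(divq_num_den r) fmorph_div /= !ratr_int natrM.
have -> : (logn p q)%:R = (denq r)%:~R * g%:R :> R.
  by rewrite -[LHS]/((logn p q)%:Z%:~R) dg intrM.
move/eqP => H; apply: (@intr_inj R).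
by rewrite !intrM H; field.
Qed.

Lemma sep_closed_split (k : fieldType) :
  (forall f : {poly k}, separable_poly f -> (1 < size f)%N -> exists c, root f c) ->
  forall f : {poly k}, separable_poly f ->
  exists2 r : seq k, uniq r & f %= \prod_(z <- r) ('X - z%:P).
Proof.
move=> sep f; elim: {f}(size f) {-2}f (leqnn (size f)) => [|n IH] f sf sepf.
  by move: sf; rewrite leqn0 size_poly_eq0 (negPf (separable_poly_neq0 sepf)).
have f0 := separable_poly_neq0 sepf.
have [s1|s1] := leqP (size f) 1.
  by exists [::] => //; rewrite big_nil -size_poly_eq1 eqn_leq s1 lt0n size_poly_eq0.
have [z rz] := sep f sepf s1.
have [g fg] := factor_theorem f z rz.
have /andP[sepg nrz] : separable_poly g && ~~ root g z by rewrite -separable_root -fg.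
have g0 : g != 0 by apply: contraNneq f0 => g0; rewrite fg g0 mul0r.
have [|r ur er] := IH g _ sepg.
  by move: sf; rewrite fg size_Mmonic ?monicXsubC // size_XsubC addn2.
exists (z :: r).
  rewrite /= ur andbT -root_prod_XsubC -(eqp_root er) // .
by rewrite big_cons fg mulrC eqp_mull.
Qed.

(** * From eigenvectors of an iterate to eigenvectors of the map itself *)

Section Descent.
Variables (R : realType) (p : nat) (F : fieldType) (absF : F -> R).
Variables (k : fieldType) (res : F -> k).
Hypothesis wF : strict_witt p absF res.
Let uF := sw_abs wF.
Let rF := sw_res wF.
Variables (q : nat) (s : {rmorphism F -> F}).
Hypothesis fs : frob_power p absF q s.
Hypothesis s_abs : forall a, absF (s a) = absF a.

(** [zeta] generates the unramified extension of degree [D] of the fixed field: it lifts a primitive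
    root of unity of order [q^D - 1] in the residue field, whose conjugates are distinct. *)
Lemma frob_fixed_generator D : (0 < D)%N -> exists zeta : F,
  [/\ absF zeta <= 1, iter D s zeta = zeta &
    forall i j, (i < D)%N -> (j < D)%N -> iter i s zeta = iter j s zeta -> i = j].
Proof.
move=> D0; have [pq q1 _] := fs.
have qD1 : (1 < q ^ D)%N by rewrite -[1%N](exp1n D) ltn_exp2r.
pose N := (q ^ D).-1; have N0 : (0 < N)%N by rewrite /N -subn1 subn_gt0.
have NS : N.+1 = (q ^ D)%N by rewrite prednK // ltnW.
(* [N = q^D - 1] is invertible in [k], so [X^N - 1] is separable and has [N] distinct roots
   there. *)
have Nk : (N%:R : k) = -1.
  apply/eqP; rewrite -subr_eq0 opprK natr1 NS natrX (sw_natq wF pq q1) expr0n.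
  by rewrite -leqn0 leqNgt D0.
have [r ur er] : exists2 r : seq k, uniq r & ('X^N - 1) %= \prod_(z <- r) ('X - z%:P).
  apply: (sep_closed_split (sw_sep wF)); rewrite separable_poly.unlock derivB derivXn -polyC1 derivC subr0.
  rewrite -scaler_nat Nk scaleN1r coprimep_sym.
  have -> : - 'X^(N.-1) = (- 1) *: 'X^(N.-1) :> {poly k} by rewrite scaleN1r.
  rewrite coprimepZl ?oppr_eq0 ?oner_eq0 //; apply: coprimep_expl.
  rewrite coprimep_sym -[X in coprimep _ X]subr0 -polyC0 coprimep_XsubC /root !hornerE.
  by rewrite expr0n gtn_eqF // sub0r oppr_eq0 oner_eq0.
have sr : size r = N.
  by have := eqp_size er; rewrite size_prod_XsubC -polyC1 size_XnsubC // => -[].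
have : has N.-primitive_root r.
  apply: has_prim_root; rewrite ?sr //.
  by apply/allP => z zr; rewrite /root_of_unity (eqp_root er) root_prod_XsubC.
move=> /hasP[z _ prz].
have zD : z ^+ (q ^ D) = z by rewrite -NS exprS prim_expr_order // mulr1.
have zinj i j : (i < D)%N -> (j < D)%N -> z ^+ (q ^ i) = z ^+ (q ^ j) -> i = j.
  move=> iD jD /eqP; rewrite (eq_prim_root_expr prz).
  (* The exponents [q ^ l] with [l < D] are almost reduced modulo [N] already; only the value [N]
     itself, congruent to 0, has to be treated apart. *)
  have small l : (l < D)%N -> (q ^ l <= N)%N.
    by move=> lD; rewrite -ltnS NS ltn_exp2l.
  have [N1|N1] := leqP N 1.
    have D1 : D = 1%N.
      apply/eqP; rewrite eqn_leq D0 andbT leqNgt; apply/negP => D2.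
      by have := leq_trans (small 1%N D2) N1; rewrite expn1 leqNgt q1.
    by move: iD jD; rewrite D1 !ltnS !leqn0 => /eqP -> /eqP ->.
  move=> H; wlog ij : i j iD jD H / (i <= j)%N.
    move=> W; have [ij|ji] := leqP i j; first exact: W.
    by apply/esym; apply: W; rewrite // 1?eq_sym // ltnW.
  have := small _ jD; rewrite leq_eqVlt => /orP[/eqP jN|jN].
    move: H; rewrite jN modnn => H.
    have : (q ^ i <= q ^ j)%N by rewrite leq_exp2l.
    rewrite jN leq_eqVlt => /orP[/eqP iN|iN].
      by apply/eqP; rewrite -(eqn_exp2l _ _ q1) iN jN.
    move: H; rewrite modn_small // expn_eq0. by case: (q) q1 => //.
  have iN : (q ^ i < N)%N by apply: leq_ltn_trans jN; rewrite leq_exp2l.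
  by move: H; rewrite !modn_small // eqn_exp2l // => /eqP.
have [t0 ht0 rt0] := res_surj rF z.
pose g i : F := if i == 0%N then -1 else 1.
have fsD := frob_power_iter wF fs s_abs D0; have s_absD := frob_iter_abs s_abs D.
(* [t1] has the same defect of invariance as [t0]; since the residue [z] is fixed by the power
   [q ^ D], that defect and hence [t1] have norm below 1, so [t0 - t1] is invariant and still
   reduces to [z]. *)
have [||t1 ht1] := @skew_poly_surj_int _ _ _ _ _ _ wF _ (iter D s) fsD s_absD 2 g (iter D s t0 - t0).
- by move=> [|i] _; rewrite /g ?(uabsN uF) (uabs1 uF).
- by exists 0%N => //; rewrite /g (uabsN uF) (uabs1 uF).
rewrite big_ord_recl big_ord1 /g /= mulN1r mul1r => e1.
have lt1 : absF t1 < 1.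
  apply: le_lt_trans ht1 _; apply/(res_eq uF rF) => //.
    by rewrite (frob_iter_abs s_abs).
  by rewrite (frob_iter_res wF fs s_abs) // rt0 zD.
have hz : absF (t0 - t1) <= 1 by apply: (uabsB_le uF) => //; exact: ltW.
have rz : res (t0 - t1) = z.
  have le1 := ltW lt1; rewrite (resB uF rF) // rt0 (_ : res t1 = 0) ?subr0 //.
  by apply/(res_eq0 rF) => //; exact: ltW.
exists (t0 - t1); split=> //.
  rewrite raddfB /=; apply/eqP; rewrite -subr_eq0; apply/eqP.
  by rewrite -(subrr (iter D s t0 - t0)) -{2}e1; ring.
move=> i j iD jD /(congr1 res); rewrite !(frob_iter_res wF fs s_abs) // rz.
exact: zinj.
Qed.

Variables (V : vectType F) (f : V -> V).
Hypothesis sf : sigma_linear s f.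

(* Hilbert 90: v is recovered from the f-fixed averages of zeta^j v by
   Lagrange interpolation at the conjugates of zeta. *)
Lemma periodic_span_fixed D v : (0 < D)%N -> iter D f v = v ->
  exists X : seq V, v \in <<X>>%VS /\ forall x, x \in X -> f x = x.
Proof.
move=> D0 fv; have [z [_ zD zinj]] := frob_fixed_generator D0.
pose w j := \sum_(l < D) iter l s z ^+ j *: iter l f v.
have fw j : f (w j) = w j.
  rewrite /w (semilinear_sum sf).
  case: (D) D0 fv zD => // D' _ fv zD.
  rewrite big_ord_recr /= [RHS]big_ord_recl addrC; congr (_ + _).
    by rewrite rmorphXn /= -[s (iter D' s z)]/(iter D'.+1 s z) zD -[f (iter D' f v)]/(iter D'.+1 f v) fv.
  by apply: eq_bigr => l _; rewrite rmorphXn.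
exists [seq w j | j <- iota 0 D]; split; last by move=> x /mapP[j _ ->].
(* [L] vanishes at all conjugates of [z] other than [z], so combining the averages [w j] with its
   coefficients leaves [L.[z] *: v]. *)
pose L : {poly F} := \prod_(1 <= l < D) ('X - (iter l s z)%:P).
have L0 : L.[z] != 0.
  rewrite /L horner_prod prodf_seq_neq0; apply/allP => l.
  rewrite mem_index_iota => /andP[l0 lD]; apply/implyP => _; rewrite hornerXsubC subr_eq0.
  by apply/eqP => zl; have := zinj 0%N l D0 lD zl; move=> e; rewrite -e in l0.
have Ll l : (0 < l < D)%N -> L.[iter l s z] = 0.
  move=> /andP[l0 lD]; apply/eqP; rewrite /L horner_prod prodf_seq_eq0; apply/hasP.
  by exists l; rewrite ?mem_index_iota ?l0 //= hornerXsubC subrr.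
have sL : (size L <= D)%N.
  by rewrite /L (size_prod_XsubC (index_iota 1 D) (fun l => iter l s z)) size_iota subn1 prednK.
have -> : v = L.[z]^-1 *: \sum_(j < D) L`_j *: w j.
  apply: (scalerI L0); rewrite scalerA divff // scale1r.
  rewrite /w; under eq_bigr do rewrite scaler_sumr.
  rewrite exchange_big /=.
  have E (l : 'I_D) : \sum_(j < D) L`_j *: (iter l s z ^+ j *: iter l f v) = L.[iter l s z] *: iter l f v.
    rewrite (horner_coef_wide _ sL) scaler_suml; apply: eq_bigr => j _.
    by rewrite scalerA.
  rewrite (eq_bigr _ (fun l _ => E l)) (bigD1 (Ordinal D0)) //= big1 ?addr0 // => l l0.
  by rewrite Ll ?scale0r // ltn_ord andbT lt0n; apply: contraNneq l0 => l0; apply/eqP/val_inj.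
apply: memvZ; apply: memv_suml => j _; apply/memvZ/memv_span/map_f.
by rewrite mem_iota /= add0n ltn_ord.
Qed.

End Descent.

Section Eigenbasis.
Variables (R : realType) (p : nat) (F : fieldType) (absF : F -> R).
Variables (k : fieldType) (res : F -> k).
Hypothesis wF : strict_witt p absF res.
Hypothesis absF_p : absF p%:R = p%:R^-1.

(** The hypothesis on slopes gives [c i = D c'], so [p^(-c') phi] has [Z_i] as a periodic vector of
    period [D]; its fixed vectors, which span [Z_i], are eigenvectors of [phi]. *)
Lemma rational_slopes_eigenbasis (q : nat) (s : {rmorphism F -> F})
    (V : vectType F) (phi : {linear V -> V | s \; *:%R}) :
  frob_power p absF q s -> (forall a, absF (s a) = absF a) ->
  (forall x, phi x = 0 -> x = 0) ->
  (forall t : R, frobenius_slope absF q phi t -> qpow_rational p q t) ->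
  exists (X : (dim V).-tuple V) (c : 'I_(dim V) -> int),
    basis_of fullv X /\ forall i : 'I_(dim V), phi X`_i = p%:R ^ c i *: X`_i.
Proof.
move=> fs s_abs phi_inj Hs.
have sphi := linear_sigma_linear phi.
have [D [Y [D0 spY HY]]] := dieudonne_manin wF erefl fs s_abs sphi phi_inj.
have [Z [bZ sZY]] := spanning_basis spY.
have HZ (i : 'I_(dim V)) : exists c : int, iter D phi Z`_i = p%:R ^ c *: Z`_i.
  by apply/HY/sZY/mem_nth; rewrite size_tuple.
pose c i := projT1 (cid (HZ i)).
have Zc (i : 'I_(dim V)) : iter D phi Z`_i = p%:R ^ c i *: Z`_i := projT2 (cid (HZ i)).
have pn0 := sw_p_neq0 wF.
have [pq q1 _] := fs.
have f0 : (0 < logn p q)%N.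
  have [[|e] qe] := p_natP pq; first by rewrite qe in q1.
  by rewrite qe pfactorK ?(sw_prime wF).
have Hspan (i : 'I_(dim V)) : exists X : seq V, Z`_i \in <<X>>%VS /\
    forall x, x \in X -> exists c' : int, phi x = p%:R ^ c' *: x.
  have := Hs _ (eigen_frobenius_slope wF absF_p fs s_abs D0 bZ Zc i).
  move=> /(qpow_rational_div D0 f0)[c' cc'].
  pose psi x := p%:R ^ (- c') *: phi x.
  have spsi : sigma_linear s psi.
    split=> [x y|a x]; rewrite /psi ?linearD ?scalerDr //.
    by rewrite (linearZ_LR phi) /= !scalerA mulrC.
  have psiD n x : iter n psi x = p%:R ^ (- (c' * n%:Z)) *: iter n phi x.
    elim: n => [|n IH]; first by rewrite mulr0 oppr0 expr0z scale1r.
    rewrite iterS IH (proj2 spsi) (rmorph_pz p) /psi scalerA -expfzDr //.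
    by congr (_ ^ _ *: _); rewrite intS mulrDr mulr1 opprD addrC.
  have [|X [ZX HX]] := @periodic_span_fixed _ _ _ _ _ _ wF q s fs s_abs V psi spsi D Z`_i D0.
    by rewrite psiD Zc scalerA -expfzDr // cc' mulrC addNr expr0z scale1r.
  exists X; split=> // x /HX hx; exists c'.
  by rewrite -{2}hx /psi scalerA -expfzDr // subrr expr0z scale1r.
pose X := flatten [seq projT1 (cid (Hspan i)) | i <- enum 'I_(dim V)].
have spX : <<X>>%VS = fullv.
  apply/eqP; rewrite eqEsubv subvf /= -(span_basis bZ); apply/span_subvP => z zZ.
  have [i ei] : exists i : 'I_(dim V), z = Z`_i.
    have hi : (index z Z < dim V)%N by rewrite -{2}(size_tuple Z) index_mem.
    by exists (Ordinal hi); rewrite /= nth_index.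
  have [h1 _] := projT2 (cid (Hspan i)).
  rewrite ei; apply: subvP h1; apply: sub_span => y yX.
  by apply/flattenP; exists (projT1 (cid (Hspan i))) => //; rewrite map_f // mem_enum.
have [W [bW sWX]] := spanning_basis spX.
have HW (i : 'I_(dim V)) : exists c : int, phi W`_i = p%:R ^ c *: W`_i.
  have /sWX/flattenP[_ /mapP[j _ ->]] : W`_i \in W by rewrite mem_nth // size_tuple.
  by have [_ h2] := projT2 (cid (Hspan j)); apply: h2.
exists W, (fun i => projT1 (cid (HW i))); split=> // i.
exact: projT2 (cid (HW i)).
Qed.

End Eigenbasis.

(** * Generic vectors *)

(** [partial_sum d (n - j)] is, up to a positive factor, the height at abscissa [j] of the polygon
    whose slopes, read from the right, are the opposites of [d 0, d 1, ...]. *)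
Definition partial_sum (d : nat -> int) (n : nat) : int := \sum_(i < n) d i.

Section GenericVector.
Variables (R : realType) (p : nat) (F : fieldType) (absF : F -> R).
Variables (k : fieldType) (res : F -> k).
Hypothesis wF : strict_witt p absF res.
Let uF := sw_abs wF.
Let rF := sw_res wF.
Variables (q : nat) (s : {rmorphism F -> F}).
Hypothesis fs : frob_power p absF q s.
Hypothesis s_abs : forall a, absF (s a) = absF a.

(** At most one exponent is bad: two bad ones would make [b u^r (u^i - 1)] smaller than [|a| = |b|],
    although [u^i - 1] is a unit. The statement for all large [r] allows finitely many coefficients
    to be treated together. *)
Lemma eventually_no_cancel (a b u : F) : a != 0 -> absF b <= absF a ->
  absF u = 1 -> (forall i, (0 < i)%N -> res u ^+ i != 1) ->
  exists r0, forall r, (r0 <= r)%N -> absF (a - b * u ^+ r) = absF a.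
Proof.
move=> a0 ba u1 ru.
have u1X i : absF (u ^+ i) = 1 by rewrite (uabsX uF) u1 expr1n.
have le r : absF (a - b * u ^+ r) <= absF a.
  by apply: (uabsB_le uF) => //; rewrite (uabsM uF) u1X mulr1.
have [[r1 lt1]|H] := pselect (exists r1, absF (a - b * u ^+ r1) < absF a); last first.
  by exists 0%N => r _; apply/le_anti; rewrite le /= leNgt; apply/negP => h; apply: H; exists r.
have eab : absF b = absF a.
  apply/le_anti; rewrite ba /= leNgt; apply/negP => h.
  by move: lt1; rewrite (uabsB_eq uF) ?ltxx // (uabsM uF) u1X mulr1.
exists r1.+1 => r hr; apply/le_anti; rewrite le /= leNgt; apply/negP => lt2.
have := uabsB_lt uF lt1 lt2.
have [i er] : exists i, r = (r1 + i.+1)%N by exists (r - r1.+1)%N; lia.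
have -> : (a - b * u ^+ r1) - (a - b * u ^+ r) = b * u ^+ r1 * (u ^+ i.+1 - 1).
  by rewrite er exprD; ring.
rewrite !(uabsM uF) u1X mulr1 eab gtr_pMr ?(uabs_gt0 uF) // => h.
have /negP := ru i.+1 isT; apply; apply/eqP.
rewrite -(resX uF rF) ?u1 // -(res1 rF); apply/(res_eq uF rF); rewrite ?u1X ?(uabs1 uF) //.
Qed.

Variable X : F.
Hypothesis X1 : absF X = 1.
Hypothesis resX : forall i, (0 < i)%N -> res (s X / X) ^+ i != 1.

Variables (V : vectType F) (phi : V -> V).
Hypothesis sphi : sigma_linear s phi.
Variables (n : nat) (v : nat -> V) (d : nat -> int).
Hypothesis phi_v : forall i, (i < n)%N -> phi (v i) = p%:R ^ d i *: v i.
Hypothesis d_mono : forall i j, (i <= j)%N -> (j < n)%N -> d i <= d j.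

Let P := absF p%:R.

(* The twisted polynomial of e + t v_m is (sigma - mu) times that of e; the
   choice of t makes mu avoid cancellation in every coefficient. *)
Lemma generic_partial m : (m <= n)%N -> exists e (a : nat -> F),
  [/\ a m = 1, \sum_(j < m.+1) a j *: iter j phi e = 0,
      (forall j, (j <= m)%N -> absF (a j) = P ^ partial_sum d (m - j)) &
      forall i, (i < m)%N -> v i \in <<[seq iter j phi e | j <- iota 0 m]>>%VS].
Proof.
have [P0 P1] := andP (sw_p wF); have pn0 := sw_p_neq0 wF.
have psS l : partial_sum d l.+1 = partial_sum d l + d l by rewrite /partial_sum big_ord_recr.
elim: m => [|m IH] mn.
  (* The start is the zero vector, annihilated by the constant polynomial 1. *)
  exists 0, (fun=> 1); split=> // [|j].
    by rewrite big_ord1 scale1r.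
  by rewrite leqn0 => /eqP ->; rewrite subnn /partial_sum big_ord0 expr0z (uabs1 uF).
have [e [a [am Sa aa sp]]] := IH (ltnW mn).
have a_neq0 j : (j <= m)%N -> a j != 0.
  by move=> jm; rewrite -(uabs_gt0 uF) aa // exprz_gt0.
have X0 : X != 0 by rewrite -(uabs_gt0 uF) X1.
pose u := s X / X; have u1 : absF u = 1 by rewrite (uabs_div uF) s_abs X1 divr1.
have [r Hr] : exists r, forall j, (j < m)%N ->
    absF (s (a j) - p%:R ^ d m * u ^+ r * a j.+1) = absF (a j).
  suff [r0 H] : exists r0, forall r, (r0 <= r)%N -> forall j, (j < m)%N ->
      absF (s (a j) - p%:R ^ d m * u ^+ r * a j.+1) = absF (a j).
    by exists r0; exact: H.
  elim: {1 3}m (leqnn m) => [|l IHl] lm; first by exists 0%N.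
  have [r0 H] := IHl (ltnW lm).
  have [||r1 H1] := @eventually_no_cancel (s (a l)) (p%:R ^ d m * a l.+1) u _ _ u1 resX.
  - by rewrite -(uabs_gt0 uF) s_abs (uabs_gt0 uF) a_neq0 // ltnW.
  (* This bound amounts to [d (m - l.+1) <= d m]: the increasing order of the exponents enters
     here. *)
  - rewrite s_abs (uabsM uF) (uabsXz uF) !aa //; last exact: ltnW.
    rewrite -expfzDr ?gt_eqF // (ler_iXz2l P0 P1).
    have -> : (m - l = (m - l.+1).+1)%N by lia.
    by rewrite psS addrC lerD2r d_mono //; lia.
  exists (maxn r0 r1) => r; rewrite geq_max => /andP[hr0 hr1] j.
  rewrite ltnS leq_eqVlt => /orP[/eqP ->|jl]; last exact: H.
  by rewrite -[RHS]s_abs -(H1 _ hr1) mulrAC.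
(* [sigma - mu] kills [y *: v m] exactly for [mu = p^(d m) s(y) / y], so replacing [y] by other
   powers of [X] varies [mu] by powers of [u]. *)
pose y := X ^+ r; have y0 : y != 0 by rewrite expf_neq0.
pose mu := p%:R ^ d m * u ^+ r.
have amu : absF mu = P ^ d m by rewrite (uabsM uF) (uabsXz uF) (uabsX uF) u1 expr1n mulr1.
have sy : s y * p%:R ^ d m = mu * y.
  rewrite /mu /y /u rmorphXn /= expr_div_n; field. by rewrite expf_neq0.
(* [t] is chosen so that the twisted polynomial of [e] sends [t *: v m] to [y *: v m]. *)
have [|t Ht] := @skew_poly_surj _ _ _ _ _ _ wF q s fs s_abs m.+1
  (fun j => a j * p%:R ^ (d m * j%:Z)) y.
  by exists m => //; rewrite am mul1r expfz_neq0.
have it j : iter j phi (t *: v m) = (p%:R ^ (d m * j%:Z) * iter j s t) *: v m.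
  elim: j => [|j IHj]; first by rewrite mulr0 expr0z mul1r.
  rewrite iterS IHj (proj2 sphi) phi_v // scalerA; congr (_ *: _).
  rewrite rmorphM /= (rmorph_pz p) mulrAC -expfzDr //.
  by rewrite intS mulrDr mulr1 addrC.
have iD j x z : iter j phi (x + z) = iter j phi x + iter j phi z.
  exact: (proj1 (semilinear_iter sphi j)).
pose e' := e + t *: v m.
have S : \sum_(j < m.+1) a j *: iter j phi e' = y *: v m.
  rewrite /e'; under eq_bigr do rewrite iD scalerDr.
  rewrite big_split /= Sa add0r -Ht scaler_suml; apply: eq_bigr => j _.
  by rewrite it scalerA mulrA.
(* The coefficients of the product of [sigma - mu] with the polynomial of [e]; the test [j <= m]
   discards the values of [a] beyond the degree, which are arbitrary. *)
exists e', (fun j => (if j is j'.+1 then s (a j') else 0) - (if (j <= m)%N then mu * a j else 0)).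
split.
- by rewrite ltnn subr0 am rmorph1.
- under eq_bigr do rewrite scalerBl.
  rewrite big_split /= sumrN big_ord_recl /= scale0r add0r.
  rewrite [X in _ - X]big_ord_recr /= ltnn scale0r addr0.
  have -> : \sum_(i < m.+1) s (a i) *: phi (iter i phi e') = phi (y *: v m).
    by rewrite -S (semilinear_sum sphi).
  have -> : \sum_(i < m.+1) (if (i <= m)%N then mu * a i else 0) *: iter i phi e' = mu *: (y *: v m).
    by rewrite -S scaler_sumr; apply: eq_bigr => j _; rewrite -ltnS ltn_ord scalerA.
  by rewrite (proj2 sphi) phi_v // !scalerA sy subrr.
- move=> [|j] hj.
    rewrite sub0r (uabsN uF) (uabsM uF) amu aa // !subn0 psS addrC expfzDr ?gt_eqF //.
  move: hj; rewrite ltnS leq_eqVlt => /orP[/eqP ->|jm].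
    by rewrite ltnn subr0 am rmorph1 (uabs1 uF) subnn /partial_sum big_ord0 expr0z.
  by rewrite jm Hr // aa ?subSS // ltnW.
(* By [S], the vector [v m] is a combination of iterates of [e']; subtracting its multiples recovers
   the iterates of [e], hence the earlier [v i]. *)
pose W := <<[seq iter j phi e' | j <- iota 0 m.+1]>>%VS.
have iW j : (j <= m)%N -> iter j phi e' \in W.
  by move=> jm; apply/memv_span/mapP; exists j => //; rewrite mem_iota.
have vW : v m \in W.
  rewrite -[v m]scale1r -(mulVf y0) -scalerA -S memvZ // memv_suml // => j _.
  by rewrite memvZ // iW // -ltnS.
move=> i; rewrite ltnS leq_eqVlt => /orP[/eqP -> //|im].
apply: subvP (sp i im); apply/span_subvP => _ /mapP[j jm ->].
rewrite mem_iota /= add0n in jm.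
have -> : iter j phi e = iter j phi e' - iter j phi (t *: v m) by rewrite iD addrK.
by rewrite memvB ?iW ?it ?memvZ // ltnW.
Qed.

End GenericVector.

Section GenericBasis.
Variables (R : realType) (p : nat) (F : fieldType) (absF : F -> R).
Variables (k : fieldType) (res : F -> k).
Hypothesis wF : strict_witt p absF res.
Variables (q : nat) (s : {rmorphism F -> F}).
Hypothesis fs : frob_power p absF q s.
Hypothesis s_abs : forall a, absF (s a) = absF a.
Variable X : F.
Hypothesis X1 : absF X = 1.
Hypothesis resX : forall i, (0 < i)%N -> res (s X / X) ^+ i != 1.

Lemma generic_vector (V : vectType F) (phi : V -> V) (Z : (dim V).-tuple V)
    (c : 'I_(dim V) -> int) :
  sigma_linear s phi -> basis_of fullv Z ->
  (forall i : 'I_(dim V), phi Z`_i = p%:R ^ c i *: Z`_i) ->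
  exists (e : V) (a : nat -> F) (d : nat -> int),
  [/\ basis_of fullv [seq iter j phi e | j <- iota 0 (dim V)],
      a (dim V) = 1, \sum_(j < (dim V).+1) a j *: iter j phi e = 0,
      (forall j, (j <= dim V)%N ->
         absF (a j) = absF p%:R ^ partial_sum d (dim V - j)) &
      forall i j, (i <= j)%N -> (j < dim V)%N -> d i <= d j].
Proof.
move=> sphi bZ phiZ.
pose r := sort (fun i j => c i <= c j) (enum 'I_(dim V)).
have sr : size r = dim V by rewrite size_sort size_enum_ord.
pose v i := nth 0 [seq Z`_(nat_of_ord j) | j <- r] i.
pose d i := nth 0 [seq c j | j <- r] i.
have rE i : (i < dim V)%N -> exists j, [/\ j \in r, v i = Z`_(nat_of_ord j) & d i = c j].
  move=> hi; have j0 : 'I_(dim V) := Ordinal hi.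
  exists (nth j0 r i); split; first by rewrite mem_nth ?sr.
    by rewrite /v (nth_map j0) ?sr.
  by rewrite /d (nth_map j0) ?sr.
have phi_v i : (i < dim V)%N -> phi (v i) = p%:R ^ d i *: v i.
  by move=> /rE[j [_ -> ->]].
have d_mono i j : (i <= j)%N -> (j < dim V)%N -> d i <= d j.
  move=> ij jn; have : sorted <=%R [seq c j | j <- r].
    by rewrite sorted_map; apply: sort_sorted => x y; exact: le_total.
  move/(sorted_leq_nth le_trans lexx); apply=> //; rewrite inE size_map sr //.
  exact: leq_ltn_trans jn.
have [e [a [a1 Sa aa sp]]] := generic_partial wF fs s_abs X1 resX sphi phi_v d_mono (leqnn _).
exists e, a, d; split=> //.
have spf : <<[seq iter j phi e | j <- iota 0 (dim V)]>>%VS = fullv.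
  apply/eqP; rewrite eqEsubv subvf /= -(span_basis bZ); apply/span_subvP => z zZ.
  have hi : (index z Z < dim V)%N by rewrite -{2}(size_tuple Z) index_mem.
  have : Ordinal hi \in r by rewrite mem_sort mem_enum.
  move=> /(nthP (Ordinal hi))[i ir ei].
  have -> : z = v i by rewrite /v (nth_map (Ordinal hi)) // ei /= nth_index.
  by apply: sp; rewrite -sr.
by rewrite basisEdim spf subvv /= size_map size_iota dimvf.
Qed.

End GenericBasis.

(** * Supporting lines of the Newton polygon *)

Section NewtonPolygon.
Variable R : realType.

Lemma half_plane_convex (a b : R) :
  @convex_set R (R^o * R^o)%type [set P | a * P.1 + b <= P.2].
Proof.
move=> x y l; rewrite !inE /= => hx hy.
have l0 : 0 <= l%:num :> R by [].
rewrite /conv /= /unstable.onem.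
have E (u w : R) : (u *: (w : R^o)) = u * w by [].
rewrite !E; have := ler_wpM2l l0 hx; have l2 : 0 <= 1 - l%:num by rewrite subr_ge0.
have := ler_wpM2l l2 hy; lra.
Qed.

Lemma partial_sum_le (d : nat -> int) i j D :
  (i <= j)%N -> (forall l, (i <= l < j)%N -> d l <= D) ->
  partial_sum d j - partial_sum d i <= (j - i)%:Z * D.
Proof.
elim: j => [|j IH] ij H.
  by move: ij; rewrite leqn0 => /eqP ->; rewrite subrr subnn mul0r.
move: ij; rewrite leq_eqVlt => /orP[/eqP ->|ij]; first by rewrite subrr subnn mul0r.
rewrite ltnS in ij.
have -> : partial_sum d j.+1 = partial_sum d j + d j by rewrite /partial_sum big_ord_recr.
have h1 := IH ij (fun l hl => H l ltac:(lia)).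
have h2 := H j ltac:(lia).
by rewrite subSn // intS mulrDl mul1r; lia.
Qed.

Lemma partial_sum_ge (d : nat -> int) i j D :
  (i <= j)%N -> (forall l, (i <= l < j)%N -> D <= d l) ->
  (j - i)%:Z * D <= partial_sum d j - partial_sum d i.
Proof.
elim: j => [|j IH] ij H.
  by move: ij; rewrite leqn0 => /eqP ->; rewrite subrr subnn mul0r.
move: ij; rewrite leq_eqVlt => /orP[/eqP ->|ij]; first by rewrite subrr subnn mul0r.
rewrite ltnS in ij.
have -> : partial_sum d j.+1 = partial_sum d j + d j by rewrite /partial_sum big_ord_recr.
have h1 := IH ij (fun l hl => H l ltac:(lia)).
have h2 := H j ltac:(lia).
by rewrite subSn // intS mulrDl mul1r; lia.
Qed.

(** Through each point passes a line below all the others, because the slopes are monotone; the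
    half-plane above it is convex and so contains the hull. *)
Lemma newton_polygon_convex (q : nat) (A : comNzRingType) (absA : A -> R)
    (n : nat) (a : nat -> A) (P : R) (d : nat -> int) :
  (1 < q)%N -> 0 < P < 1 ->
  (forall j, (j <= n)%N -> absA (a j) = P ^ partial_sum d (n - j)) ->
  (forall j, (j <= n)%N -> a j != 0) ->
  (forall i j, (i <= j)%N -> (j < n)%N -> d i <= d j) ->
  forall i, (i <= n)%N -> newton_polygon q absA n a (np_point q absA i (a i)).
Proof.
move=> q1 /andP[P0 P1] aa a0 dm i hin.
pose kap := - (ln P / ln q%:R).
have kap0 : 0 <= kap.
  rewrite oppr_ge0 mulr_le0_ge0 ?ln_le0 ?(ltW P1) // invr_ge0 ln_ge0 //.
  by rewrite ler1n ltnW.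
have npE j : (j <= n)%N -> np_point q absA j (a j) = (j%:R, kap * (partial_sum d (n - j))%:~R).
  move=> jn; rewrite /np_point aa // -powR_intmul ?ltW // ln_powR /kap; congr pair.
  by ring.
have Sub : np_points q absA n a `<=` convex_hull (np_points q absA n a).
  exact: sub_gen_smallest.
split.
  by apply: Sub; exists i => //; split=> //; exact: a0.
move=> y; rewrite npE //= => Hy.
(* [d (n - i)] governs the edge to the left of abscissa [i]; for [i = 0], which has no such edge,
   [minn] selects the edge to its right. *)
pose D := d (minn (n - i) n.-1).
pose sl : R := - (kap * D%:~R).
pose b : R := kap * (partial_sum d (n - i))%:~R - sl * i%:R.
suff : [set P : R * R | sl * P.1 + b <= P.2] (i%:R, y).
  by rewrite /= /b addrCA subrr addr0.
move: Hy; apply: smallest_sub; first exact: half_plane_convex.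
move=> _ [j [jn _] <-]; rewrite npE //= /b /sl.
have key : partial_sum d (n - i) - (j%:Z - i%:Z) * D <= partial_sum d (n - j).
  have [ij|ji] := leqP i j.
    have := @partial_sum_le d (n - j) (n - i) D.
    have -> : (n - i - (n - j) = j - i)%N by lia.
    rewrite -subzn // => H; rewrite lerBlDl -lerBlDr; apply: H; first lia.
    by move=> l hl; rewrite /D; apply: dm; lia.
  have := @partial_sum_ge d (n - i) (n - j) D.
  have -> : (n - j - (n - i) = i - j)%N by lia.
  have -> : ((i - j)%N : int) = i%:Z - j%:Z by rewrite -subzn // ltnW.
  move=> H; have h : (i%:Z - j%:Z) * D <= partial_sum d (n - j) - partial_sum d (n - i).
    by apply: H; [lia|move=> l hl; rewrite /D; apply: dm; lia].
  have -> : (j%:Z - i%:Z) * D = - ((i%:Z - j%:Z) * D) by ring.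
  by rewrite opprK addrC -lerBrDr.
have {}key : (partial_sum d (n - i))%:~R - (j%:R - i%:R) * D%:~R <=
    (partial_sum d (n - j))%:~R :> R.
  by move: key; rewrite -(ler_int R) intrB intrM intrB.
have := ler_wpM2l kap0 key; nra.
Qed.

End NewtonPolygon.

Lemma sigma_module_inj (F : fieldType) (s : {rmorphism F -> F}) (V : vectType F)
    (phi : {linear V -> V | s \; *:%R}) :
  sigma_module phi -> forall x, phi x = 0 -> x = 0.
Proof.
move=> [b [bb bphi]] x phix; have [c [xc _]] := bb x.
have [c' [_ uc']] := bphi 0.
have e1 : c' = \row_i s (c 0 i).
  apply: uc'; rewrite -[LHS]phix xc (semilinear_sum (linear_sigma_linear phi)).
  by apply: eq_bigr => i _; rewrite mxE.
have e2 : c' = 0 by apply: uc'; rewrite big1 // => i _; rewrite mxE scale0r.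
rewrite xc big1 // => i _; have : s (c 0 i) = 0.
  by have := congr1 (fun m : 'rV_(dim V) => m 0 i) e1; rewrite /= e2 !mxE.
by move/eqP; rewrite fmorph_eq0 => /eqP ->; rewrite scale0r.
Qed.

(** * Perturbation and descent to a dense subfield *)

Section CyclicBasis.
Variables (F : fieldType) (V : vectType F) (phi : V -> V) (e : V) (n : nat).

Definition cyclic_seq : seq V := [seq iter j phi e | j <- iota 0 n].

Definition cyclic_tuple : n.-tuple V :=
  [tuple of map (fun j => iter j phi e) (iota_tuple n 0)].

Lemma cyclic_tupleE (i : 'I_n) : cyclic_tuple`_i = iter i phi e.
Proof.
by rewrite /= (nth_map 0%N) ?size_iota // nth_iota.
Qed.

Lemma cyclic_freeP : reflect
  (forall c : 'I_n -> F, \sum_(i < n) c i *: iter i phi e = 0 -> forall i, c i = 0)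
  (free cyclic_seq).
Proof.
apply: (iffP (@freeP _ _ _ cyclic_tuple)) => H c S; apply: H;
  by rewrite -[RHS]S; apply: eq_bigr => i _; rewrite cyclic_tupleE.
Qed.

End CyclicBasis.

Section Perturbation.
Variables (R : realType) (F : fieldType) (absF : F -> R).
Hypothesis uF : ultrametric_abs absF.
Variables (s : {rmorphism F -> F}).
Hypothesis s_abs : forall a, absF (s a) = absF a.
Variables (V : vectType F) (phi : V -> V).
Hypothesis sphi : sigma_linear s phi.

Lemma uabs_max_index n (x : 'I_n.+1 -> F) :
  exists j, forall i, absF (x i) <= absF (x j).
Proof.
exists [arg max_(i > (ord0 : 'I_n.+1)) absF (x i)]%O => i.
by case: arg_maxP => // j _; exact.
Qed.

(** In coordinates with respect to the iterates of [e], the new relation differs from the old one by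
    at most [eta] times the larger of 1 and its own coefficients. This bounds those coefficients
    first, and then their distance to the [a j] below [|a j|]. *)
Lemma generic_perturbation m (z : 'I_m -> V) (e : V) (a : nat -> F) n :
  basis_of fullv (cyclic_seq phi e n) -> a n = 1 ->
  \sum_(j < n.+1) a j *: iter j phi e = 0 -> (forall j, (j <= n)%N -> a j != 0) ->
  exists2 eps : R, 0 < eps & forall c : 'I_m -> F, (forall l, absF (c l) < eps) ->
    free (cyclic_seq phi (e + \sum_l c l *: z l) n) /\
    forall a' : nat -> F, a' n = 1 ->
      \sum_(j < n.+1) a' j *: iter j phi (e + \sum_l c l *: z l) = 0 ->
      forall j, (j <= n)%N -> absF (a' j) = absF (a j).
Proof.
move=> be an Sa a0.
pose Y := cyclic_tuple phi e n.
have fY : free Y by exact: basis_free be.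
have YE (i : 'I_n) : Y`_i = iter i phi e by exact: cyclic_tupleE.
have Yspan x : x = \sum_i coord Y i x *: Y`_i by apply: (coord_basis be); exact: memvf.
(* [K] dominates the coordinates of all iterates of the [z l], whence the radius [eta / K] for the
   coefficients; [A] dominates the [|a j|] and their inverses. *)
pose K : R := 1 + \sum_(i < n.+1) \sum_(j < n) \sum_l absF (coord Y j (iter i phi (z l))).
pose A : R := 1 + \sum_(j < n.+1) (absF (a j) + (absF (a j))^-1).
have K1 : 1 <= K.
  by rewrite lerDl; do 3 (apply: sumr_ge0 => ? _); exact: uabs_ge0.
have A1 : 1 <= A.
  by rewrite lerDl; apply: sumr_ge0 => ? _; rewrite addr_ge0 ?invr_ge0 ?(uabs_ge0 uF).
have leA j : (j <= n)%N -> absF (a j) <= A /\ (absF (a j))^-1 <= A.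
  move=> jn; have nn (i : 'I_n.+1) : 0 <= absF (a i) + (absF (a i))^-1.
    by rewrite addr_ge0 ?invr_ge0 ?(uabs_ge0 uF).
  have : absF (a j) + (absF (a j))^-1 <= A.
    rewrite /A (bigD1 (Ordinal (jn : (j < n.+1)%N))) //=.
    rewrite [leRHS]addrC -[leRHS]addrA lerDl addr_ge0 //. exact: sumr_ge0.
  have := uabs_ge0 uF (a j); have : 0 <= (absF (a j))^-1 by rewrite invr_ge0 (uabs_ge0 uF).
  by move=> h1 h2 h3; split; lra.
(* Small enough for [eta < 1] and [eta * A < A^-1 <= |a j|]. *)
pose eta : R := (A * A * 2)^-1.
have A0 : 0 < A by lra.
have eta0 : 0 < eta by rewrite invr_gt0 !mulr_gt0.
have eta1 : eta * A < (A)^-1.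
  have -> : eta * A = A^-1 / 2 by rewrite /eta; field; rewrite gt_eqF.
  by rewrite gtr_pMr ?invr_gt0 // invf_lt1 //; lra.
have eta_lt1 : eta < 1.
  rewrite invf_lt1 ?mulr_gt0 //; have : 1 * 1 <= A * A by apply: ler_pM.
  by lra.
exists (eta / K); first by rewrite divr_gt0 //; lra.
move=> c hc; set del := \sum_l c l *: z l.
have small (i : 'I_n.+1) j : absF (coord Y j (iter i phi del)) <= eta.
  rewrite /del (semilinear_sum (semilinear_iter sphi i)) linear_sum.
  apply: (uabs_sum_le uF); first exact: ltW.
  move=> l _; rewrite linearZ (uabsM uF) (frob_iter_abs s_abs).
  apply: (@le_trans _ _ (eta / K * K)); last by rewrite divfK // gt_eqF //; lra.
  apply: ler_pM; rewrite ?(uabs_ge0 uF) ?(ltW (hc _)) //.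
  have nn := uabs_ge0 uF; rewrite /K (bigD1 i) //= (bigD1 j) //= (bigD1 l) //=.
  set u := absF _; set u1 := \sum_(_ < m | _) _; set u2 := \sum_(_ < n | _) _.
  set u3 := \sum_(_ < n.+1 | _) _.
  have h1 : 0 <= u1 by apply: sumr_ge0.
  have h2 : 0 <= u2 by do 2 (apply: sumr_ge0 => ? _).
  have h3 : 0 <= u3 by do 3 (apply: sumr_ge0 => ? _).
  by lra.
have iD i x y : iter i phi (x + y) = iter i phi x + iter i phi y.
  exact: (proj1 (semilinear_iter sphi i)).
have coordE (x : 'I_n -> F) (kk : 'I_n) :
    coord Y kk (\sum_(i < n) x i *: iter i phi (e + del)) =
    x kk + \sum_(i < n) x i * coord Y kk (iter i phi del).
  under eq_bigr do rewrite iD scalerDr.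
  rewrite big_split /= linearD /=; congr (_ + _).
    under eq_bigr do rewrite -YE.
    by rewrite coord_sum_free.
  by rewrite linear_sum; apply: eq_bigr => i _; rewrite linearZ.
have small' (i : 'I_n) j : absF (coord Y j (iter i phi del)) <= eta.
  exact: (small (widen_ord (leqnSn n) i)).
case: n => [|n] in an be Sa a0 Y fY YE Yspan K A leA K1 A1 eta A0 eta0 eta1 eta_lt1 hc small coordE small' *.
  by split=> [|a' a'n _ j]; [exact: nil_free|rewrite leqn0 => /eqP ->; rewrite a'n an].
split.
  apply/cyclic_freeP => x Sx.
  have [j maxj] := uabs_max_index x.
  have xj : x j = - \sum_(i < n.+1) x i * coord Y j (iter i phi del).
    by apply/eqP; rewrite -addr_eq0 -coordE Sx linear0.
  have lex : absF (x j) <= absF (x j) * eta.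
    rewrite {1}xj (uabsN uF); apply: (uabs_sum_le uF).
      by rewrite mulr_ge0 ?(uabs_ge0 uF) // ltW.
    by move=> i _; rewrite (uabsM uF) ler_pM ?(uabs_ge0 uF).
  have xj0 : absF (x j) = 0.
    apply/le_anti; rewrite (uabs_ge0 uF) andbT leNgt; apply/negP => h.
    by move: lex; rewrite -[X in X <= _]mulr1 ler_pM2l // leNgt eta_lt1.
  by move=> i; apply/eqP; rewrite -(uabs_eq0 uF) eq_le (uabs_ge0 uF) andbT -xj0.
move=> a' a'n Sa'.
have rel (kk : 'I_n.+1) : a' kk - a kk = - (coord Y kk (iter n.+1 phi del) +
    \sum_(i < n.+1) a' i * coord Y kk (iter i phi del)).
  have c1 : a kk + coord Y kk (iter n.+1 phi e) = 0.
    have := congr1 (coord Y kk) Sa; rewrite big_ord_recr linearD linear0 /= an scale1r.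
    under eq_bigr do rewrite -YE.
    by rewrite coord_sum_free.
  have c2 := congr1 (coord Y kk) Sa'; move: c2.
  rewrite big_ord_recr linearD linear0 /= a'n scale1r (coordE (fun i => a' i)) -iterS iD linearD /=.
  move: c1 => /= /eqP; rewrite addrC addr_eq0 => /eqP ->.
  set u := a' kk; set v := \sum_(_ < _) _; set w := coord _ _ _ => c2.
  have -> : u - a kk = (u + v + (- a kk + w)) - (w + v) by ring.
  by rewrite c2 sub0r.
have [j maxj] := uabs_max_index (fun i : 'I_n.+1 => a' i).
have dif (kk : 'I_n.+1) B : 1 <= B -> absF (a' j) <= B -> absF (a' kk - a kk) <= eta * B.
  move=> B1 hB; have B0 : 0 <= B by lra.
  rewrite rel (uabsN uF); apply: (uabsD_le uF).
    by apply: le_trans (small ord_max kk) _; rewrite ler_peMr // ltW.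
  apply: (uabs_sum_le uF); first by rewrite mulr_ge0 // ltW.
  move=> i _; rewrite (uabsM uF) mulrC; apply: ler_pM; rewrite ?(uabs_ge0 uF) //.
  exact: le_trans (maxj i) hB.
(* A largest coefficient above [A] would equal its own difference with [a j] in absolute value,
   hence be at most [eta] times itself. *)
have a'A : absF (a' j) <= A.
  rewrite leNgt; apply/negP => h.
  have := dif j (absF (a' j)) (le_trans A1 (ltW h)) (lexx _).
  have jn : (j <= n.+1)%N by exact: ltnW.
  have lt1 : absF (a j) < absF (a' j) by apply: le_lt_trans (proj1 (leA j jn)) h.
  rewrite (uabsB_eq uF) // => h2.
  have p0 : 0 < absF (a' j) by lra.
  by move: h2; rewrite -[X in X <= _]mul1r ler_pM2r // leNgt eta_lt1.
move=> i; rewrite leq_eqVlt => /predU1P[->|hi]; first by rewrite a'n an.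
apply: (uabs_near uF); apply: le_lt_trans (dif (Ordinal hi) A A1 a'A) _.
apply: lt_le_trans eta1 _.
have [_ hAi] := leA i (ltnW hi).
rewrite -[leRHS]invrK lef_pV2 ?posrE // invr_gt0 (uabs_gt0 uF) a0 //.
exact: ltnW.
Qed.

End Perturbation.

Lemma is_basis_ext (A : nzRingType) (M : lmodType A) n (b b' : 'I_n -> M) :
  b =1 b' -> is_basis b -> is_basis b'.
Proof.
move=> bb' H x; have [c [xc uc]] := H x.
have e (c' : 'rV_n) : \sum_i c' 0 i *: b i = \sum_i c' 0 i *: b' i.
  by apply: eq_bigr => i _; rewrite bb'.
exists c; split; first by rewrite -e.
by move=> c'; rewrite -e; exact: uc.
Qed.

Section Main.
Variables (R : realType) (p : nat) (F : fieldType) (absF : F -> R).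
Variables (k : fieldType) (res : F -> k).
Hypothesis wF : strict_witt p absF res.
Let uF := sw_abs wF.
Hypothesis absF_p : absF p%:R = p%:R^-1.
Variables (q : nat) (s : {rmorphism F -> F}).
Hypothesis fs : frob_power p absF q s.
Hypothesis s_abs : forall a, absF (s a) = absF a.
Variable X : F.
Hypothesis X1 : absF X = 1.
Hypothesis resX : forall i, (0 < i)%N -> res (s X / X) ^+ i != 1.

Lemma generic_relation (V : vectType F) (phi : {linear V -> V | s \; *:%R}) :
  (forall x, phi x = 0 -> x = 0) ->
  (forall t : R, frobenius_slope absF q phi t -> qpow_rational p q t) ->
  exists (e : V) (a : nat -> F) (d : nat -> int),
  [/\ basis_of fullv (cyclic_seq phi e (dim V)),
      a (dim V) = 1, \sum_(j < (dim V).+1) a j *: iter j phi e = 0,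
      (forall j, (j <= dim V)%N ->
         absF (a j) = absF p%:R ^ partial_sum d (dim V - j)) &
      forall i j, (i <= j)%N -> (j < dim V)%N -> d i <= d j].
Proof.
move=> phi_inj Hs.
have [Z [c [bZ Zc]]] := rational_slopes_eigenbasis wF absF_p fs s_abs phi_inj Hs.
exact: (generic_vector wF fs s_abs X1 resX (linear_sigma_linear phi) bZ Zc).
Qed.

Lemma generic_cyclic_vector_field (V : vectType F) (phi : {linear V -> V | s \; *:%R}) :
  sigma_module phi ->
  (forall t : R, frobenius_slope absF q phi t -> qpow_rational p q t) ->
  exists e : V, generic_cyclic_vector q absF phi e.
Proof.
move=> /sigma_module_inj phi_inj Hs.
have [e [a [d [be a1 Sa aa dm]]]] := generic_relation phi_inj Hs.
have [_ q1 _] := fs; have P01 := sw_p wF.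
have a0 j : (j <= dim V)%N -> a j != 0.
  by move=> jn; rewrite -(uabs_gt0 uF) aa // exprz_gt0 //; case/andP: P01.
exists e; split.
  apply: (is_basis_ext (cyclic_tupleE phi e (n := dim V))).
  exact: (@is_basis_tuple _ _ _ (cyclic_tuple phi e (dim V))).
exists a; first split=> //.
  move: Sa; rewrite big_ord_recr /= a1 scale1r => /eqP.
  by rewrite addrC addr_eq0 => /eqP.
move=> i hi; split; first exact: a0.
exact: (newton_polygon_convex q1 P01 aa a0 dm).
Qed.

Section DenseSubfield.
Variables (C : comNzRingType) (j : {rmorphism C -> F}) (sC : {rmorphism C -> C}).
Hypothesis C_field : forall c : C, c != 0 -> exists c', c' * c = 1.
Hypothesis C_dense : forall (a : F) (eps : R), 0 < eps ->
  exists c, absF (j c - a) < eps.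
Hypothesis j_sigma : forall c, j (sC c) = s (j c).
Variables (M : vectType C) (phi : {linear M -> M | sC \; *:%R}).
Hypothesis M_sigma : sigma_module phi.
Hypothesis M_slopes : forall t : R,
  generic_frobenius_slope absF q j s phi t -> qpow_rational p q t.

Let n := dim M.
Let N : vectType F := 'rV[F]_n.
Let b0 (i : 'I_n) : M := @VectorInternalTheory.r2v C M (delta_mx 0 i).
Let vr (x : M) : 'rV[C]_n := @VectorInternalTheory.v2r C M x.

Let vrD x y : vr (x + y) = vr x + vr y.
Proof. exact: (vector.v2r_semilinear (VectorInternalTheory.v2r_subproof M)).2. Qed.

Let vrZ a x : vr (a *: x) = a *: vr x.
Proof. exact: (vector.v2r_semilinear (VectorInternalTheory.v2r_subproof M)).1. Qed.

(** The scalar extension of [M] is modelled by row vectors over [F], through the coordinates carried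
    by the [vectType] structure of [M]. *)
Definition base_ext (x : M) : 'rV[F]_n := map_mx j (vr x).

Lemma base_ext_is_linear : linear_for (j \; *:%R) base_ext.
Proof.
move=> a x y; rewrite /base_ext vrD vrZ; apply/rowP => i.
by rewrite !mxE rmorphD rmorphM.
Qed.

HB.instance Definition _ :=
  GRing.isLinear.Build C M 'rV[F]_n (j \; *:%R) base_ext base_ext_is_linear.

Definition phi_ext (v : 'rV[F]_n) : 'rV[F]_n :=
  \sum_i s (v 0 i) *: base_ext (phi (b0 i)).

Lemma phi_ext_is_linear : linear_for (s \; *:%R) phi_ext.
Proof.
move=> a x y; rewrite /phi_ext /= scaler_sumr -big_split; apply: eq_bigr => i _ /=.
by rewrite !mxE rmorphD rmorphM scalerDl scalerA.
Qed.

HB.instance Definition _ :=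
  GRing.isLinear.Build F 'rV[F]_n 'rV[F]_n (s \; *:%R) phi_ext phi_ext_is_linear.

Lemma vr_sum (c : 'rV[C]_n) (b : 'I_n -> M) :
  vr (\sum_i c 0 i *: b i) = c *m \matrix_i vr (b i).
Proof.
have vr0 : vr 0 = 0 by rewrite -(scale0r 0) vrZ scale0r.
rewrite (big_morph vr vrD vr0); apply/rowP => l; rewrite summxE !mxE.
by apply: eq_bigr => i _; rewrite vrZ !mxE.
Qed.

Lemma vr_b0 i : vr (b0 i) = delta_mx 0 i.
Proof. exact: (@VectorInternalTheory.r2vK C M). Qed.

Lemma vr_inj : injective vr.
Proof. exact: (can_inj (@VectorInternalTheory.v2rK C M)). Qed.

Lemma b0_sum x : x = \sum_i vr x 0 i *: b0 i.
Proof.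
apply: vr_inj; rewrite vr_sum [LHS](row_sum_delta (vr x)); apply/rowP => l.
rewrite summxE !mxE; apply: eq_bigr => i _; by rewrite !mxE vr_b0 !mxE.
Qed.

Lemma phi_ext_base x : base_ext (phi x) = phi_ext (base_ext x).
Proof.
rewrite {1}[x]b0_sum.
have -> : phi (\sum_i vr x 0 i *: b0 i) = \sum_i sC (vr x 0 i) *: phi (b0 i).
  by rewrite linear_sum; apply: eq_bigr => i _; rewrite linearZ_LR.
rewrite linear_sum /phi_ext; apply: eq_bigr => i _.
by rewrite (linearZ_LR base_ext) /= j_sigma mxE.
Qed.

Lemma iter_phi_ext_base i x : base_ext (iter i phi x) = iter i phi_ext (base_ext x).
Proof. by elim: i => //= i IH; rewrite phi_ext_base IH. Qed.

(** The inverse transition matrix has entries in [C], so invertibility is transported by [j]. *)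
Lemma basis_unitmx (b : 'I_n -> M) : is_basis b ->
  (\matrix_i base_ext (b i)) \in unitmx.
Proof.
move=> bb; pose B := \matrix_i vr (b i).
have H i := cid (bb (b0 i)).
pose B' := \matrix_i projT1 (H i).
have BB : B' *m B = 1%:M.
  apply/row_matrixP => i; rewrite row_mul rowK -vr_sum -(proj1 (projT2 (H i))).
  by rewrite vr_b0 row1.
have : map_mx j B' *m map_mx j B = 1%:M by rewrite -map_mxM BB map_mx1.
move/mulmx1_unit => [_]; congr (_ \in unitmx).
by apply/matrixP => i l; rewrite !mxE.
Qed.

Lemma phi_ext_inj v : phi_ext v = 0 -> v = 0.
Proof.
have [b [bb bphi]] := M_sigma; have uB := basis_unitmx bb; have uP := basis_unitmx bphi.
set B := \matrix_i base_ext (b i) in uB; set Bp := \matrix_i _ in uP.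
pose c := v *m invmx B; have vE : v = \sum_i c 0 i *: base_ext (b i).
  rewrite -[LHS](mulmxKV uB) -/c; apply/rowP => l; rewrite summxE !mxE.
  by apply: eq_bigr => i _; rewrite !mxE.
move=> pv; have : (\row_i s (c 0 i)) *m Bp = 0.
  rewrite -pv vE (semilinear_sum (linear_sigma_linear phi_ext)) /=.
  apply/rowP => l; rewrite summxE !mxE; apply: eq_bigr => i _.
  by rewrite -phi_ext_base !mxE.
move=> /(congr1 (mulmx^~ (invmx Bp))); rewrite mulmxK // mul0mx => c0.
rewrite vE big1 // => i _; have : s (c 0 i) = 0.
  by have := congr1 (fun m : 'rV_n => m 0 i) c0; rewrite !mxE.
by move/eqP; rewrite fmorph_eq0 => /eqP ->; rewrite scale0r.
Qed.

Lemma phi_ext_base_change : @base_change C sC F j s M phi N phi_ext base_ext.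
Proof.
split; last exact: phi_ext_base.
exists b0; split=> [x|x].
  exists (vr x); split; first exact: b0_sum.
  move=> c ->; rewrite vr_sum; apply/rowP => l; rewrite mxE (bigD1 l) //= big1 ?addr0.
    by rewrite mxE vr_b0 mxE !eqxx mulr1.
  by move=> i il; rewrite mxE vr_b0 mxE eqxx /= eq_sym (negPf il) mulr0.
have E (c : 'rV[F]_n) : \sum_i c 0 i *: base_ext (b0 i) = c.
  rewrite [RHS]row_sum_delta; apply: eq_bigr => i _; congr (_ *: _).
  by rewrite /base_ext vr_b0 map_delta_mx.
by exists x; split=> [|c]; rewrite E.
Qed.

(** A generic vector of the scalar extension is approximated coordinatewise from [M]; by the
    perturbation lemma its iterates stay independent over [F] and the coefficients keep their
    absolute values. The relation itself then has to be found over [C]. *)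
Lemma generic_cyclic_vector_dense :
  exists e : M, generic_cyclic_vector q (absF \o j) phi e.
Proof.
have [_ q1 _] := fs; have P01 := sw_p wF.
have Hs t : frobenius_slope absF q (phi_ext : {linear N -> N | s \; *:%R}) t -> qpow_rational p q t.
  move=> Ht; apply: M_slopes; exists N, phi_ext, base_ext; split=> //.
  exact: phi_ext_base_change.
have [e0 [a [d]]] := @generic_relation N phi_ext phi_ext_inj Hs.
have -> : dim N = n by exact: mul1n.
move=> [be a1 Sa aa dm].
have a0 i : (i <= n)%N -> a i != 0.
  by move=> jn; rewrite -(uabs_gt0 uF) aa // exprz_gt0 //; case/andP: P01.
have sphi := linear_sigma_linear (phi_ext : {linear N -> N | s \; *:%R}).
have [eps eps0 Hper] := @generic_perturbation _ _ _ uF s s_abs N phi_ext sphi n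
  (fun l => delta_mx 0 l) e0 a n be a1 Sa a0.
have Hc l : exists c, absF (j c - e0 0 l) < eps by exact: C_dense.
pose e : M := @VectorInternalTheory.r2v C M (\row_l projT1 (cid (Hc l))).
have ee : base_ext e = e0 + \sum_l (j (projT1 (cid (Hc l))) - e0 0 l) *: delta_mx 0 l.
  have -> : \sum_l (j (projT1 (cid (Hc l))) - e0 0 l) *: delta_mx 0 l =
      \row_l (j (projT1 (cid (Hc l))) - e0 0 l) :> 'rV[F]_n.
    by rewrite [RHS]row_sum_delta; apply: eq_bigr => l _; rewrite mxE.
  apply/rowP => l.
  by rewrite /base_ext /vr (@VectorInternalTheory.r2vK C M) !mxE addrC subrK.
have [fe He] := Hper _ (fun l => projT2 (cid (Hc l))).
rewrite -ee in fe He.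
pose W := \matrix_i vr (iter (nat_of_ord i) phi e) : 'M[C]_n.
(* Independence over [F] yields a nonzero determinant in [C], where nonzero elements are invertible,
   so the iterates form a basis over [C]. *)
have dW : \det W != 0.
  apply/eqP => d0; have : \det (map_mx j W) = 0 by rewrite det_map_mx d0 rmorph0.
  move/eqP/det0P => [x x0 xW]; case/eqP: x0; apply/rowP => i; rewrite mxE.
  apply: (elimT (cyclic_freeP _ _ _) fe (fun i => x 0 i)).
  rewrite -[RHS]xW; apply/rowP => l; rewrite summxE !mxE; apply: eq_bigr => i' _.
  by rewrite -iter_phi_ext_base !mxE.
have [w hw] := C_field dW.
pose W' := w *: \adj W.
have WW' : W *m W' = 1%:M by rewrite -scalemxAr mul_mx_adj scale_scalar_mx hw.
have W'W : W' *m W = 1%:M by rewrite -scalemxAl mul_adj_mx scale_scalar_mx hw.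
have cyc : is_basis (fun i : 'I_n => iter i phi e).
  move=> x; exists (vr x *m W'); split.
    by apply: vr_inj; rewrite vr_sum -mulmxA -/W W'W mulmx1.
  by move=> c ->; rewrite vr_sum -mulmxA -/W WW' mulmx1.
exists e; split=> //.
have [c [hc _]] := cyc (iter n phi e).
(* [insub] fails at [i = n], and the default value 1 is the leading coefficient. *)
pose a' i : C := if insub i is Some i' then - c 0 (i' : 'I_n) else 1.
have a'n : a' n = 1 by rewrite /a' insubF ?ltnn.
have a'E (i : 'I_n) : a' i = - c 0 i by rewrite /a' valK.
have rel : iter n phi e = - \sum_(i < n) a' i *: iter i phi e.
  by rewrite {1}hc -sumrN; apply: eq_bigr => i _; rewrite a'E scaleNr opprK.
have relF : \sum_(i < n.+1) j (a' i) *: iter i phi_ext (base_ext e) = 0.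
  apply: (@etrans _ _ (base_ext (\sum_(i < n.+1) a' i *: iter i phi e))); last first.
    by rewrite big_ord_recr /= rel a'n scale1r subrr linear0.
  rewrite [RHS]linear_sum; apply: eq_bigr => i _.
  by rewrite [RHS]linearZ_LR -iter_phi_ext_base.
have absa' i : (i <= n)%N -> absF (j (a' i)) = absF (a i).
  by apply: (He (fun i => j (a' i))); rewrite // a'n rmorph1.
have a'0 i : (i <= n)%N -> a' i != 0.
  move=> hi; apply: contraNneq (a0 i hi) => ai; rewrite -(uabs_eq0 uF) -absa' // ai rmorph0.
  by rewrite (uabs0 uF).
exists a' => // i hi; split; first exact: a'0.
apply: (newton_polygon_convex q1 P01 _ a'0 dm hi) => l hl /=.
by rewrite absa' // aa.
Qed.

End DenseSubfield.
End Main.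

(** * Overconvergent elements *)

Section ValuationRing.
Variables (R : realType) (k : fieldType) (v : k -> \bar R).
Hypothesis v0 : v 0 = +oo%E.
Hypothesis v_fin : forall a, a != 0 -> v a \is a fin_num.
Hypothesis vM : forall a b, v (a * b) = (v a + v b)%E.
Hypothesis vD : forall a b, (Order.min (v a) (v b) <= v (a + b)%R)%E.
Variable w : k.
Hypothesis vw : v w = 1%:E.

Definition vint (x : k) : bool := (0 <= v x)%E.

Lemma v1 : v 1 = 0%:E.
Proof.
have f1 := v_fin (oner_neq0 k); have := vM 1 1; rewrite mulr1.
by rewrite -(fineK f1) -EFinD => -[] e; congr EFin; lra.
Qed.

Lemma vX x n : x != 0 -> v (x ^+ n) = (n%:R * fine (v x))%:E.
Proof.
move=> x0; elim: n => [|n IH]; first by rewrite expr0 v1 mul0r.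
by rewrite exprS vM IH -{1}(fineK (v_fin x0)) -EFinD -natr1 mulrDl mul1r addrC.
Qed.

Lemma vint0 : vint 0. Proof. by rewrite /vint v0 leey. Qed.
Lemma vint1 : vint 1. Proof. by rewrite /vint v1. Qed.
Lemma vintM x y : vint x -> vint y -> vint (x * y).
Proof. by rewrite /vint vM => *; apply: adde_ge0. Qed.
Lemma vintD x y : vint x -> vint y -> vint (x + y).
Proof. by rewrite /vint => hx hy; apply: le_trans (vD x y); rewrite le_min hx hy. Qed.
Lemma vint_w : vint w. Proof. by rewrite /vint vw lee_fin. Qed.
Lemma vintX x n : vint x -> vint (x ^+ n).
Proof. by move=> hx; elim: n => [|n IH]; rewrite ?expr0 ?vint1 // exprS vintM. Qed.

Lemma vint_root x n : (0 < n)%N -> vint (x ^+ n) -> vint x.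
Proof.
move=> n0; have [->|x0] := eqVneq x 0; first by rewrite vint0.
rewrite /vint vX // lee_fin pmulr_rge0 ?ltr0n // => h.
by rewrite -(fineK (v_fin x0)) lee_fin.
Qed.

Lemma vw_neq0 : w != 0.
Proof. by apply/eqP => w0; move: vw; rewrite w0 v0. Qed.

Lemma vint_wX x n : x != 0 -> vint (x * w ^+ n) = (- n%:R <= fine (v x)).
Proof.
move=> x0; rewrite /vint vM vX ?vw_neq0 // vw /= mulr1 -{1}(fineK (v_fin x0)).
by rewrite -EFinD lee_fin -lerBlDr sub0r.
Qed.

Lemma vint_wX_exists x : exists n, vint (x * w ^+ n).
Proof.
have [->|x0] := eqVneq x 0; first by exists 0%N; rewrite mul0r vint0.
exists (Num.bound (- fine (v x))); rewrite vint_wX // lerNl.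
have [h|h] := leP 0 (- fine (v x)); first by apply/ltW/archi_boundP.
by apply: le_trans (ltW h) _.
Qed.

Lemma vint_wX_le x m n : (m <= n)%N -> vint (x * w ^+ m) -> vint (x * w ^+ n).
Proof.
by move=> mn h; rewrite -(subnKC mn) exprD mulrA vintM // vintX // vint_w.
Qed.

Lemma vint_wX_bound (d : nat -> k) N :
  exists b, forall i, (i < N)%N -> vint (d i * w ^+ b).
Proof.
elim: N => [|N [b hb]]; first by exists 0%N.
have [b' hb'] := vint_wX_exists (d N).
exists (b + b')%N => i; rewrite ltnS leq_eqVlt => /orP[/eqP ->|iN].
  exact: vint_wX_le (leq_addl _ _) hb'.
exact: vint_wX_le (leq_addr _ _) (hb i iN).
Qed.

Variables (F : fieldType) (absF : F -> R) (T : k -> F) (pi : F).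

Lemma gamma_alg_conP f : gamma_alg_con absF T pi v f <->
  absF f <= 1 /\ exists (d : nat -> k) (a b : nat),
    teichmuller_expansion absF T pi f d /\ forall i, vint (d i * w ^+ (a * i + b)).
Proof.
split=> [[r r0 [f1 [d dE dc]]]|[f1 [d [a [b [dE dv]]]]]].
  split=> //; move/cvgeyPge: dc => /(_ 0) [N _ HN].
  pose a := Num.bound r^-1.
  have ha : r^-1 < a%:R by apply: archi_boundP; rewrite invr_ge0 ltW.
  have [b hb] := vint_wX_bound d N.
  exists d, a, b; split=> // i.
  have [iN|Ni] := ltnP i N; first exact: vint_wX_le (leq_addl _ _) (hb i iN).
  have [->|di0] := eqVneq (d i) 0; first by rewrite mul0r vint0.
  apply: (@vint_wX_le _ (a * i)); first exact: leq_addr.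
  rewrite vint_wX //.
  have := HN i Ni => /=.
  have hpv : (partial_val v d i <= v (d i))%E.
    by rewrite /partial_val (bigD1 ord_max) //= ge_min lexx.
  have r0' : (0 <= r%:E)%E by rewrite lee_fin ltW.
  move=> h; have := le_trans h (leeD2r _ (lee_wpmul2l r0' hpv)).
  rewrite -(fineK (v_fin di0)) -EFinM -EFinD lee_fin natrM => h2.
  have h3 : - i%:R <= r * fine (v (d i)) by lra.
  have h4 : - (i%:R / r) <= fine (v (d i)).
    by rewrite -mulNr ler_pdivrMr // mulrC.
  by apply: le_trans h4; rewrite lerN2 [leRHS]mulrC ler_wpM2l // ltW.
(* Strictly below [1 / a], so that [n - r (a n + b) = (n - b) / (a + 1)] for this [r] tends to
   infinity up to a constant. *)
pose r : R := (a.+1)%:R^-1.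
have r0 : 0 < r by rewrite invr_gt0.
exists r => //; split=> //; exists d => //.
have hv n : ((- ((a * n + b)%:R))%:E <= partial_val v d n)%E.
  rewrite /partial_val; elim/big_ind: _ => [|x y hx hy|i _]; first by rewrite leey.
    by rewrite le_min hx hy.
  have [->|di0] := eqVneq (d i) 0; first by rewrite v0 leey.
  have : vint (d i * w ^+ (a * n + b)).
    by apply: vint_wX_le (dv i); rewrite leq_add2r leq_mul2l -ltnS ltn_ord orbT.
  by rewrite vint_wX // -(fineK (v_fin di0)) lee_fin.
apply/cvgeyPge => A.
exists (Num.bound (`|A| * (a.+1)%:R + b%:R)) => // n /= hn.
have hn' : `|A| * (a.+1)%:R + b%:R <= n%:R.
  apply: le_trans (ltW (archi_boundP _)) _; first by rewrite addr_ge0 // mulr_ge0.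
  by rewrite ler_nat.
have r0' : (0 <= r%:E)%E by rewrite lee_fin ltW.
apply: le_trans (leeD2r _ (lee_wpmul2l r0' (hv n))).
rewrite -EFinM -EFinD lee_fin natrD natrM.
have ra : r * (a.+1)%:R = 1 by rewrite mulVf // pnatr_eq0.
have : r * (`|A| * (a.+1)%:R + b%:R) <= r * n%:R by rewrite ler_wpM2l // ltW.
have := ler_norm A.
have e1 : n%:R = r * (a.+1)%:R * n%:R by rewrite ra mul1r.
have e2 : `|A| = r * (a.+1)%:R * `|A| by rewrite ra mul1r.
move: e1 e2; rewrite -natr1 => e1 e2 h1 h2; lra.
Qed.

End ValuationRing.

Section PowerSums.
Variables (F : fieldType) (S : F -> Prop) (p : nat).
Hypothesis p_prime : prime p.
Hypothesis S0 : S 0.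
Hypothesis S1 : S 1.
Hypothesis SD : forall x y, S x -> S y -> S (x + y).
Hypothesis SM : forall x y, S x -> S y -> S (x * y).

Lemma closed_pow x n : S x -> S (x ^+ n).
Proof. by move=> Sx; elim: n => [|n IH]; rewrite ?expr0 // exprS; apply: SM. Qed.

Lemma closed_muln x n : S x -> S (x *+ n).
Proof. by move=> Sx; elim: n => [|n IH]; rewrite ?mulr0n // mulrS; apply: SD. Qed.

(** The inner binomial coefficients are divisible by [p], with natural numbers as quotients, so the
    remainder lies in any set closed under sums and products. The set will be [ball0], and the whole
    field for residues. *)
Lemma closed_frob_add x y : S x -> S y ->
  exists2 r, S r & (x + y) ^+ p = x ^+ p + y ^+ p + p%:R * r.
Proof.
move=> Sx Sy; have p0 := prime_gt0 p_prime; have p1 := prime_gt1 p_prime.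
exists (\sum_(1 <= i < p) (x ^+ (p - i) * y ^+ i) *+ ('C(p, i) %/ p)).
  rewrite big_seq; elim/big_ind: _ => // i _.
  by apply/closed_muln/SM; apply: closed_pow.
rewrite exprDn -(big_mkord xpredT (fun i => (x ^+ (p - i) * y ^+ i) *+ 'C(p, i))).
rewrite big_nat_recr //= big_ltn // subn0 bin0 expr0 mulr1 mulr1n subnn binn mul1r mulr1n.
rewrite addrAC; congr (_ + _); rewrite mulr_sumr; apply: eq_big_nat => i /andP[i0 ip].
by rewrite mulr_natl -mulrnA divnK // prime_dvd_bin // i0.
Qed.

Lemma closed_frob_sum (I : Type) (r : seq I) (f : I -> F) : (forall i, S (f i)) ->
  exists2 y, S y & (\sum_(i <- r) f i) ^+ p = \sum_(i <- r) f i ^+ p + p%:R * y.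
Proof.
move=> Sf; elim: r => [|i r [y Sy IH]].
  exists 0 => //; rewrite !big_nil mulr0 addr0 expr0n.
  by rewrite gtn_eqF // prime_gt0.
have Ss : S (\sum_(i <- r) f i) by elim/big_ind: _ => // *; exact: SD.
have [y' Sy' E] := closed_frob_add (Sf i) Ss.
exists (y + y'); first exact: SD.
by rewrite !big_cons E IH mulrDr; ring.
Qed.

End PowerSums.

Section Overconvergent.
Variables (R : realType) (p : nat) (F : fieldType) (absF : F -> R).
Variables (k : fieldType) (res : F -> k).
Hypothesis wF : strict_witt p absF res.
Let uF := sw_abs wF.
Let rF := sw_res wF.
Variables (q : nat) (pq : p.-nat q) (q1 : (1 < q)%N).
Variable pi : F.
Hypothesis pi_unif : is_uniformizer absF pi.
Variables (T : k -> F) (T_teich : teichmuller absF res T).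
Variable v : k -> \bar R.
Hypothesis v0 : v 0 = +oo%E.
Hypothesis v_fin : forall a, a != 0 -> v a \is a fin_num.
Hypothesis vM : forall a b, v (a * b) = (v a + v b)%E.
Hypothesis vD : forall a b, (Order.min (v a) (v b) <= v (a + b)%R)%E.
Variable w : k.
Hypothesis vw : v w = 1%:E.

(* The constants: a subfield containing pi, whose integral elements have
   residues of nonnegative valuation and are q-th powers modulo pi. *)
Variable Kc : set F.
Hypothesis Kc_sub : is_subfield Kc.
Hypothesis Kc_pi : Kc pi.
Hypothesis Kc_res : forall c, Kc c -> absF c <= 1 -> vint v (res c).
Hypothesis Kc_root : forall c n, Kc c -> absF c <= 1 ->
  exists c', [/\ Kc c', absF c' <= 1 & absF (c - c' ^+ (q ^ n)) < 1].

Let vi := vint v.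
Let P := absF pi.

Let P0 : 0 < P. Proof. by case: pi_unif => /andP[]. Qed.
Let P1 : P < 1. Proof. by case: pi_unif => /andP[]. Qed.
Let P01 : 0 <= P < 1. Proof. by rewrite ltW. Qed.
Let pi0 : pi != 0. Proof. by rewrite -(uabs_gt0 uF). Qed.
Let lt1P a : absF a < 1 -> absF a <= P.
Proof. by move=> h; have := uabs_unif_le uF pi_unif (a := a) (b := 1); rewrite (uabs1 uF) mulr1; apply. Qed.

Let T_le1 x : absF (T x) <= 1. Proof. by case: T_teich. Qed.
Let resT x : res (T x) = x. Proof. by case: T_teich. Qed.
Let TM x y : T (x * y) = T x * T y. Proof. by case: T_teich. Qed.

Lemma teich0 : T 0 = 0.
Proof.
have := TM 0 0; rewrite mulr0 => /esym/eqP; rewrite -subr_eq0 -{3}[T 0]mulr1 -mulrBr mulf_eq0 subr_eq0.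
move=> /orP[/eqP //|/eqP T1]; have := resT 0; rewrite T1 (res1 rF) => /eqP.
by rewrite oner_eq0.
Qed.

Lemma teich1 : T 1 = 1.
Proof.
have T10 : T 1 != 0.
  by apply: contraTneq (oner_neq0 k) => T1; rewrite -(resT 1) T1 (res0 uF rF) eqxx.
by apply: (mulfI T10); rewrite -TM !mulr1.
Qed.

Lemma teichX x n : T (x ^+ n) = T x ^+ n.
Proof. by elim: n => [|n IH]; rewrite ?expr0 ?teich1 // !exprS TM IH. Qed.

Lemma teichV x : x != 0 -> T x^-1 = (T x)^-1.
Proof.
move=> x0; have Tx0 : T x != 0.
  by apply: contraNneq x0 => Tx; rewrite -(resT x) Tx (res0 uF rF).
by apply: (mulfI Tx0); rewrite -TM !divff // teich1.
Qed.

Lemma abs_teich x : x != 0 -> absF (T x) = 1.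
Proof. by move=> x0; apply/eqP; rewrite -(res_neq0 rF) ?resT. Qed.

(** The cofactor of [x - y] in [x^p - y^p] is congruent to [p y^(p-1)], hence divisible by [pi]. *)
Lemma pow_close x y N : absF x <= 1 -> absF y <= 1 -> absF (x - y) <= P ^+ N.+1 ->
  absF (x ^+ p - y ^+ p) <= P ^+ N.+2.
Proof.
move=> hx hy hxy; rewrite subrXX (uabsM uF) [P ^+ _.+2]exprSr.
apply: ler_pM; rewrite ?(uabs_ge0 uF) //; apply: lt1P.
have rxy : res x = res y.
  apply/(res_eq uF rF) => //; apply: le_lt_trans hxy _.
  rewrite exprS; apply: le_lt_trans P1.
  by rewrite ler_piMr ?(ltW P0) // exprn_ile1 // ltW.
apply/(res_eq0 rF); first by apply: (uabs_sum_le uF) => // i _; apply: (uabs_le1M uF); apply: (uabs_le1X uF).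
rewrite (res_sum uF rF); last by move=> i; apply: (uabs_le1M uF); apply: (uabs_le1X uF).
have E (i : 'I_p) : res (x ^+ (p.-1 - i) * y ^+ i) = res y ^+ p.-1.
  rewrite (resM rF) ?(uabs_le1X uF) // !(resX uF rF) // rxy -exprD subnK //.
  by rewrite -ltnS prednK ?prime_gt0 ?(sw_prime wF).
rewrite (eq_bigr _ (fun i _ => E i)) sumr_const card_ord.
by rewrite -mulr_natl (eqP (andP (sw_pchar wF)).2) mul0r.
Qed.

Lemma pow_close_iter x y n N : (n <= N)%N -> absF x <= 1 -> absF y <= 1 -> absF (x - y) < 1 ->
  absF (x ^+ (p ^ N) - y ^+ (p ^ N)) <= P ^+ n.+1.
Proof.
move=> nN hx hy hxy.
have : absF (x ^+ (p ^ N) - y ^+ (p ^ N)) <= P ^+ N.+1.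
  elim: N {nN} => [|N IH]; first by rewrite !expr1; exact: lt1P.
  by rewrite expnSr !exprM; apply: pow_close => //; apply: (uabs_le1X uF).
by move/le_trans; apply; rewrite ler_wiXn2l // ?ltW.
Qed.

Let Kc1 : Kc 1. Proof. by case: Kc_sub. Qed.
Let KcB a b : Kc a -> Kc b -> Kc (a - b). Proof. by case: Kc_sub => _ H _ _; exact: H. Qed.
Let KcM a b : Kc a -> Kc b -> Kc (a * b). Proof. by case: Kc_sub => _ _ H _; exact: H. Qed.
Let KcV a : Kc a -> Kc a^-1. Proof. by case: Kc_sub => _ _ _ H; exact: H. Qed.
Let Kc0 : Kc 0. Proof. by rewrite -(subrr 1); apply: KcB. Qed.
Let KcN a : Kc a -> Kc (- a). Proof. by rewrite -sub0r; apply: KcB. Qed.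
Let KcX a n : Kc a -> Kc (a ^+ n).
Proof. by move=> Ka; elim: n => [|n IH]; rewrite ?expr0 // exprS; apply: KcM. Qed.
Let KcD a b : Kc a -> Kc b -> Kc (a + b).
Proof. by move=> Ka Kb; rewrite -[b]opprK; apply/KcB/KcN. Qed.
Let Kcn n : Kc n%:R.
Proof. by elim: n => [|n IH] //; rewrite -natr1; apply: KcD. Qed.

Section Ball.
Variable a : nat.
Let z := pi / T (w ^+ a).
Let wa0 : w ^+ a != 0. Proof. by rewrite expf_neq0 // (vw_neq0 v0 vw). Qed.
Let az : absF z = P. Proof. by rewrite (uabs_div uF) abs_teich // divr1. Qed.
Let z0 : z != 0. Proof. by rewrite -(uabs_gt0 uF) az. Qed.

(* [ball] is a closed subring of the integers all of whose elements have
   overconvergent Teichmueller expansions, with v(d i) >= - a i; it is stable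
   under division by [z] of the elements of norm < 1, because sums of
   Teichmueller lifts of integral residues adding up to 0 are divisible by p in
   [ball]. *)
Inductive ball0 : F -> Prop :=
| ball0_const c : Kc c -> absF c <= 1 -> ball0 c
| ball0_teich x : vi x -> ball0 (T x)
| ball0_z : ball0 z
| ball0D x y : ball0 x -> ball0 y -> ball0 (x + y)
| ball0M x y : ball0 x -> ball0 y -> ball0 (x * y).

Definition ball (f : F) : Prop :=
  forall N, exists2 g, ball0 g & absF (f - g) <= P ^+ N.

Lemma ball0_le1 g : ball0 g -> absF g <= 1.
Proof.
elim=> [c _ //|x _|//||] //; first by rewrite az ltW.
  by move=> x y _ hx _ hy; exact: (uabsD_le uF).
by move=> x y _ hx _ hy; exact: (uabs_le1M uF).
Qed.

Lemma ball0_ball g : ball0 g -> ball g.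
Proof. by move=> Bg N; exists g => //; rewrite subrr (uabs0 uF) exprn_ge0 // ltW. Qed.

Lemma ball_le1 f : ball f -> absF f <= 1.
Proof.
move=> /(_ 0%N)[g Bg h]; rewrite -[f](subrK g); apply: (uabsD_le uF); last exact: ball0_le1.
by rewrite expr0 in h.
Qed.

Lemma ball_lim f : (forall N, exists2 g, ball g & absF (f - g) <= P ^+ N) -> ball f.
Proof.
move=> H N; have [g /(_ N)[g' Bg' h'] h] := H N; exists g' => //.
by rewrite -(subrKA g); apply: (uabsD_le uF).
Qed.

Lemma ballD f g : ball f -> ball g -> ball (f + g).
Proof.
move=> Bf Bg N; have [f' Bf' hf] := Bf N; have [g' Bg' hg] := Bg N.
exists (f' + g'); first exact: ball0D.
by rewrite opprD addrACA; apply: (uabsD_le uF).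
Qed.

Lemma ballM f g : ball f -> ball g -> ball (f * g).
Proof.
move=> Bf Bg N; have [f' Bf' hf] := Bf N; have [g' Bg' hg] := Bg N.
exists (f' * g'); first exact: ball0M.
have -> : f * g - f' * g' = (f - f') * g + f' * (g - g') by ring.
apply: (uabsD_le uF); rewrite (uabsM uF).
  by rewrite -[X in _ <= X]mulr1; apply: ler_pM; rewrite ?(uabs_ge0 uF) // ball_le1.
by rewrite -[X in _ <= X]mul1r; apply: ler_pM; rewrite ?(uabs_ge0 uF) // ball0_le1.
Qed.

Lemma ball_const c : Kc c -> absF c <= 1 -> ball c.
Proof. by move=> *; apply/ball0_ball/ball0_const. Qed.
Lemma ball_teich x : vi x -> ball (T x).
Proof. by move=> *; apply/ball0_ball/ball0_teich. Qed.
Lemma ball0_0 : ball0 0. Proof. by apply: ball0_const; rewrite ?(uabs0 uF). Qed.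
Lemma ball0_1 : ball0 1. Proof. by apply: ball0_const; rewrite ?(uabs1 uF). Qed.
Lemma ball0N f : ball0 f -> ball0 (- f).
Proof.
move=> Bf; rewrite -mulN1r; apply: ball0M => //; apply: ball0_const; first exact: KcN.
by rewrite (uabsN uF) (uabs1 uF).
Qed.
Lemma ballN f : ball f -> ball (- f).
Proof.
move=> Bf; rewrite -mulN1r; apply: ballM => //; apply: ball_const; first exact: KcN.
by rewrite (uabsN uF) (uabs1 uF).
Qed.
Lemma ballX f n : ball f -> ball (f ^+ n).
Proof.
by apply: closed_pow; [exact: ball0_ball ball0_1|exact: ballM].
Qed.

Lemma ball_res f : ball f -> vi (res f).
Proof.
move=> Bf; have [g Bg h] := Bf 1%N.
have -> : res f = res g.
  apply/(res_eq uF rF); [exact: ball_le1|exact: ball0_le1|].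
  by apply: le_lt_trans h _; rewrite expr1.
elim: Bg {h} => [c|x vx||x y Bx hx By hy|x y Bx hx By hy].
- exact: Kc_res.
- by rewrite resT.
- have -> : res z = 0 by apply/(res_eq0 rF); rewrite az // ltW.
  exact: (vint0 v0).
- by rewrite (resD rF) ?ball0_le1 //; exact: vintD.
- by rewrite (resM rF) ?ball0_le1 //; exact: vintM.
Qed.

Lemma ball_div_pi f : ball (f / pi) -> ball (f / z).
Proof.
move=> B; have -> : f / z = (f / pi) * T (w ^+ a).
  by rewrite /z invf_div mulrA mulrAC.
by apply: ballM => //; apply: ball_teich; apply/vintX/vint_w.
Qed.

(** [T (res c)] is the limit of the powers [c'^(q^N)], where [c'] is a constant whose residue is a
    root of order [q^N] of that of [c]; each [c - c'^(q^N)] is a constant divisible by [pi]. *)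
Lemma ball_const_teich c : Kc c -> absF c <= 1 -> ball ((c - T (res c)) / pi).
Proof.
move=> Kcc c1 N; have [c' [Kc' c'1 hc']] := Kc_root N Kcc c1.
exists ((c - c' ^+ (q ^ N)) / pi).
  apply: ball0_const; first by apply/KcM/KcV => //; apply/KcB/KcX.
  by rewrite (uabs_div uF) ler_pdivrMr // mul1r; exact: lt1P.
rewrite -mulrBl.
have -> : c - T (res c) - (c - c' ^+ (q ^ N)) = c' ^+ (q ^ N) - T (res c) by ring.
rewrite (uabs_div uF) ler_pdivrMr // -exprSr.
have -> : res c = res c' ^+ (q ^ N).
  by rewrite -(resX uF rF) //; apply/(res_eq uF rF) => //; exact: (uabs_le1X uF).
rewrite teichX; have [e qe] := p_natP pq.
have e0 : (0 < e)%N by case: e qe q1 => // ->.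
rewrite qe -expnM; apply: pow_close_iter => //; first exact: leq_pmull.
by apply/(res_eq uF rF); rewrite ?resT.
Qed.

(** The p-th roots of the residues also add up to 0, so by induction the sum of their lifts is [p b]
    to precision [N + 1]. Raising to the power [p] gains one unit of precision and returns the
    original sum plus [p r], with [r] in [ball0]. *)
Lemma ball_teich_sum_mod (ys : seq k) N : all vi ys -> \sum_(y <- ys) y = 0 ->
  exists2 b, ball0 b & absF (\sum_(y <- ys) T y - p%:R * b) <= P ^+ N.+1.
Proof.
have pp := sw_prime wF.
elim: N ys => [|N IH] ys vys Sys.
  exists 0; first exact: ball0_0.
  rewrite mulr0 subr0; apply: lt1P; apply/(res_eq0 rF).
    by apply: (uabs_sum_le uF).
  have sum_res : res (\sum_(y <- ys) T y) = \sum_(y <- ys) y.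
    elim: (ys) => [|y ys' IHy]; first by rewrite !big_nil (res0 uF rF).
    by rewrite !big_cons (resD rF) ?resT ?IHy //; apply: (uabs_sum_le uF).
  by rewrite sum_res.
have Hr y := cid (sw_perfect wF y); pose rt y := projT1 (Hr y).
have rtE y : rt y ^+ p = y by exact: projT2 (Hr y).
have [||b Bb hb] := IH [seq rt y | y <- ys].
- apply/allP => _ /mapP[y yys ->]; apply: (vint_root v0 v_fin vM (prime_gt0 pp)).
  by rewrite rtE; exact: (allP vys).
- have [y _] := @closed_frob_sum k (fun=> True) p pp I I (fun _ _ _ _ => I)
    (fun _ _ _ _ => I) _ ys rt (fun=> I).
  rewrite (eqP (andP (sw_pchar wF)).2) mul0r addr0 (eq_bigr _ (fun y _ => rtE y)) Sys big_map.
  by move/eqP; rewrite expf_eq0 => /andP[_ /eqP].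
(* The default 0 makes membership hold for every residue, also those outside the list. *)
have vys' : forall y, ball0 (if vi y then T (rt y) else 0).
  move=> y; case: ifP => vy; last exact: ball0_0.
  by apply/ball0_teich/(vint_root v0 v_fin vM (prime_gt0 pp)); rewrite rtE.
have [r Br Er] := closed_frob_sum pp ball0_0 ball0_1 ball0D ball0M ys vys'.
have E1 : \sum_(y <- ys) (if vi y then T (rt y) else 0) = \sum_(y <- [seq rt y | y <- ys]) T y.
  by rewrite big_map; apply: eq_big_seq => y /(allP vys) ->.
have E2 : \sum_(y <- ys) (if vi y then T (rt y) else 0) ^+ p = \sum_(y <- ys) T y.
  by apply: eq_big_seq => y /(allP vys) ->; rewrite -teichX rtE.
rewrite E1 E2 in Er.
exists (p%:R ^+ p.-1 * b ^+ p - r).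
  apply/ball0D/ball0N => //; apply: ball0M; apply: closed_pow => //;
    try exact: ball0_1; try exact: ball0M.
  by apply: ball0_const; [exact: Kcn|exact: uabs_nat].
have -> : \sum_(y <- ys) T y - p%:R * (p%:R ^+ p.-1 * b ^+ p - r) =
    (\sum_(y <- [seq rt y | y <- ys]) T y) ^+ p - (p%:R * b) ^+ p.
  rewrite Er exprMn mulrBr mulrA -exprS prednK ?prime_gt0 //; ring.
apply: pow_close hb; first exact: (uabs_sum_le uF).
by apply: (uabs_le1M uF); [exact: uabs_nat|exact: ball0_le1].
Qed.

(** Divisibility by [p] implies divisibility by [pi], since [p / pi] is an integral constant. The
    division by [p] loses precision, which the shift [e] compensates. *)
Lemma ball_teich_sum (ys : seq k) : all vi ys -> \sum_(y <- ys) y = 0 ->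
  ball ((\sum_(y <- ys) T y) / pi).
Proof.
move=> vys Sys; have pn0 := sw_p_neq0 wF.
have -> : (\sum_(y <- ys) T y) / pi = (\sum_(y <- ys) T y) / p%:R * (p%:R / pi).
  by rewrite mulrA divfK.
apply: ballM; last first.
  apply: ball_const; first by apply/KcM/KcV.
  by rewrite (uabs_div uF) ler_pdivrMr // mul1r; apply: lt1P; case/andP: (sw_p wF).
have [e Ee] : exists e, P ^+ e <= absF p%:R.
  have [e] := expr_mul_lt 1 P01 (proj1 (andP (sw_p wF))); rewrite mulr1 => /ltW; by exists e.
move=> N; have [b Bb hb] := ball_teich_sum_mod (N + e) vys Sys.
exists b => //; have -> : (\sum_(y <- ys) T y) / p%:R - b = (\sum_(y <- ys) T y - p%:R * b) / p%:R.
  by field.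
rewrite (uabs_div uF) ler_pdivrMr; last by case/andP: (sw_p wF).
apply: le_trans hb _; rewrite -addSn exprD; apply: ler_pM => //; rewrite ?exprn_ge0 ?(ltW P0) //.
by rewrite ler_wiXn2l // ?ltW.
Qed.

(** Modulo [z] the generators are Teichmueller lifts, and sums of such lifts are closed under
    products because [T] is multiplicative. *)
Lemma ball0_decomp g : ball0 g -> exists2 ys, all vi ys &
  ball ((g - \sum_(y <- ys) T y) / z).
Proof.
have Bsum ys : all vi ys -> ball (\sum_(y <- ys) T y).
  move=> vys; rewrite big_seq; elim/big_ind: _; [exact: ball0_ball ball0_0|exact: ballD|].
  by move=> y /(allP vys); exact: ball_teich.
elim=> [c Kcc c1|x vx||x y Bx [xs vxs hx] By [ys vys hy]|x y Bx [xs vxs hx] By [ys vys hy]].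
- exists [:: res c]; first by rewrite /= andbT; exact: Kc_res.
  by rewrite big_seq1; apply/ball_div_pi/ball_const_teich.
- exists [:: x]; first by rewrite /= vx.
  by rewrite big_seq1 subrr mul0r; exact: ball0_ball ball0_0.
- exists [::] => //; rewrite big_nil subr0 divff //; exact: ball0_ball ball0_1.
- exists (xs ++ ys); first by rewrite all_cat vxs.
  by rewrite big_cat opprD addrACA mulrDl; exact: ballD.
exists [seq x' * y' | x' <- xs, y' <- ys].
  apply/allP => _ /allpairsP[[x' y'] /= [hx' hy' ->]].
  by apply: (vintM vM); [exact: (allP vxs)|exact: (allP vys)].
have -> : \sum_(t <- [seq x' * y' | x' <- xs, y' <- ys]) T t =
    (\sum_(t <- xs) T t) * (\sum_(t <- ys) T t).
  rewrite big_allpairs_dep mulr_suml; apply: eq_bigr => x' _.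
  by rewrite mulr_sumr; apply: eq_bigr => y' _; exact: TM.
have -> : (x * y - (\sum_(t <- xs) T t) * (\sum_(t <- ys) T t)) / z =
    ((x - \sum_(t <- xs) T t) / z) * y + (\sum_(t <- xs) T t) * ((y - \sum_(t <- ys) T t) / z).
  by field.
by apply: ballD; apply: ballM => //; [exact: ball0_ball|exact: Bsum].
Qed.

(** Modulo [z], the element is a sum of lifts whose residues add up to its own residue 0, and such a
    sum is divisible. *)
Lemma ball_div_z f : ball f -> absF f < 1 -> ball (f / z).
Proof.
move=> Bf f1.
have B0 g : ball0 g -> absF g < 1 -> ball (g / z).
  move=> Bg g1; have [ys vys hg] := ball0_decomp Bg.
  rewrite -[g](subrK (\sum_(y <- ys) T y)) mulrDl; apply: ballD => //.
  apply/ball_div_pi/ball_teich_sum => //.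
  have sT : absF (\sum_(y <- ys) T y) <= 1 by exact: (uabs_sum_le uF).
  have <- : res (\sum_(y <- ys) T y) = \sum_(y <- ys) y.
    elim: (ys) => [|y ys' IHy]; first by rewrite !big_nil (res0 uF rF).
    by rewrite !big_cons (resD rF) ?resT ?IHy //; apply: (uabs_sum_le uF).
  apply/(res_eq0 rF) => //.
  have -> : \sum_(y <- ys) T y = g - z * ((g - \sum_(y <- ys) T y) / z) by field.
  apply: (uabsB_lt uF) => //; rewrite (uabsM uF) az.
  by apply: le_lt_trans P1; rewrite ler_piMr ?(ltW P0) // ball_le1.
apply: ball_lim => N; have [g Bg hg] := Bf N.+1.
exists (g / z).
  apply: B0 => //; rewrite -[g](subKr f); apply: (uabsB_lt uF) => //.
  apply: le_lt_trans hg _; rewrite exprS; apply: le_lt_trans P1.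
  by rewrite ler_piMr ?(ltW P0) // exprn_ile1 ?ltW.
by rewrite -mulrBl (uabs_div uF) az ler_pdivrMr // -exprSr.
Qed.

(** Division by [z] can be iterated inside the ball, giving an expansion in powers of [z]. As
    [z^i = pi^i / T (w^(a i))], the factor moves into the digit, which becomes
    [res (r i) / w^(a i)]. *)
Lemma ball_expansion f : ball f -> exists2 d : nat -> k,
  teichmuller_expansion absF T pi f d & forall i, vi (d i * w ^+ (a * i)).
Proof.
move=> Bf; pose r i := iter i (fun g => (g - T (res g)) / z) f.
have Br i : ball (r i).
  elim: i => //= i IH; apply: ball_div_z.
    by apply/ballD/ballN/ball_teich/ball_res.
  by apply/(res_eq uF rF); [exact: ball_le1|exact: T_le1|rewrite resT].
have w0 := vw_neq0 v0 vw.
exists (fun i => res (r i) / w ^+ (a * i)); last first.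
  by move=> i; rewrite divfK ?expf_neq0 //; exact: ball_res.
have E N : f - \sum_(i < N) pi ^+ i * T (res (r i) / w ^+ (a * i)) = z ^+ N * r N.
  elim: N => [|N IH]; first by rewrite big_ord0 subr0 mul1r.
  rewrite big_ord_recr /= opprD addrA IH TM teichV ?expf_neq0 // exprM teichX.
  rewrite -/(r N) /z.
  have Tw0 : T (w ^+ a) != 0 by rewrite -(uabs_gt0 uF) abs_teich.
  rewrite exprSr exprMn exprVn. field.
  by rewrite pi0 Tw0 expf_neq0.
apply/cvgrPdist_lt => eps eps0; have [N0 hN0] := expr_mul_lt 1 P01 eps0.
exists N0 => // N /= hN; rewrite sub0r normrN ger0_norm ?(uabs_ge0 uF) // E.
rewrite (uabsM uF) (uabsX uF) az; apply: le_lt_trans hN0.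
apply: ler_pM; rewrite ?(uabs_ge0 uF) ?exprn_ge0 ?(ltW P0) ?ball_le1 //.
by rewrite ler_wiXn2l // ?ltW.
Qed.

Lemma ball_inv h : ball h -> absF (h - 1) < 1 -> ball h^-1.
Proof.
move=> Bh h1; have ah : absF h = 1.
  by rewrite -(uabs1 uF); apply: (uabs_near uF); rewrite (uabs1 uF).
have h0 : h != 0 by rewrite -(uabs_gt0 uF) ah.
apply: ball_lim => N; exists (\sum_(i < N) (1 - h) ^+ i).
  elim/big_ind: _ => [||i _]; [exact: ball0_ball ball0_0|exact: ballD|].
  by apply/ballX/ballD/ballN => //; exact: ball0_ball ball0_1.
have -> : h^-1 - \sum_(i < N) (1 - h) ^+ i = (1 - h) ^+ N / h.
  apply: (mulfI h0); rewrite mulrBr divff // mulrCA divff // mulr1.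
  have -> : (1 - h) ^+ N = ((1 - h) ^+ N - 1) + 1 by rewrite subrK.
  by rewrite subrX1; ring.
rewrite (uabs_div uF) ah divr1 (uabsX uF) (uabs_distC uF); apply: lerXn2r.
- by rewrite nnegrE (uabs_ge0 uF).
- by rewrite nnegrE ltW.
- exact: lt1P.
Qed.

Lemma ball_gamma_con f s : ball f -> gamma_alg_con absF T pi v (f / T (w ^+ s)).
Proof.
move=> Bf; have w0 := vw_neq0 v0 vw; have ws0 : w ^+ s != 0 by rewrite expf_neq0.
apply/(gamma_alg_conP v0 v_fin vM vw); split.
  by rewrite (uabs_div uF) abs_teich // divr1 ball_le1.
have [d dE dv] := ball_expansion Bf.
exists (fun i => d i / w ^+ s), a, s; split; last first.
  by move=> i; rewrite exprD mulrA mulrAC divfK //; exact: dv.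
rewrite /teichmuller_expansion; have -> : (fun N => absF (f / T (w ^+ s) -
    \sum_(i < N) pi ^+ i * T (d i / w ^+ s))) =
    (fun N => absF (f - \sum_(i < N) pi ^+ i * T (d i))) => //.
apply: funext => N; rewrite -[RHS]divr1 -(abs_teich ws0) -(uabs_div uF) mulrBl mulr_suml.
by congr (absF (_ - _)); apply: eq_bigr => i _; rewrite TM teichV // mulrA.
Qed.

End Ball.

(** Truncate the Teichmueller expansion of a multiple [p^m f] of norm at most 1: finitely many
    digits have bounded poles, removed by a single [w^b], so the ball with [a = 0] is enough. *)
Lemma con_inv_dense (f : F) (eps : R) : 0 < eps ->
  exists2 g, gamma_alg_con_inv p absF T pi v g & absF (g - f) < eps.
Proof.
move=> eps0; have /andP[p0 p1] := sw_p wF.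
have p01 : 0 <= absF p%:R < 1 by rewrite (ltW p0).
have [m hm] := expr_mul_lt (absF f) p01 ltr01.
have pm0 : (p%:R ^+ m : F) != 0 by rewrite expf_neq0 // (sw_p_neq0 wF).
pose f' := p%:R ^+ m * f.
have f'1 : absF f' <= 1 by rewrite (uabsM uF) (uabsX uF) ltW.
pose r i := iter i (fun g => (g - T (res g)) / pi) f'.
have r1 i : absF (r i) <= 1.
  elim: i => //= i IH; rewrite (uabs_div uF) ler_pdivrMr // mul1r; apply: lt1P.
  by apply/(res_eq uF rF); [exact: IH|exact: T_le1|rewrite resT].
have E N : f' - \sum_(i < N) pi ^+ i * T (res (r i)) = pi ^+ N * r N.
  elim: N => [|N IH]; first by rewrite big_ord0 subr0 mul1r.
  by rewrite big_ord_recr /= opprD addrA IH -/(r N) exprSr; field.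
have [N hN] := expr_mul_lt (absF p%:R ^- m) P01 eps0.
have [b hb] := vint_wX_bound v0 v_fin vM vw (fun i => res (r i)) N.
pose S := \sum_(i < N) pi ^+ i * T (res (r i)).
have wb0 : w ^+ b != 0 by rewrite expf_neq0 // (vw_neq0 v0 vw).
have Twb : T (w ^+ b) != 0 by rewrite -(uabs_gt0 uF) abs_teich.
exists (S / p%:R ^+ m); last first.
  have -> : S / p%:R ^+ m - f = - ((f' - S) / p%:R ^+ m).
    by rewrite /f'; field.
  rewrite (uabsN uF) E (uabs_div uF) (uabsM uF) !(uabsX uF); apply: le_lt_trans hN.
  rewrite ler_pM2r ?invr_gt0 ?exprn_gt0 // ler_piMr //.
  by rewrite exprn_ge0 // ltW.
exists m; rewrite mulrC divfK //.
have -> : S = (S * T (w ^+ b)) / T (w ^+ b) by rewrite mulfK.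
apply: (@ball_gamma_con 0%N); rewrite /S mulr_suml.
elim/big_ind: _ => [||i _].
- exact: ball0_ball (ball0_0 _).
- exact: ballD.
rewrite -mulrA -TM; apply: ballM.
  by apply: ballX; apply: ball_const => //; exact: ltW.
by apply: ball_teich; exact: hb.
Qed.

(** Factoring out the first nonzero term leaves [h] congruent to 1. Its digits have linearly bounded
    poles with no constant term, so [h] lies in a ball, where the geometric series inverts it. *)
Lemma con_inv_inv g : g != 0 -> gamma_alg_con_inv p absF T pi v g ->
  gamma_alg_con_inv p absF T pi v g^-1.
Proof.
move=> g0 [m Hm]; have pn0 := sw_p_neq0 wF; have w0 := vw_neq0 v0 vw.
set f := p%:R ^+ m * g in Hm.
have f0 : f != 0 by rewrite mulf_neq0 // expf_neq0.
have [f1 [d [a [b [dE dv]]]]] := (gamma_alg_conP v0 v_fin vM vw _ _ _ _).1 Hm.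
have dE' eps : 0 < eps -> exists N0, forall N, (N0 <= N)%N ->
    absF (f - \sum_(i < N) pi ^+ i * T (d i)) < eps.
  move=> eps0; move/cvgrPdist_lt: dE => /(_ eps eps0)[N0 _ H]; exists N0 => N hN.
  by have := H N hN; rewrite /= sub0r normrN ger0_norm ?(uabs_ge0 uF).
have ex : exists i, d i != 0.
  apply: contrapT => H; have d0 i : d i = 0.
    by apply/eqP/negPn/negP => di; apply: H; exists i.
  have [|N0 /(_ N0 (leqnn _))] := dE' (absF f); first by rewrite (uabs_gt0 uF).
  by rewrite big1 ?subr0 ?ltxx // => i _; rewrite d0 teich0 mulr0.
case: (ex_minnP ex) => i0 di0 min_i0.
have d_small i : (i < i0)%N -> d i = 0.
  move=> ii0; apply/eqP/negPn/negP => di; have := min_i0 i di.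
  by rewrite leqNgt ii0.
pose e l := d (i0 + l)%N / d i0.
have [t ht] := vint_wX_exists v0 v_fin vM vw (d i0)^-1.
(* The pole of [e l] is at most [a l + (a i0 + b + t)]; for [l > 0] the constant is absorbed into a
   multiple of [l], and [e 0 = 1]. *)
pose A := (a + (a * i0 + b + t))%N.
have ve l : vi (e l * w ^+ (A * l)).
  case: l => [|l]; first by rewrite muln0 mulr1 /e addn0 divff // /vi (vint1 v_fin vM).
  apply: (@vint_wX_le _ _ _ v_fin vM _ vw _ ((a * (i0 + l.+1) + b) + t)%N).
    have -> : (a * (i0 + l.+1) + b + t = a * l.+1 + (a * i0 + b + t))%N.
      by rewrite mulnDr [(a * i0 + _)%N]addnC -!addnA.
    by rewrite /A mulnDl leq_add2l leq_pmulr.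
  rewrite exprD /e mulrACA; apply: (vintM vM) => //; exact: dv.
pose h := f / (pi ^+ i0 * T (d i0)).
have Td0 : T (d i0) != 0 by rewrite -(uabs_gt0 uF) abs_teich.
have pi0' : pi ^+ i0 != 0 by rewrite expf_neq0.
have Hh N : exists M, (0 < M)%N /\ absF (h - \sum_(l < M) pi ^+ l * T (e l)) <= P ^+ N.
  have [|N0 hN0] := dE' (P ^+ (i0 + N)); first by rewrite exprn_gt0.
  exists N0.+1; split=> //; have hle : (N0 <= i0 + N0.+1)%N by rewrite addnS leqW // leq_addl.
  have := hN0 _ hle; rewrite big_split_ord /= big1 ?add0r; last first.
    by move=> i _; rewrite d_small // teich0 mulr0.
  have -> : f - \sum_(i < N0.+1) pi ^+ (i0 + i) * T (d (i0 + i)%N) =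
      (pi ^+ i0 * T (d i0)) * (h - \sum_(l < N0.+1) pi ^+ l * T (e l)).
    rewrite mulrBr /h mulrC divfK ?mulf_neq0 // mulr_sumr; congr (_ - _).
    apply: eq_bigr => l _; rewrite exprD mulrACA -TM /e [d i0 * _]mulrC divfK //.
  rewrite !(uabsM uF) abs_teich // mulr1 (uabsX uF) exprD => /ltW.
  by rewrite ler_pM2l // exprn_gt0.
have Bterm l : ball0 A (pi ^+ l * T (e l)).
  have wA0 : T (w ^+ A) != 0 by rewrite -(uabs_gt0 uF) abs_teich // expf_neq0.
  have -> : pi ^+ l * T (e l) = (pi / T (w ^+ A)) ^+ l * T (e l * w ^+ (A * l)).
    have -> : T (e l * w ^+ (A * l)) = T (e l) * T (w ^+ A) ^+ l.
      by rewrite TM exprM -teichX.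
    by rewrite exprMn exprVn; field; rewrite expf_neq0.
  apply: ball0M; last exact: ball0_teich.
  apply: closed_pow; [exact: ball0_1|exact: ball0M|exact: ball0_z].
have Bh : ball A h.
  move=> N; have [M [_ hM]] := Hh N; exists (\sum_(l < M) pi ^+ l * T (e l)) => //.
  by elim/big_ind: _ => [||l _]; [exact: ball0_0|exact: ball0D|exact: Bterm].
have h1 : absF (h - 1) < 1.
  have [M [M0 hM]] := Hh 1%N; rewrite expr1 in hM.
  rewrite -(subrKA (\sum_(l < M) pi ^+ l * T (e l))); apply: le_lt_trans P1.
  apply: (uabsD_le uF) => //; case: M M0 {hM} => // M _.
  rewrite big_ord_recl /= expr0 mul1r /e addn0 divff // teich1 addrC addKr.
  apply: (uabs_sum_le uF) => [|l _]; first exact: ltW.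
  rewrite (uabsM uF) (uabsX uF) /bump add1n exprS -mulrA ler_piMr ?(ltW P0) //.
  by rewrite mulr_ile1 ?exprn_ge0 ?(uabs_ge0 uF) ?(ltW P0) // exprn_ile1 // ltW.
have Bi := ball_inv Bh h1.
exists i0.
(* The power [p^i0] turns [pi^(-i0)] into the integral constant [(p / pi)^i0], and [w^t] removes the
   pole of the inverse digit. *)
have -> : p%:R ^+ i0 * g^-1 =
    (p%:R ^+ m * (p%:R / pi) ^+ i0 * T ((d i0)^-1 * w ^+ t) * h^-1) / T (w ^+ t).
  have wt0 : T (w ^+ t) != 0 by rewrite -(uabs_gt0 uF) abs_teich // expf_neq0.
  have pm0 : (p%:R ^+ m : F) != 0 by rewrite expf_neq0.
  rewrite /h /f TM teichV // expr_div_n; field.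
  by rewrite pi0' Td0 wt0 g0 pm0.
apply: (@ball_gamma_con A); apply: ballM => //; apply: ballM; last exact: ball_teich.
apply: ballM; apply: ballX; apply: ball_const; rewrite ?(uabs_nat uF) //.
  by apply/KcM/KcV.
by rewrite (uabs_div uF) ler_pdivrMr // mul1r; apply: lt1P; case/andP: (sw_p wF).
Qed.

End Overconvergent.

(** * The field Gamma^alg[1/p] *)

Lemma cvg_const_eq0 (R : realType) (u : nat -> R) x :
  u @ \oo --> (0 : R) -> (forall n, u n = x) -> x = 0.
Proof.
move=> uc ux; apply/eqP/negPn/negP => x0.
move/cvgrPdist_lt: uc => /(_ `|x|) []; first by rewrite normr_gt0.
by move=> N _ /(_ N (leqnn _)) /=; rewrite ux sub0r normrN ltxx.
Qed.

Lemma sym_sum_single (V : nmodType) (u : int -> V) N :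
  (forall i, i != 0 -> u i = 0) -> sym_sum u N = u 0.
Proof.
move=> u0; have hN : (N < N.*2.+1)%N by rewrite ltnS -addnn leq_addr.
rewrite /sym_sum (bigD1 (Ordinal hN)) //= subrr big1 ?addr0 // => i iN.
by apply: u0; rewrite subr_eq0; apply: contraNneq iN => /eqP iN; apply/eqP/val_inj/eqP.
Qed.

(** * Constants and the Gauss norm in the field of series *)

Section Series.
Variables (R : realType) (K : fieldType) (absK : K -> R) (piK : K).
Hypothesis K_dvf : is_complete_dvf absK piK.
Variables (E : fieldType) (coef : E -> int -> K) (cst : K -> E) (x : E).
Hypothesis E_series : series_field absK coef cst x.

Let uK : ultrametric_abs absK. Proof. by case: K_dvf. Qed.
Let unK : is_uniformizer absK piK. Proof. by case: K_dvf. Qed.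

Lemma coef_cstM c g n : coef (cst c * g) n = c * coef g n.
Proof.
apply/esym/eqP; rewrite -subr_eq0 -(uabs_eq0 uK); apply/eqP.
apply: (cvg_const_eq0 (Defs.coefM E_series (cst c) g n)) => N.
rewrite sym_sum_single; first by rewrite (coef_cst E_series) eqxx subr0.
by move=> i i0; rewrite (coef_cst E_series) (negPf i0) mul0r.
Qed.

Lemma cst1 : cst 1 = 1.
Proof.
have : cst 1 * 1 = 1.
  by apply: (coef_inj E_series); apply: funext => n; rewrite coef_cstM mul1r.
by rewrite mulr1.
Qed.

Lemma cstM a b : cst (a * b) = cst a * cst b.
Proof.
apply: (coef_inj E_series); apply: funext => n; rewrite coef_cstM !(coef_cst E_series).
by case: ifP; rewrite ?mulr0.
Qed.

Lemma cstD a b : cst (a + b) = cst a + cst b.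
Proof.
apply: (coef_inj E_series); apply: funext => n; rewrite (Defs.coefD E_series) !(coef_cst E_series).
by case: ifP; rewrite ?addr0.
Qed.

Lemma cst0 : cst 0 = 0.
Proof. by apply: (addrI (cst 0)); rewrite -cstD !addr0. Qed.

Lemma cstB a b : cst (a - b) = cst a - cst b.
Proof. by apply: (addIr (cst b)); rewrite -cstD !subrK. Qed.

Lemma cstV a : cst a^-1 = (cst a)^-1.
Proof.
have [->|a0] := eqVneq a 0; first by rewrite invr0 cst0 invr0.
have e : cst a * cst a^-1 = 1 by rewrite -cstM divff // cst1.
have ca0 : cst a != 0 by apply: contra_eqN e => /eqP ->; rewrite mul0r eq_sym oner_eq0.
by apply: (mulfI ca0); rewrite e divff.
Qed.

Lemma cst_nat n : cst n%:R = n%:R.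
Proof. by elim: n => [|n IH]; rewrite ?cst0 // -!natr1 cstD IH cst1. Qed.

Lemma gauss_norm_max f n0 : (forall n, absK (coef f n) <= absK (coef f n0)) ->
  gauss_norm absK coef f = absK (coef f n0).
Proof.
move=> H; have ub : ubound (range (fun n => absK (coef f n))) (absK (coef f n0)).
  by move=> _ [n _ <-].
apply/le_anti/andP; split.
  by apply: ge_sup => //; exists (absK (coef f n0)); exists n0.
by apply: ub_le_sup; [exists (absK (coef f n0))|exists n0].
Qed.

Lemma gauss_norm_attained f : exists n0, gauss_norm absK coef f = absK (coef f n0).
Proof.
suff [n0 H] : exists n0, forall n, absK (coef f n) <= absK (coef f n0).
  by exists n0; exact: gauss_norm_max.
have [[n1 hn1]|H] := pselect (exists n, coef f n != 0); last first.
  exists 0 => n; have -> : coef f n = 0.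
    by apply/eqP/negPn/negP => h; apply: H; exists n.
  by rewrite (uabs0 uK) (uabs_ge0 uK).
have [[B HB] _] : series_coefs absK (coef f).
  by apply/(coef_range E_series); exists f.
pose S := range (fun n => absK (coef f n)).
have hsS : has_sup S.
  by split; [exists (absK (coef f n1)); exists n1|exists B => _ [n _ <-]].
have leS n : absK (coef f n) <= sup S by apply: ub_le_sup; [case: hsS|exists n].
have s0 : 0 < sup S by apply: lt_le_trans (leS n1); rewrite (uabs_gt0 uK).
have [/andP[p0 p1] _] := unK.
have e0 : 0 < sup S - absK piK * sup S.
  by rewrite subr_gt0 gtr_pMl.
have [_ [n0 _ <-] hn0] := sup_adherent e0 hsS.
rewrite opprB addrC subrK in hn0.
exists n0 => n; rewrite leNgt; apply/negP => lt.
have := uabs_unif_le uK unK lt; rewrite leNgt; move/negP; apply.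
apply: le_lt_trans hn0; rewrite ler_wpM2l ?(ltW p0) //.
Qed.

Lemma gauss_norm_cst c : gauss_norm absK coef (cst c) = absK c.
Proof.
rewrite (@gauss_norm_max _ 0) (coef_cst E_series) ?eqxx // => n.
by rewrite (coef_cst E_series); case: eqP; rewrite ?(uabs0 uK) ?(uabs_ge0 uK).
Qed.

Lemma gauss_norm_x : gauss_norm absK coef x = 1.
Proof.
rewrite (@gauss_norm_max _ 1) (coef_x E_series) ?eqxx ?(uabs1 uK) // => n.
by rewrite (coef_x E_series); case: eqP; rewrite ?(uabs1 uK) // (uabs0 uK).
Qed.

Lemma frob_cst q (sK : {rmorphism K -> K}) (sE : {rmorphism E -> E}) c :
  series_frobenius absK coef x q sK sE -> sE (cst c) = cst (sK c).
Proof.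
move=> [_ H]; apply: (coef_inj E_series); apply: funext => n.
have := H (cst c) n => /cvg_const_eq0 {}H.
have -> : coef (cst (sK c)) n = sK c * coef 1 n.
  by rewrite -coef_cstM mulr1.
apply/esym/eqP; rewrite -subr_eq0 -(uabs_eq0 uK); apply/eqP; apply: H => N.
rewrite sym_sum_single; first by rewrite (coef_cst E_series) eqxx expr0z.
by move=> i i0; rewrite (coef_cst E_series) (negPf i0) rmorph0 mul0r.
Qed.

End Series.

Section GammaAlg.
Variables (R : realType) (p q : nat).
Hypothesis p_prime : prime p.
Hypothesis q_pow : p.-nat q.
Hypothesis q_gt1 : (1 < q)%N.
Variables (K : fieldType) (absK : K -> R) (piK : K) (sK : {rmorphism K -> K}).
Hypothesis K_dvf : is_complete_dvf absK piK.
Hypothesis absK_p : absK p%:R = p%:R^-1.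
Variables (E : fieldType) (coef : E -> int -> K) (cst : K -> E) (x : E).
Variable sE : {rmorphism E -> E}.
Hypothesis E_series : series_field absK coef cst x.
Variables (G : fieldType) (absG : G -> R) (iota : nat -> {rmorphism E -> G}).
Variables (sG : {rmorphism G -> G}) (kG : fieldType) (res : G -> kG).
Hypothesis G_galg : gamma_alg_field absK coef q sE absG iota sG res.

Let uG := galg_abs G_galg.
Let rG := galg_res G_galg.
Let uK : ultrametric_abs absK. Proof. by case: K_dvf. Qed.
Let pi := iota 0%N (cst piK).

Lemma galg_abs_cst m c : absG (iota m (cst c)) = absK c.
Proof. by rewrite (galg_isometry G_galg) (gauss_norm_cst K_dvf E_series). Qed.

Lemma galg_abs_p : absG p%:R = p%:R^-1.
Proof.
by rewrite -absK_p -(galg_abs_cst 0) (cst_nat K_dvf E_series) rmorph_nat.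
Qed.

Lemma galg_p_lt1 : 0 < absG p%:R < 1.
Proof.
have p1 := prime_gt1 p_prime.
by rewrite galg_abs_p invr_gt0 ltr0n prime_gt0 // invf_lt1 ?ltr1n // ltr0n prime_gt0.
Qed.

(** The value group does not change from [K] on: the Gauss norm is attained by a coefficient, the
    extension [U] is unramified, and [U] is dense. *)
Lemma galg_unif : is_uniformizer absG pi.
Proof.
have [pK HK] : is_uniformizer absK piK by case: K_dvf.
split; rewrite /pi galg_abs_cst // => g g0.
have [U [_ _ _ [Uval _] _] Ud] := galg_unramified G_galg.
have [|u Uu hu] := Ud g (absG g); first by rewrite (uabs_gt0 uG).
have eu : absG u = absG g by apply: (uabs_near uG); rewrite (uabs_distC uG).
have u0 : u != 0 by rewrite -(uabs_gt0 uG) eu (uabs_gt0 uG).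
have [l [m [f ->]] el] := Uval u Uu u0.
have [n0 en] := gauss_norm_attained K_dvf E_series f.
have e : absG g = absK (coef f n0) by rewrite -eu el (galg_isometry G_galg) en.
have c0 : coef f n0 != 0 by rewrite -(uabs_gt0 uK) -e (uabs_gt0 uG).
by have [z ez] := HK _ c0; exists z; rewrite e.
Qed.

(** Completion does not enlarge the residue field: an integral element is congruent to a nearby
    element of [U]. *)
Lemma galg_res_subfield : exists2 U : set G,
  max_unramified absG res [set g | exists m f, g = iota m f] U &
  forall c, sub_residue absG res U c.
Proof.
have [U mU Ud] := galg_unramified G_galg; exists U => // c.
have [a a1 <-] := res_surj rG c.
have [u Uu hu] := Ud a 1 ltr01.
have u1 : absG u <= 1 by rewrite -[u](subKr a); apply: (uabsB_le uG) => //; exact: ltW.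
by exists u => //; apply/esym/(res_eq uG rG).
Qed.

Lemma galg_sep (f : {poly kG}) : separable_poly f -> (1 < size f)%N ->
  exists c, root f c.
Proof.
move=> sf s1; have [U [_ _ _ _ HU] HUr] := galg_res_subfield.
by have [|c _ rc] := HU f _ sf s1; [move=> i; exact: HUr|exists c].
Qed.

Lemma galg_frob_res a : absG a <= 1 -> res (sG a) = res a ^+ q.
Proof.
move=> a1; have [h1 h2] := galg_frobenius G_galg a1.
by rewrite -(resX uG rG) //; apply/(res_eq uG rG) => //; exact: (uabs_le1X uG).
Qed.

(** Residues from the direct limit are q-th powers, because level [m] is the image under [sG] of
    level [m.+1]. So the separable polynomial of [c] is the Frobenius transform of a polynomial [g],
    which is again separable and splits; [c] is the p-th power of a root of [g]. *)
Lemma galg_perfect (c : kG) : exists d, d ^+ p = c.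
Proof.
have chp : p \in [pchar kG].
  rewrite inE p_prime /=; apply/eqP.
  have <- : res p%:R = p%:R.
    elim: (p) => [|n IH]; first exact: (res0 uG rG).
    by rewrite -!natr1 (resD rG) ?(uabs1 uG) ?(uabs_nat uG) // IH (res1 rG).
  by apply/(res_eq0 rG); [exact: uabs_nat|case/andP: galg_p_lt1].
have [U [_ _ _ [_ HU] _] HUr] := galg_res_subfield.
have [f [fL sf fc]] := HU c (HUr c).
have [e qe] := p_natP q_pow; have e0 : (0 < e)%N by case: e qe q_gt1 => // ->.
have Lroot i : exists d, d ^+ p = f`_i.
  have [_ [[m [g ->]] g1] <-] := fL i.
  exists (res (iota m.+1 g) ^+ (p ^ e.-1)).
  rewrite -exprM -expnSr prednK // -qe.
  have eg : iota m g = sG (iota m.+1 g) by rewrite (galg_sigma G_galg) (galg_colim G_galg).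
  rewrite [in RHS]eg galg_frob_res //.
  by rewrite (galg_isometry G_galg) -(galg_isometry G_galg m).
pose rt i := projT1 (cid (Lroot i)).
have rtE i : rt i ^+ p = f`_i by exact: projT2 (cid (Lroot i)).
pose g := \poly_(i < size f) rt i.
have fg : f = map_poly (pFrobenius_aut chp) g.
  apply/polyP => i; rewrite coef_map coef_poly /=; case: ltnP => hi.
    by rewrite pFrobenius_autE rtE.
  by rewrite pFrobenius_aut0 nth_default.
have sg : separable_poly g by rewrite -(separable_map (pFrobenius_aut chp)) -fg.
have [r _ gr] := sep_closed_split galg_sep sg.
have : f %= map_poly (pFrobenius_aut chp) (\prod_(z <- r) ('X - z%:P)).
  by rewrite fg eqp_map.
move/eqp_root => /(_ c); rewrite fc rmorph_prod => /esym.
under eq_bigr do rewrite /= map_polyXsubC.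
rewrite -(big_map _ xpredT (fun y => 'X - y%:P)) root_prod_XsubC => /mapP[y _ ->].
by exists y.
Qed.

Lemma galg_strict_witt : strict_witt p absG res.
Proof.
split.
- exact: p_prime.
- exact: uG.
- exact: galg_complete G_galg.
- exact: rG.
- by exists pi; exact: galg_unif.
- exact: galg_p_lt1.
- exact: galg_sep.
- exact: galg_perfect.
Qed.

Lemma galg_frob_power : frob_power p absG q sG.
Proof. by split=> //; exact: galg_frobenius G_galg. Qed.

(** Units go to units, as [u] and [u^-1] both stay integral; in general a power of [a] is a unit
    times a power of [p], which is fixed. *)
Lemma galg_sigma_abs a : absG (sG a) = absG a.
Proof.
have [->|a0] := eqVneq a 0; first by rewrite rmorph0.
have unit u : absG u = 1 -> absG (sG u) = 1.
  move=> u1; have u0 : u != 0 by rewrite -(uabs_gt0 uG) u1.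
  have hu : absG u <= 1 by rewrite u1.
  have hv : absG u^-1 <= 1 by rewrite (uabsV uG) u1 invr1.
  have [h1 _] := galg_frobenius G_galg hu; have [h2 _] := galg_frobenius G_galg hv.
  apply/le_anti; rewrite h1 /=; rewrite fmorphV (uabsV uG) in h2.
  by move: h2; rewrite invf_le1 // (uabs_gt0 uG) fmorph_eq0.
have [n [c [n0 ec]]] := sw_abs_pow galg_strict_witt a0.
have pc0 : (p%:R : G) ^ c != 0 by rewrite expfz_neq0 // (sw_p_neq0 galg_strict_witt).
have := unit (a ^+ n / p%:R ^ c).
rewrite !(uabs_div uG) (uabsX uG) ec divff ?(uabs_eq0 uG) // => /(_ erefl).
rewrite rmorphM fmorphV rmorphXn /= (rmorph_pz p) (uabs_div uG) (uabsX uG) -ec.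
move=> h; have an0 : absG a ^+ n != 0 by rewrite ec (uabs_eq0 uG).
have /eqP : absG (sG a) ^+ n = absG a ^+ n by rewrite -[LHS](divfK an0) h mul1r.
by rewrite eqrXn2 ?(uabs_ge0 uG) // => /eqP.
Qed.

Variable v : kG -> \bar R.
Hypothesis v_val : residue_valuation absK coef (iota 0%N) res v.

Let w := res (iota 0%N x).

Lemma galg_vw : v w = 1%:E.
Proof.
rewrite /w (val_xadic v_val (n := 1)) //.
- by move=> i; rewrite (coef_x E_series); case: eqP; rewrite ?(uabs1 uK) // (uabs0 uK).
- by rewrite (coef_x E_series) eqxx (uabs1 uK).
by move=> i i1; rewrite (coef_x E_series) lt_eqF // (uabs0 uK).
Qed.

Lemma galg_abs_x : absG (iota 0%N x) = 1.
Proof. by rewrite (galg_isometry G_galg) (gauss_norm_x K_dvf E_series). Qed.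

(** The residue is [w^(q-1)], whose powers have positive valuation. *)
Lemma galg_x_not_root i : (0 < i)%N ->
  res (sG (iota 0%N x) / iota 0%N x) ^+ i != 1.
Proof.
move=> i0; have ax := galg_abs_x; set y := iota 0%N x in ax *.
have ay : absG y <= 1 by rewrite ax.
have w0 : w != 0 by rewrite /w (res_neq0 rG) // ax.
rewrite (resM rG) ?(uabsV uG) ?galg_sigma_abs ?ax ?invr1 // (resV uG rG) // galg_frob_res //.
have -> : res y ^+ q / res y = w ^+ q.-1 by rewrite -{1}(prednK (ltnW q_gt1)) exprSr mulfK.
apply/eqP => /(congr1 v).
have vf := val_fin v_val; have vM := Defs.valM v_val.
rewrite (v1 vf vM) (vX vf vM) ?expf_neq0 // (vX vf vM) // galg_vw /= mulr1 => -[] /eqP.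
rewrite -natrM pnatr_eq0 muln_eq0; case: (i) i0 => // j _ /=.
by case: (q) q_gt1 => [|[]].
Qed.

Lemma galg_colim_iter m n f : iota (m + n)%N (iter n sE f) = iota m f.
Proof. by elim: n => [|n IH]; rewrite ?addn0 // addnS (galg_colim G_galg). Qed.

Lemma galg_sigma_iter m n f : iter n sG (iota m f) = iota m (iter n sE f).
Proof. by elim: n => //= n ->; rewrite (galg_sigma G_galg). Qed.

(** The direct limit of [K] along [sK]. All levels are taken because the residue field of [K] may be
    imperfect, and the roots of order [q^n] of its residues live [n] levels higher. *)
Definition galg_constants : set G := [set g | exists m c, g = iota m (cst c)].

Hypothesis sE_frob : series_frobenius absK coef x q sK sE.

Lemma galg_constants_level m n c : exists c', iota m (cst c) = iota (m + n)%N (cst c').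
Proof.
elim: n => [|n [c' ->]]; first by exists c; rewrite addn0.
exists (sK c'); rewrite addnS -(galg_colim G_galg).
by rewrite (frob_cst K_dvf E_series _ sE_frob).
Qed.

Lemma galg_constants_common a b : galg_constants a -> galg_constants b ->
  exists m c c', a = iota m (cst c) /\ b = iota m (cst c').
Proof.
move=> [m [c ->]] [n [c' ->]]; have [d ->] := galg_constants_level m n c.
have [d' ->] := galg_constants_level n m c'.
by exists (m + n)%N, d, d'; rewrite [(n + m)%N]addnC.
Qed.

Lemma galg_constants_subfield : is_subfield galg_constants.
Proof.
split.
- by exists 0%N, 1; rewrite (cst1 K_dvf E_series) rmorph1.
- move=> a b /galg_constants_common H /H[m [c [c' [-> ->]]]].
  by exists m, (c - c'); rewrite (cstB E_series) rmorphB.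
- move=> a b /galg_constants_common H /H[m [c [c' [-> ->]]]].
  by exists m, (c * c'); rewrite (cstM K_dvf E_series) rmorphM.
- by move=> _ [m [c ->]]; exists m, c^-1; rewrite (cstV K_dvf E_series) fmorphV.
Qed.

(** The same constant placed [n] levels higher is mapped to the given one by the n-th iterate of
    [sG], which raises residues to the power [q^n]. *)
Lemma galg_constants_root c n : galg_constants c -> absG c <= 1 ->
  exists c', [/\ galg_constants c', absG c' <= 1 & absG (c - c' ^+ (q ^ n)) < 1].
Proof.
move=> [m [c0 ->]] c1; exists (iota (m + n)%N (cst c0)).
have c'1 : absG (iota (m + n)%N (cst c0)) <= 1 by rewrite galg_abs_cst -(galg_abs_cst m).
split=> //; first by exists (m + n)%N, c0.
apply/(res_eq uG rG) => //; first exact: (uabs_le1X uG).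
rewrite (resX uG rG) //.
rewrite -(frob_iter_res galg_strict_witt galg_frob_power galg_sigma_abs) //.
by rewrite galg_sigma_iter galg_colim_iter.
Qed.

(** The power [q^m] of the residue comes from level 0, where a constant unit has valuation 0;
    integrality descends to roots. *)
Lemma galg_constants_res c : galg_constants c -> absG c <= 1 -> vint v (res c).
Proof.
move=> [m [c0 ->]] c1.
have qm : (0 < q ^ m)%N by rewrite expn_gt0 (ltnW q_gt1).
have vf := val_fin v_val; have vM := Defs.valM v_val.
apply: (vint_root (val0 v_val) vf vM qm).
rewrite -(frob_iter_res galg_strict_witt galg_frob_power galg_sigma_abs) //.
rewrite galg_sigma_iter -{1}[m]add0n galg_colim_iter.
have c01 : absK c0 <= 1 by rewrite -(galg_abs_cst m).
have [e1|ne] := eqVneq (absK c0) 1; last first.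
  have -> : res (iota 0%N (cst c0)) = 0.
    by apply/(res_eq0 rG); rewrite galg_abs_cst // lt_neqAle ne.
  exact: (vint0 (val0 v_val)).
rewrite /vint (val_xadic v_val (n := 0)) //.
- move=> i; rewrite (coef_cst E_series); case: eqP => // _.
  by rewrite (uabs0 uK).
- by rewrite (coef_cst E_series) eqxx.
by move=> i i0; rewrite (coef_cst E_series) lt_eqF // (uabs0 uK).
Qed.

End GammaAlg.

Theorem theorem5p2 (R : realType) (p q : nat)
  (p_prime : prime p) (q_pow : p.-nat q) (q_gt1 : (1 < q)%N)
  (K : fieldType) (absK : K -> R) (piK : K) (sK : {rmorphism K -> K})
  (K_char0 : [pchar K] =i pred0)
  (K_dvf : is_complete_dvf absK piK)
  (absK_p : absK p%:R = p%:R^-1)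
  (sK_frob : frobenius_lift absK q sK)
  (E : fieldType) (coef : E -> int -> K) (cst : K -> E) (x : E)
  (sE : {rmorphism E -> E})
  (E_series : series_field absK coef cst x)
  (sE_frob : series_frobenius absK coef x q sK sE)
  (G : fieldType) (absG : G -> R) (iota : nat -> {rmorphism E -> G})
  (sG : {rmorphism G -> G}) (kG : fieldType) (res : G -> kG)
  (G_galg : gamma_alg_field absK coef q sE absG iota sG res)
  (v : kG -> \bar R)
  (v_val : residue_valuation absK coef (iota 0%N) res v)
  (T : kG -> G) (T_teich : teichmuller absG res T) :
  (forall (M : vectType G) (phi : {linear M -> M | sG \; *:%R}),
     sigma_module phi ->
     (forall t : R, frobenius_slope absG q phi t -> qpow_rational p q t) ->
     exists e : M, generic_cyclic_vector q absG phi e)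
  /\
  (forall (C : comNzRingType) (j : {rmorphism C -> G})
     (sC : {rmorphism C -> C}),
     injective j ->
     range j = gamma_alg_con_inv p absG T (iota 0%N (cst piK)) v ->
     (forall c, j (sC c) = sG (j c)) ->
   forall (M : vectType C) (phi : {linear M -> M | sC \; *:%R}),
     sigma_module phi ->
     (forall t : R, generic_frobenius_slope absG q j sG phi t ->
        qpow_rational p q t) ->
     exists e : M, generic_cyclic_vector q (absG \o j) phi e).
Proof.
have wG := galg_strict_witt p_prime q_pow q_gt1 K_dvf absK_p E_series G_galg.
have fG := galg_frob_power q_pow q_gt1 G_galg.
have sG_abs := galg_sigma_abs p_prime q_pow q_gt1 K_dvf absK_p E_series G_galg.
have Gp := galg_abs_p K_dvf absK_p E_series G_galg.
have X1 := galg_abs_x K_dvf E_series G_galg.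
have Xr := galg_x_not_root p_prime q_pow q_gt1 K_dvf absK_p E_series G_galg v_val.
split=> [M phi sM Hs|C j sC j_inj j_range j_s M phi sM Hs].
  exact: (generic_cyclic_vector_field wG Gp fG sG_abs X1 Xr sM Hs).
have pi_unif := galg_unif K_dvf E_series G_galg.
have vw := galg_vw K_dvf E_series v_val.
have v0 := val0 v_val; have vf := val_fin v_val; have vM := Defs.valM v_val; have vD := Defs.valD v_val.
have Ks := galg_constants_subfield K_dvf E_series G_galg sE_frob.
have Kr := galg_constants_res p_prime q_pow q_gt1 K_dvf absK_p E_series G_galg v_val.
have Kroot := galg_constants_root p_prime q_pow q_gt1 K_dvf absK_p E_series G_galg.
have Kpi : galg_constants cst iota (iota 0%N (cst piK)) by exists 0%N, piK.
(* What remains is that nonzero elements of [C] are invertible and that the image of [C] is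
   dense. *)
apply: (generic_cyclic_vector_dense wG Gp fG sG_abs X1 Xr _ _ j_s sM Hs).
- move=> c c0; have jc0 : j c != 0 by rewrite -(rmorph0 j) (inj_eq j_inj).
  have jc : gamma_alg_con_inv p absG T (iota 0%N (cst piK)) v (j c).
    by rewrite -j_range; exists c.
  have := con_inv_inv wG q_pow q_gt1 pi_unif T_teich v0 vf vM vD vw Ks Kpi Kr Kroot jc0 jc.
  rewrite -j_range => -[c' _ ec']; exists c'; apply: j_inj.
  by rewrite rmorphM rmorph1 ec' mulVf.
move=> a eps eps0.
have [g] := con_inv_dense wG q_pow q_gt1 pi_unif T_teich v0 vf vM vD vw Ks Kpi Kr Kroot a eps0.
by rewrite -j_range => -[c _ <-] hc; exists c.
Qed.
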